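(* \textsc{Isometric Path Partition} is $\mathsf{W}[1]$-hard when parameterized by the pathwidth of the input graph, and hence also when parameterized by the treewidth of the input graph.
   Context: All graphs are finite, simple and undirected. A path in a graph $G$ is isometric if it is a shortest path in $G$ between its two endpoints. In the problem \textsc{Isometric Path Partition}, the input is a graph $G$ and an integer $k$, and the question is whether the vertex set of $G$ can be partitioned into $k$ sets, each of which is the vertex set of an isometric path of $G$. *)

(* Defs.v *)
(* Library: Mathematical Components, with mathcomp.classical.boolp. *)
From mathcomp Require Import all_boot.
From mathcomp Require Import boolp.

Set Implicit Arguments.
Unset Strict Implicit.
Unset Printing Implicit Defensive.

(** * Random access machines

    Machines are structured programs over finitely many arrays of natural
    numbers (every program mentions finitely many arrays, and a scalar variable
    is an array used only at index 0).  Each command costs one step; the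
    expressions of a fixed program have bounded size.  As the only arithmetic is
    addition and truncated subtraction, [t] steps build numbers of [O(t + log n)]
    bits, so this unit-cost model and Turing machines simulate each other with
    polynomial overhead.  Output is written one bit per step, so that an output
    is never longer than the running time. *)

Definition word := seq bool.

Definition memory := nat -> nat -> nat.

Inductive expr :=
  | Const of nat
  | Read of nat & expr
  | Plus of expr & expr
  | Minus of expr & expr.

Inductive prog :=
  | Assign of nat & expr & expr
  | Emit of expr
  | Seq of prog & prog
  | If of expr & prog & prog
  | While of expr & prog.

Fixpoint eval (m : memory) (e : expr) : nat :=
  match e with
  | Const n => n
  | Read a e1 => m a (eval m e1)
  | Plus e1 e2 => eval m e1 + eval m e2
  | Minus e1 e2 => eval m e1 - eval m e2
  end.

Definition update (m : memory) (a i v : nat) : memory :=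
  fun b j => if (b == a) && (j == i) then v else m b j.

(* [exec p m t m' w]: started in memory [m], the program [p] halts after [t]
   steps in memory [m'], having emitted the word [w]. *)
Inductive exec : prog -> memory -> nat -> memory -> word -> Prop :=
  | ExecAssign m a e1 e2 :
      exec (Assign a e1 e2) m 1 (update m a (eval m e1) (eval m e2)) [::]
  | ExecEmit m e :
      exec (Emit e) m 1 m [:: eval m e != 0]
  | ExecSeq p1 p2 m0 m1 m2 t1 t2 w1 w2 :
      exec p1 m0 t1 m1 w1 -> exec p2 m1 t2 m2 w2 ->
      exec (Seq p1 p2) m0 (t1 + t2).+1 m2 (w1 ++ w2)
  | ExecIfTrue e p1 p2 m t m' w :
      eval m e != 0 -> exec p1 m t m' w ->
      exec (If e p1 p2) m t.+1 m' w
  | ExecIfFalse e p1 p2 m t m' w :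
      eval m e = 0 -> exec p2 m t m' w ->
      exec (If e p1 p2) m t.+1 m' w
  | ExecWhileTrue e p m0 m1 m2 t1 t2 w1 w2 :
      eval m0 e != 0 -> exec p m0 t1 m1 w1 -> exec (While e p) m1 t2 m2 w2 ->
      exec (While e p) m0 (t1 + t2).+1 m2 (w1 ++ w2)
  | ExecWhileFalse e p m :
      eval m e = 0 -> exec (While e p) m 1 m [::].

(* Cell 0 of array 0 holds the length of the input, array 1 holds its bits, and
   every other cell holds 0. *)
Definition input_memory (w : word) : memory :=
  fun a i => match a with
             | 0 => if i == 0 then size w else 0
             | 1 => nth false w i : nat
             | _ => 0
             end.

Definition computes (p : prog) (w : word) (t : nat) (w' : word) : Prop :=
  exists m', exec p (input_memory w) t m' w'.

Definition computable (f : nat -> nat) : Prop :=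
  exists p, forall n, exists t, computes p (nseq n true) t (nseq (f n) true).

(** * Parameterized problems and reductions *)

(* The language of the problem is the set of codes of its yes-instances.  As is
   customary for width parameters, [param] is not required to be computable. *)
Record pproblem := PProblem {
  inst : Type;
  code : inst -> word;
  code_inj : injective code;
  param : inst -> nat;
  yes : inst -> Prop
}.

Definition fpt_reduces (P Q : pproblem) : Prop :=
  exists (R : inst P -> inst Q) (p : prog) (f g : nat -> nat) (c : nat),
    [/\ computable f, computable g &
      forall x : inst P,
        [/\ yes x <-> yes (R x),
            param (R x) <= g (param x) &
            exists2 t, computes p (code x) t (code (R x)) &
                       t <= f (param x) * (size (code x)).+1 ^ c]].

(** * Encodings *)

(* The adjacency matrix of a digraph, row by row. *)
Definition matrix_code n (A : {set 'I_n * 'I_n}) : word :=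
  [seq (i, j) \in A | i <- enum 'I_n, j <- enum 'I_n].

Lemma size_matrix_code n (A : {set 'I_n * 'I_n}) :
  size (matrix_code A) = n * n.
Proof. by rewrite size_allpairs size_enum_ord. Qed.

Lemma matrix_code_inj n : injective (@matrix_code n).
Proof.
move=> A B; rewrite /matrix_code.
rewrite -(map_allpairs (fun x => x \in A) (fun i j => (i, j))).
rewrite -(map_allpairs (fun x => x \in B) (fun i j => (i, j))).
move/eq_in_map=> AB; apply/setP=> -[i j]; apply: AB.
by apply/allpairsP; exists (i, j); rewrite !mem_enum.
Qed.

Lemma unary_prefix_inj m n (s t : word) :
  nseq m true ++ false :: s = nseq n true ++ false :: t -> m = n /\ s = t.
Proof.
elim: m n => [|m IH] [|n] //=; first by case.
by case=> /IH[-> ->].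
Qed.

(** * Boolean circuits and the W-hierarchy *)

(* The nodes are topologically sorted, and the last one is the output node.
   Nodes of in-degree 0 are the inputs, nodes of in-degree 1 are negations, and
   a node [i] of in-degree at least 2 is an and-node if [i \in and_nodes] and an
   or-node otherwise. *)
Record circuit := Circuit {
  csize : nat;
  arcs : {set 'I_csize.+1 * 'I_csize.+1};
  and_nodes : {set 'I_csize.+1};
  arcs_sorted : [forall a in arcs, a.1 < a.2]
}.

Section CircuitDefs.
Variable C : circuit.
Local Notation node := 'I_(csize C).+1.

Definition preds (i : node) : {set node} := [set j | (j, i) \in arcs C].
Definition input_nodes : {set node} := [set i | #|preds i| == 0].
Definition large_node : pred node := fun i => 2 < #|preds i|.
Definition arc : rel node := fun i j => (i, j) \in arcs C.

(* [p] lists the nodes of a path from an input node to the output node, without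
   the input node [i] it starts from. *)
Definition in_out_path (i : node) (p : seq node) : Prop :=
  [/\ i \in input_nodes, path arc i p & last i p = ord_max].

Definition depth_le (d : nat) : Prop :=
  forall i p, in_out_path i p -> size p <= d.

Definition weft_le (t : nat) : Prop :=
  forall i p, in_out_path i p -> count large_node (i :: p) <= t.

(* [v] gives the values computed at all nodes from the values it gives to the
   input nodes. *)
Definition evaluation (v : {ffun node -> bool}) : bool :=
  [forall i, (i \notin input_nodes) ==>
    (v i == if #|preds i| == 1 then [forall j in preds i, ~~ v j]
            else if i \in and_nodes C then [forall j in preds i, v j]
            else [exists j in preds i, v j])].

Definition weighted_sat (k : nat) : Prop :=
  exists v, [/\ evaluation v, v ord_max & #|[set i in input_nodes | v i]| = k].

End CircuitDefs.

(* Weft at most [t] and depth at most [d]. *)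
Definition bounded_circuit (t d : nat) : Type :=
  {C : circuit | `[< weft_le C t /\ depth_le C d >]}.

(* Numbers [k] are coded in unary here and below: only values of [k] up to the
   number of nodes can give yes-instances, so binary coding is equivalent up to
   polynomial-time reductions. *)
Definition circuit_code (x : circuit * nat) : word :=
  let: (C, k) := x in
  nseq (csize C).+1 true ++ false :: matrix_code (arcs C) ++
    [seq i \in and_nodes C | i <- enum 'I_(csize C).+1] ++ nseq k true.

Lemma circuit_code_inj : injective circuit_code.
Proof.
move=> [[m A a sA] k] [[n B b sB] l] /unary_prefix_inj /=[[mn]].
move: B b sB; rewrite -mn => B b sB /eqP.
rewrite eqseq_cat ?size_matrix_code // => /andP[/eqP /matrix_code_inj AB].
rewrite eqseq_cat ?size_map // => /andP[/eqP ab /eqP kl].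
have {}kl : k = l by rewrite -(size_nseq k true) kl size_nseq.
have {}ab : a = b.
  by apply/setP=> i; move/eq_in_map: ab; apply; rewrite mem_enum.
by move: sA sB; rewrite AB ab kl => sA sB; rewrite (bool_irrelevance sA sB).
Qed.

Definition wcs_code t d (x : bounded_circuit t d * nat) : word :=
  circuit_code (sval x.1, x.2).

Lemma wcs_code_inj t d : injective (@wcs_code t d).
Proof.
by move=> [C k] [D l] /circuit_code_inj[/val_inj -> ->].
Qed.

(* Weighted Circuit Satisfiability for circuits of weft at most [t] and depth at
   most [d], parameterized by the weight [k]. *)
Definition WCS (t d : nat) : pproblem :=
  @PProblem (bounded_circuit t d * nat) (@wcs_code t d) (@wcs_code_inj t d)
    (fun x => x.2) (fun x => weighted_sat (sval x.1) x.2).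

Definition in_W (t : nat) (P : pproblem) : Prop :=
  exists d, fpt_reduces P (WCS t d).

Definition W_hard (t : nat) (P : pproblem) : Prop :=
  forall Q : pproblem, in_W t Q -> fpt_reduces Q P.

(** * Graphs, pathwidth and treewidth *)

Record sgraph := SGraph {
  gorder : nat;
  edges : {set 'I_gorder * 'I_gorder};
  edges_sym : [forall i, forall j, ((i, j) \in edges) == ((j, i) \in edges)];
  edges_irr : [forall i, (i, i) \notin edges]
}.

Definition adj (G : sgraph) : rel 'I_(gorder G) :=
  fun i j => (i, j) \in edges G.

Section GraphDefs.
Variables (V : finType) (e : rel V).

(* [x :: p] lists the vertices of a path in order. *)
Definition is_path (x : V) (p : seq V) : bool := path e x p && uniq (x :: p).

Definition isometric_path (x : V) (p : seq V) : Prop :=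
  is_path x p /\
  forall q, is_path x q -> last x q = last x p -> size p <= size q.

Definition isometric_path_partition (k : nat) : Prop :=
  exists P : {set {set V}},
    [/\ partition P [set: V], #|P| = k &
        forall A, A \in P ->
          exists x p, isometric_path x p /\ A = [set y in x :: p]].

Definition width m (X : 'I_m.+1 -> {set V}) : nat := (\max_i #|X i|).-1.

Definition path_decomposition m (X : 'I_m.+1 -> {set V}) : Prop :=
  [/\ forall v, exists i, v \in X i,
      forall u v, e u v -> exists i, (u \in X i) && (v \in X i) &
      forall i j k : 'I_m.+1, i <= j <= k -> X i :&: X k \subset X j].

Definition is_tree (I : finType) (t : rel I) : Prop :=
  [/\ symmetric t, irreflexive t, forall i j, connect t i j &
      forall c : seq I, uniq c -> cycle t c -> size c <= 2].

Definition tree_decomposition m (t : rel 'I_m.+1) (X : 'I_m.+1 -> {set V}) :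
    Prop :=
  [/\ is_tree t,
      forall v, exists i, v \in X i,
      forall u v, e u v -> exists i, (u \in X i) && (v \in X i) &
      forall v i j, v \in X i -> v \in X j ->
        connect [rel a b | [&& t a b, v \in X a & v \in X b]] i j].

Lemma ex_path_decomposition :
  exists w, `[< exists m (X : 'I_m.+1 -> {set V}),
                  path_decomposition X /\ width X = w >].
Proof.
exists (width (fun _ : 'I_1 => [set: V])); apply/asboolP.
exists 0, (fun=> setT); split=> //.
by split=> [v|u v _|i j k _]; try exists ord0; rewrite ?inE // setIid.
Qed.

Lemma ex_tree_decomposition :
  exists w, `[< exists m (t : rel 'I_m.+1) (X : 'I_m.+1 -> {set V}),
                  tree_decomposition t X /\ width X = w >].
Proof.
exists (width (fun _ : 'I_1 => [set: V])); apply/asboolP.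
exists 0, (fun _ _ => false), (fun=> setT); split=> //.
split=> [|v|u v _|v i j _ _]; try by [exists ord0; rewrite !inE].
  split=> // [i j|[|x [|y c]] //=]; first by rewrite !ord1 connect0.
by rewrite !ord1 connect0.
Qed.

(* The graph without vertices gets width 0. *)
Definition pathwidth : nat := ex_minn ex_path_decomposition.
Definition treewidth : nat := ex_minn ex_tree_decomposition.

End GraphDefs.

(** * Isometric Path Partition *)

Definition graph_code (x : sgraph * nat) : word :=
  let: (G, k) := x in
  nseq (gorder G) true ++ false :: matrix_code (edges G) ++ nseq k true.

Lemma graph_code_inj : injective graph_code.
Proof.
move=> [[m A sA iA] k] [[n B sB iB] l] /unary_prefix_inj /=[mn].
move: B sB iB; rewrite -mn => B sB iB /eqP.
rewrite eqseq_cat ?size_matrix_code // => /andP[/eqP /matrix_code_inj AB].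
move/eqP=> kl; have {}kl : k = l by rewrite -(size_nseq k true) kl size_nseq.
move: sA iA sB iB; rewrite AB kl => sA iA sB iB.
by rewrite (bool_irrelevance sA sB) (bool_irrelevance iA iB).
Qed.

Definition IPP (kappa : sgraph -> nat) : pproblem :=
  @PProblem (sgraph * nat) graph_code graph_code_inj
    (fun x => kappa x.1) (fun x => isometric_path_partition (@adj x.1) x.2).

Definition IPP_pathwidth : pproblem := IPP (fun G => pathwidth (@adj G)).
Definition IPP_treewidth : pproblem := IPP (fun G => treewidth (@adj G)).

(* Main.v *)
(** Weighted satisfiability of circuits of weft 1 and bounded depth is first
    expressed by positive clauses over boundedly many variables with values
    [u < m]: a clause is a set of pairs [(i, u)], and an assignment [x] satisfies
    it when it contains some [(i, x i)].  The variables are the chosen inputs and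
    the moves of a prover who defends the value of the output gate; every strategy
    of the challenger gives a clause.

    Each variable becomes a long cyclic track.  A few hubs, adjacent to periodic
    sets of track vertices, create shortcuts such that an arc of a track with more
    than [period] vertices is not isometric, whereas arcs of [period] vertices are
    because the graph folds onto a cycle of length [2 * period - 2].  The number of
    paths leaves no slack, so each track is cut into arcs of exactly [period]
    vertices, and the position of the cuts modulo [period] is the value of the
    variable, the same all along the track.  A checker vertex with a private leaf
    can only be covered by prolonging an arc that ends at one of its neighbours,
    and these are placed so that this means that its clause is satisfied.  Sweeping
    along the tracks gives a path decomposition whose width is linear in the
    number of tracks.

    The reduction is written in a small language of bounded sums, which compiles to
    programs with polynomial running time. *)

From mathcomp Require Import all_boot boolp zify.
Require Import Defs.

Set Implicit Arguments.
Unset Strict Implicit.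
Unset Printing Implicit Defensive.


(** * A language of polynomial-time programs *)

(** Two demands on the neighbours of a checker pull apart. To create no shortcut they must fold to
    one vertex of the cycle, and are chosen as multiples of [cycle_len = 4 * r]; to tell values
    apart they must differ modulo [period = 2 * r + 1]. The two numbers are coprime, so a stretch of
    [cycle_len * period] positions per clause has room for both. A value takes two residues modulo
    [period], because the break at the end of an arc may come just after or just before the
    neighbour of a checker; hence the condition [m <= r]. That there is no slack is a count of
    edges: a partition of [n] vertices into [k] paths has [n - k] edges, a hub or checker lies on at
    most two of them, and every [period] consecutive edges of a track include one outside the paths.
    With [K * arcs_per_track + 4] paths all these bounds are attained; the 4 stands for the paths
    through the hubs and their leaves. At a gate of large in-degree, the replies of the challenger
    to all moves of the prover would make exponentially many strategies. Hence moves down to that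
    gate are variables, whose number depends on the depth alone. *)

Inductive term :=
  | Var of nat
  | Cst of nat
  | Len
  | Bit of term
  | Bin of bool & term & term
  | Sum of term & term.

Definition env := nat -> nat.
Definition push (x : nat) (e : env) : env :=
  fun i => if i is j.+1 then e j else x.

(* De Bruijn indices: [Sum b t] binds variable 0 of [t]. *)
Fixpoint den (w : word) (e : env) (t : term) : nat :=
  match t with
  | Var i => e i
  | Cst c => c
  | Len => size w
  | Bit s => nth false w (den w e s)
  | Bin op s u => if op then den w e s + den w e u else den w e s - den w e u
  | Sum b s => \sum_(x <- iota 0 (den w e b)) den w (push x e) s
  end.

Inductive stmt :=
  | Out of term
  | For of term & stmt
  | Cat of stmt & stmt.

Fixpoint out (w : word) (e : env) (s : stmt) : word :=
  match s with
  | Out t => [:: den w e t != 0]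
  | For b s => flatten [seq out w (push x e) s | x <- iota 0 (den w e b)]
  | Cat s u => out w e s ++ out w e u
  end.

Definition reg (j : nat) : expr := Read j.+2 (Const 0).
Definition set_reg (j : nat) (a : expr) : prog := Assign j.+2 (Const 0) a.

(* [rho] gives the registers of the variables, registers from [n] on are free,
   and the result goes to register [n]. *)
Fixpoint comp (t : term) (rho : seq nat) (n : nat) : prog :=
  match t with
  | Var i => set_reg n (if i < size rho then reg (nth 0 rho i) else Const 0)
  | Cst c => set_reg n (Const c)
  | Len => set_reg n (Read 0 (Const 0))
  | Bit s => Seq (comp s rho n) (set_reg n (Read 1 (reg n)))
  | Bin op s u =>
      Seq (comp s rho n) (Seq (comp u rho n.+1)
        (set_reg n ((if op then Plus else Minus) (reg n) (reg n.+1))))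
  | Sum b s =>
      Seq (comp b rho n) (Seq (set_reg n.+1 (Const 0)) (Seq (set_reg n.+2 (Const 0))
        (Seq (While (Minus (reg n) (reg n.+2))
               (Seq (Seq (comp s (n.+2 :: rho) n.+3)
                         (set_reg n.+1 (Plus (reg n.+1) (reg n.+3))))
                    (set_reg n.+2 (Plus (reg n.+2) (Const 1)))))
             (set_reg n (reg n.+1)))))
  end.

Fixpoint scomp (s : stmt) (rho : seq nat) (n : nat) : prog :=
  match s with
  | Out t => Seq (comp t rho n) (Emit (reg n))
  | For b s =>
      Seq (comp b rho n) (Seq (set_reg n.+2 (Const 0))
        (While (Minus (reg n) (reg n.+2))
               (Seq (scomp s (n.+2 :: rho) n.+3)
                    (set_reg n.+2 (Plus (reg n.+2) (Const 1))))))
  | Cat s u => Seq (scomp s rho n) (scomp u rho n)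
  end.

Definition inp (w : word) (m : memory) : Prop :=
  m 0 0 = size w /\ forall j, m 1 j = nth false w j.

Definition env_ok (rho : seq nat) (n : nat) (m : memory) (e : env) : Prop :=
  all (fun j => j < n) rho /\
  forall i, e i = if i < size rho then m (nth 0 rho i).+2 0 else 0.

Definition agree (n : nat) (m m' : memory) : Prop :=
  forall a, a < n -> forall j, m' a j = m a j.

Lemma agree_trans n m1 m2 m3 : agree n m1 m2 -> agree n m2 m3 -> agree n m1 m3.
Proof. by move=> h12 h23 a an j; rewrite h23 // h12. Qed.

Lemma agreeW n n' m m' : n' <= n -> agree n m m' -> agree n' m m'.
Proof. by move=> nn h a an j; rewrite h //; apply: leq_trans nn. Qed.

Lemma agree_update n m a i v : n <= a -> agree n m (update m a i v).
Proof. by move=> na b bn j; rewrite /update; case: eqP => // ba; lia. Qed.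

Lemma agree_inp n w m m' : agree n.+2 m m' -> inp w m -> inp w m'.
Proof. by move=> mm [h0 h1]; split=> [|j]; rewrite mm. Qed.

Lemma agree_env_ok rho n m m' e :
  agree n.+2 m m' -> env_ok rho n m e -> env_ok rho n m' e.
Proof.
move=> mm [rn h]; split=> // i; rewrite h; case: ifP => // isz.
by rewrite mm // !ltnS; apply: (allP rn); rewrite mem_nth.
Qed.

Lemma env_okW rho n n' m e : n <= n' -> env_ok rho n m e -> env_ok rho n' m e.
Proof.
move=> nn [rn h]; split=> //.
by apply/allP=> j /(allP rn) jn; apply: leq_trans nn.
Qed.

Lemma env_ok_push rho n m e x :
  env_ok rho n m e -> m n.+2 0 = x -> env_ok (n :: rho) n.+1 m (push x e).
Proof.
move=> [rn h] mx; split=> [|[|i]] //=.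
by rewrite ltnSn; apply/allP=> j /(allP rn) /ltnW.
Qed.

Lemma updateE m a i v : update m a i v a i = v.
Proof. by rewrite /update !eqxx. Qed.

Lemma update_neq m a i v b j : b != a -> update m a i v b j = m b j.
Proof. by rewrite /update => /negbTE->. Qed.

(** Register [n] holds the bound and register [x] the counter. The 3 added to the cost [c] of the
    body pays for the increment, the sequencing and the loop test. *)
Lemma loop_exec (body : prog) (n x b c : nat) (I : nat -> memory -> Prop)
    (o : nat -> word) :
    (forall k m, I k m -> m n.+2 0 = b /\ m x.+2 0 = k) ->
    (forall k m, k < b -> I k m -> exists T m',
       [/\ exec body m T m' (o k), T <= c, m' x.+2 0 = k &
           I k.+1 (update m' x.+2 0 k.+1)]) ->
  forall j k m, k + j = b -> I k m -> exists T m',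
    [/\ exec (While (Minus (reg n) (reg x))
               (Seq body (set_reg x (Plus (reg x) (Const 1))))) m T m'
             (flatten [seq o i | i <- iota k j]),
        T <= j * (c + 3) + 1 & I b m'].
Proof.
move=> Iv step; elim=> [|j IH] k m kj Ik; have [mb mk] := Iv _ _ Ik.
  exists 1, m; split=> //; last by rewrite -kj addn0.
  by apply: ExecWhileFalse; rewrite /= mb mk; lia.
have [|T [m1 [ex1 leT m1k I1]]] := step k m _ Ik; first lia.
have [|T2 [m2 [ex2 leT2 I2]]] := IH k.+1 _ _ I1; first lia.
exists ((T + 1).+1 + T2).+1, m2; split=> //; last by lia.
rewrite /=; apply: ExecWhileTrue ex2; first by rewrite /= mb mk; lia.
rewrite -[o k]cats0; apply: ExecSeq ex1 _.
have := ExecAssign m1 x.+2 (Const 0) (Plus (reg x) (Const 1)).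
by rewrite /= m1k addn1.
Qed.

Lemma leq_expW M a b : 1 < M -> a <= b -> M ^ a <= M ^ b.
Proof. by move=> M1 ab; rewrite leq_exp2l. Qed.

Lemma leq_exp_cst M c : 1 < M -> c <= M ^ c.
Proof. by move=> M1; apply/ltnW/ltn_expl. Qed.

Lemma leq_exp_self M c : 1 < M -> M <= M ^ c.+1.
Proof. by move=> M1; rewrite -{1}(expn1 M) leq_expW. Qed.

Lemma leq_exp4 M a : 1 < M -> 4 * M ^ a <= M ^ a.+2.
Proof. by move=> M1; rewrite 2!expnS mulnA leq_mul2r (@leq_mul 2 2) ?orbT. Qed.

(** A Hoare triple with a time bound. The arrays below [n.+2] are the input and the registers of the
    variables in scope; their preservation lets program fragments be composed. *)
Definition run (p : prog) (n : nat) (m : memory) (b : nat) (w : word)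
    (Q : memory -> Prop) : Prop :=
  exists T m', [/\ exec p m T m' w, T <= b, agree n.+2 m m' & Q m'].

Lemma run_seq p1 p2 n m b1 b2 w1 w2 (Q1 Q2 : memory -> Prop) :
  run p1 n m b1 w1 Q1 ->
  (forall m', agree n.+2 m m' -> Q1 m' -> run p2 n m' b2 w2 Q2) ->
  run (Seq p1 p2) n m (b1 + b2).+1 (w1 ++ w2) Q2.
Proof.
move=> [T1 [m1 [ex1 le1 ag1 q1]]] /(_ _ ag1 q1) [T2 [m2 [ex2 le2 ag2 q2]]].
exists (T1 + T2).+1, m2; split=> //; last exact: agree_trans ag2.
  exact: ExecSeq ex2.
by rewrite ltnS leq_add.
Qed.

Lemma run_set n j a m (Q : memory -> Prop) :
  n <= j -> Q (update m j.+2 0 (eval m a)) -> run (set_reg j a) n m 1 [::] Q.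
Proof.
move=> nj q; exists 1, (update m j.+2 0 (eval m a)); split=> //.
  exact: ExecAssign.
by apply: agree_update; lia.
Qed.

Lemma runW p n m b b' w (Q Q' : memory -> Prop) n' :
  run p n' m b w Q -> b <= b' -> n <= n' ->
  (forall m', agree n'.+2 m m' -> Q m' -> Q' m') -> run p n m b' w Q'.
Proof.
move=> [T [m' [ex le ag q]]] bb nn QQ; exists T, m'; split=> //.
- exact: leq_trans bb.
- by apply: agreeW ag.
- exact: QQ.
Qed.

Definition bounded (M : nat) (w : word) (e : env) : Prop :=
  [/\ 1 < M, size w <= M & forall i, e i <= M].

Lemma bounded_exp M w e c : bounded M w e -> 0 < c -> bounded (M ^ c) w e.
Proof.
move=> [M1 wM eM]; case: c => // c _; have MM := leq_exp_self c M1.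
split=> [||i]; [exact: leq_trans MM | exact: leq_trans MM |].
exact: leq_trans (eM i) MM.
Qed.

Lemma bounded_push M w e x : bounded M w e -> x <= M -> bounded M w (push x e).
Proof. by move=> [M1 wM eM] xM; split=> // -[|i] //=. Qed.

(** The exponent depends on the term alone. A variable bound by [Sum] can be as large as the value
    of the bound, so the body is run with [M ^ c.+1] in the role of [M] and the exponents multiply.
    This is why values and running times are bounded together. *)
Lemma comp_ok (t : term) : exists c, forall M w e rho n m,
  bounded M w e -> inp w m -> env_ok rho n m e ->
  den w e t <= M ^ c.+1 /\
  run (comp t rho n) n m (M ^ c.+1) [::] (fun m' => m' n.+2 0 = den w e t).
Proof.
have M0 M c : 1 < M -> 1 < M ^ c.+1.
  by move=> M1; apply: leq_trans (leq_exp_self c M1).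
elim: t => [i|c||s [c IH]|op s [c IHs] u [c' IHu]|b [c IHb] s [c' IHs]] /=.
- exists 0 => M w e rho n m [M1 wM eM] mw [rn mr]; rewrite expn1; split=> //.
  apply: (@runW _ _ _ 1 _ _ (fun m' => m' n.+2 0 = e i) _ n) => //; last lia.
  by apply: run_set; rewrite // updateE mr; case: ifP.
- exists c => M w e rho n m [M1 wM eM] mw [rn mr]; split.
    by apply: leq_trans (leq_exp_cst c M1) _; rewrite leq_expW ?leqnSn.
  apply: (@runW _ _ _ 1 _ _ (fun m' => m' n.+2 0 = c) _ n) => //; last first.
    exact/ltnW/M0.
  by apply: run_set; rewrite // updateE.
- exists 0 => M w e rho n m [M1 wM eM] mw [rn mr]; rewrite expn1; split=> //.
  apply: (@runW _ _ _ 1 _ _ (fun m' => m' n.+2 0 = size w) _ n) => //; last lia.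
  by apply: run_set; rewrite // updateE /=; case: mw.
- exists c.+2 => M w e rho n m Mb mw me.
  have [M1 _ _] := Mb; have [v r] := IH _ _ _ _ _ _ Mb mw me; split.
    by case: (nth _ _ _) => //; apply/ltnW/M0.
  apply: (@runW _ _ _ (M ^ c.+1 + 1).+1 _ _
    (fun m' => m' n.+2 0 = nth false w (den w e s)) _ n) => //; last first.
    by have := leq_exp4 c.+1 M1; have := M0 M c M1; lia.
  apply: (run_seq (w1 := [::]) r) => m' ag q.
  apply: run_set => //; rewrite updateE /= q.
  by have [_ ->] := agree_inp ag mw.
- exists (c + c').+3 => M w e rho n m Mb mw me.
  have [M1 _ _] := Mb; have [v r] := IHs _ _ _ _ _ _ Mb mw me.
  have h1 : M ^ c.+1 <= M ^ (c + c').+1 by apply: leq_expW; lia.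
  have h2 : M ^ c'.+1 <= M ^ (c + c').+1 by apply: leq_expW; lia.
  have hh : M ^ c.+1 + M ^ c'.+1 + 4 <= M ^ (c + c').+4.
    have := leq_exp4 (c + c').+2 M1; have := M0 M (c + c').+1 M1.
    have : M ^ (c + c').+1 <= M ^ (c + c').+2 by apply: leq_expW; lia.
    lia.
  split.
    by have [v' _] := IHu _ _ _ _ _ _ Mb mw me; case: op; lia.
  apply: (@runW _ _ _ (M ^ c.+1 + (M ^ c'.+1 + 1).+1).+1 _ _
    (fun m' => m' n.+2 0 = if op then den w e s + den w e u
                           else den w e s - den w e u) _ n) => //; last first.
    lia.
  apply: (run_seq (w1 := [::]) r) => m' ag q.
  have mw' := agree_inp ag mw; have me' := agree_env_ok ag me.
  have [_ r'] := IHu _ _ _ _ n.+1 _ Mb mw' (env_okW (leqnSn _) me').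
  apply: (run_seq (w1 := [::]) (Q1 := fun m2 => m2 n.+2 0 = den w e s /\
     m2 n.+3 0 = den w e u)).
    by apply: runW r' _ _ _ => // m2 ag2 q2; split=> //; rewrite ag2.
  move=> m2 ag2 [q2 q2']; apply: run_set => //; rewrite updateE.
  by case: (op); rewrite /= q2 q2'.
exists (c + c.+1 * c'.+1 + 4) => M w e rho n m Mb mw me.
have n2 : n <= n.+2 by lia.
have [M1 wM eM] := Mb; have [v r] := IHb _ _ _ _ _ _ Mb mw me.
set B := M ^ c.+1 in v r; set k := den w e b in v r *.
have BB : bounded B w e by apply: bounded_exp.
(* The induction hypothesis bounds the value of the body only in a memory that matches the
   environment; one is made up by writing [x] to the counter register. *)
have vs x : x < k -> den w (push x e) s <= B ^ c'.+1.
  move=> xk; have Bx := bounded_push BB (ltnW (leq_trans xk v)).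
  have okx : env_ok (n.+2 :: rho) n.+3 (update m n.+4 0 x) (push x e).
    apply: env_ok_push; last exact: updateE.
    apply: env_okW n2 _.
    by apply: agree_env_ok me; apply: agree_update; lia.
  have inx : inp w (update m n.+4 0 x).
    by apply: (@agree_inp 0 _ m) mw; apply: agree_update.
  by have [] := IHs _ _ _ _ _ _ Bx inx okx.
have vk j : j <= k -> \sum_(x <- iota 0 j) den w (push x e) s <= j * B ^ c'.+1.
  elim: j => [|j IHj] jk; first by rewrite big_nil.
  rewrite -addn1 iotaD big_cat big_seq1 /= add0n addn1 mulSn addnC.
  by rewrite leq_add ?vs // IHj // ltnW.
set X := B ^ c'.+1 in vs vk.
have B1 : 1 < B by apply: M0.
have BX : B <= X by apply: leq_exp_self.
have le4 : B * X * 16 <= M ^ (c + c.+1 * c'.+1 + 4).+1.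
  have -> : (c + c.+1 * c'.+1 + 4).+1 = c.+1 + c.+1 * c'.+1 + 4 by lia.
  by rewrite !expnD expnM leq_mul // (_ : 16 = 2 ^ 4) // leq_exp2r.
split.
  apply: leq_trans le4; apply: leq_trans (vk _ (leqnn _)) _.
  by rewrite -mulnA leq_mul // leq_pmulr.
apply: (@runW _ _ _ (B + (1 + (1 + ((k * (X + 1).+1 + k * 3 + 1) + 1).+1).+1).+1).+1
  _ _ (fun m' => m' n.+2 0 = \sum_(x <- iota 0 k) den w (push x e) s) _ n) => //; last first.
  by apply: leq_trans le4; nia.
apply: (run_seq (w1 := [::]) r) => m1 ag1 q1.
have mw1 := agree_inp ag1 mw; have me1 := agree_env_ok ag1 me.
apply: (run_seq (w1 := [::]) (Q1 := fun m2 => m2 n.+2 0 = k /\ m2 n.+3 0 = 0)).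
  by apply: run_set; rewrite ?updateE ?update_neq //; lia.
move=> m2 ag2 [q2 q2'].
apply: (run_seq (w1 := [::]) (Q1 := fun m3 => [/\ m3 n.+2 0 = k, m3 n.+3 0 = 0
    & m3 n.+4 0 = 0])).
  by apply: run_set; rewrite ?updateE ?update_neq //; lia.
move=> m3 ag3 [q3 q3' q3''].
have ag13 := agree_trans ag2 ag3.
have mw3 := agree_inp ag13 mw1; have me3 := agree_env_ok ag13 me1.
apply: (run_seq (w1 := [::]) (Q1 := fun m4 =>
    m4 n.+3 0 = \sum_(x <- iota 0 k) den w (push x e) s)); last first.
  by move=> m4 ag4 q4; apply: run_set => //; rewrite updateE.
pose I j m' := [/\ agree n.+2 m3 m', m' n.+2 0 = k, m' n.+4 0 = j &
  m' n.+3 0 = \sum_(x <- iota 0 j) den w (push x e) s].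
have L := @loop_exec (Seq (comp s (n.+2 :: rho) n.+3)
  (set_reg n.+1 (Plus (reg n.+1) (reg n.+3)))) n n.+2 k (X + 1).+1 I (fun=> [::]).
case: (L _ _ k 0 m3) => {L}[j m' []|j m' jk [agj j2 j4 j3]|||T [m' [ex leT [agk _ _ k3]]]] //.
- have mwj := agree_inp agj mw3.
  have okj : env_ok (n.+2 :: rho) n.+3 m' (push j e).
    apply: env_ok_push => //; apply: env_okW n2 _.
    by apply: agree_env_ok agj _.
  have Bj := bounded_push BB (ltnW (leq_trans jk v)).
  have [_ [T [m'' [ex leT ag q]]]] := IHs _ _ _ _ _ _ Bj mwj okj.
  exists (T + 1).+1, (update m'' n.+3 0 (m'' n.+3 0 + m'' n.+3.+2 0)); split.
  + apply: (ExecSeq (w1 := [::])) ex _; exact: ExecAssign.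
  + by rewrite ltnS leq_add2r.
  + by rewrite update_neq ?ag //; lia.
  + split; last 1 first.
    * rewrite update_neq; last lia.
      by rewrite updateE q ag // j3 -[in RHS]addn1 iotaD big_cat big_seq1.
    * apply: agree_trans agj _; apply: agree_trans (agreeW _ ag) _; first lia.
      apply: agree_trans (agree_update _ _ _ _) (agree_update _ _ _ _); lia.
    * by rewrite !update_neq ?ag //; lia.
    * exact: updateE.
- by split=> //; rewrite big_nil.
exists T, m'; split=> //.
  suff -> : [::] = flatten [seq [::] | i <- iota 0 k] :> word by [].
  by elim: (iota 0 k).
lia.
Qed.


Lemma scomp_ok (s : stmt) : exists c, forall M w e rho n m,
  bounded M w e -> inp w m -> env_ok rho n m e ->
  run (scomp s rho n) n m (M ^ c.+1) (out w e s) (fun=> True).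
Proof.
have M0 M c : 1 < M -> 1 < M ^ c.+1.
  by move=> M1; apply: leq_trans (leq_exp_self c M1).
elim: s => [t|t s [c' IHs]|s [c IHs] u [c' IHu]] /=.
- have [c IH] := comp_ok t.
  exists c.+2 => M w e rho n m Mb mw me; have [M1 _ _] := Mb.
  have [_ r] := IH _ _ _ _ _ _ Mb mw me.
  apply: (@runW _ _ _ (M ^ c.+1 + 1).+1 _ _ (fun=> True) _ n) => //; last first.
    by have := leq_exp4 c.+1 M1; have := M0 M c M1; lia.
  apply: (run_seq (w1 := [::]) r) => m' ag q.
  exists 1, m'; split=> //; rewrite -q; exact: (ExecEmit m' (reg n)).
- have [c IHt] := comp_ok t.
  exists (c + c.+1 * c'.+1 + 4) => M w e rho n m Mb mw me.
  have n2 : n <= n.+2 by lia.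
  have [M1 wM eM] := Mb; have [v r] := IHt _ _ _ _ _ _ Mb mw me.
  set B := M ^ c.+1 in v r; set k := den w e t in v r *.
  have BB : bounded B w e by apply: bounded_exp.
  set X := B ^ c'.+1.
  have B1 : 1 < B by apply: M0.
  have BX : B <= X by apply: leq_exp_self.
  have le4 : B * X * 16 <= M ^ (c + c.+1 * c'.+1 + 4).+1.
    have -> : (c + c.+1 * c'.+1 + 4).+1 = c.+1 + c.+1 * c'.+1 + 4 by lia.
    by rewrite !expnD expnM leq_mul // (_ : 16 = 2 ^ 4) // leq_exp2r.
  apply: (@runW _ _ _ (B + (1 + (k * (X + 3) + 1)).+1).+1 _ _ (fun=> True) _ n) => //;
      last first.
    by apply: leq_trans le4; nia.
  apply: (run_seq (w1 := [::]) r) => m1 ag1 q1.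
  have mw1 := agree_inp ag1 mw; have me1 := agree_env_ok ag1 me.
  apply: (run_seq (w1 := [::]) (Q1 := fun m2 => m2 n.+2 0 = k /\ m2 n.+4 0 = 0)).
    by apply: run_set; rewrite ?updateE ?update_neq //; lia.
  move=> m3 ag3 [q3 q3'].
  have mw3 := agree_inp ag3 mw1; have me3 := agree_env_ok ag3 me1.
  pose I j m' := [/\ agree n.+2 m3 m', m' n.+2 0 = k & m' n.+4 0 = j].
  have L := @loop_exec (scomp s (n.+2 :: rho) n.+3) n n.+2 k X I
    (fun j => out w (push j e) s).
  case: (L _ _ k 0 m3) => {L}[j m' []|j m' jk [agj j2 j4]|||T [m' [ex leT [agk _ _]]]] //.
    have mwj := agree_inp agj mw3.
    have okj : env_ok (n.+2 :: rho) n.+3 m' (push j e).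
      apply: env_ok_push => //; apply: env_okW n2 _.
      by apply: agree_env_ok agj _.
    have Bj := bounded_push BB (ltnW (leq_trans jk v)).
    have [T [m'' [ex leT ag q]]] := IHs _ _ _ _ _ _ Bj mwj okj.
    exists T, m''; split=> //; first by rewrite ag.
    split; last by rewrite updateE.
      apply: agree_trans agj _; apply: agree_trans (agreeW _ ag) _; first lia.
      by apply: agree_update; lia.
    by rewrite update_neq ?ag //; lia.
  by exists T, m'; split.
exists (c + c').+3 => M w e rho n m Mb mw me; have [M1 _ _] := Mb.
have h1 : M ^ c.+1 <= M ^ (c + c').+2 by apply: leq_expW; lia.
have h2 : M ^ c'.+1 <= M ^ (c + c').+2 by apply: leq_expW; lia.
apply: (@runW _ _ _ (M ^ c.+1 + M ^ c'.+1).+1 _ _ (fun=> True) _ n) => //; last first.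
  by have := leq_exp4 (c + c').+2 M1; have := M0 M c M1; lia.
apply: run_seq (IHs _ _ _ _ _ _ Mb mw me) _ => m' ag _.
exact: IHu Mb (agree_inp ag mw) (agree_env_ok ag me).
Qed.

(** * Closure properties of polynomial-time functions *)

(** The environment makes the class closed under binders: the body [G w e x] of a sum is admissible
    when [G w (fun i => e i.+1) (e 0)] is, the bound variable having index 0. *)
Definition polytime (F : word -> env -> nat) : Prop :=
  exists t, forall w e, den w e t = F w e.

Definition polytime_word (F : word -> env -> word) : Prop :=
  exists s, forall w e, out w e s = F w e.

Lemma polytime_prog F : polytime_word F -> exists p c, forall w,
  exists2 t, computes p w t (F w (fun=> 0)) & t <= (size w + 2) ^ c.
Proof.
case=> s sF; have [c ok] := scomp_ok s; exists (scomp s [::] 0), c.+1 => w.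
have hb : bounded (size w + 2) w (fun=> 0) by split=> //; lia.
have hi : inp w (input_memory w) by [].
have he : env_ok [::] 0 (input_memory w) (fun=> 0) by [].
have [T [m' [ex leT _ _]]] := ok _ _ _ _ _ _ hb hi he.
by exists T => //; exists m'; rewrite -sF.
Qed.

Lemma polytime_ext F G : (forall w e, F w e = G w e) -> polytime F -> polytime G.
Proof. by move=> FG [t h]; exists t => w e; rewrite h. Qed.

Lemma polytime_var i : polytime (fun w e => e i).
Proof. by exists (Var i). Qed.

Lemma polytime_cst c : polytime (fun w e => c).
Proof. by exists (Cst c). Qed.

Lemma polytime_size : polytime (fun w e => size w).
Proof. by exists Len. Qed.

Lemma polytime_bit F : polytime F -> polytime (fun w e => nth false w (F w e)).
Proof. by case=> t h; exists (Bit t) => w e /=; rewrite h. Qed.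

Lemma polytime_add F G : polytime F -> polytime G ->
  polytime (fun w e => F w e + G w e).
Proof. by case=> t h [u k]; exists (Bin true t u) => w e /=; rewrite h k. Qed.

Lemma polytime_sub F G : polytime F -> polytime G ->
  polytime (fun w e => F w e - G w e).
Proof. by case=> t h [u k]; exists (Bin false t u) => w e /=; rewrite h k. Qed.

Lemma polytime_sum F G : polytime F ->
  polytime (fun w e => G w (fun i => e i.+1) (e 0)) ->
  polytime (fun w e => \sum_(x <- iota 0 (F w e)) G w e x).
Proof.
case=> t h [u k]; exists (Sum t u) => w e /=; rewrite h.
by apply: eq_bigr => x _; rewrite k.
Qed.

(** Terms from outside a binder also occur in its body, where their variables must be shifted. *)
Fixpoint rename (f : nat -> nat) (t : term) : term :=
  match t with
  | Var i => Var (f i)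
  | Cst c => Cst c
  | Len => Len
  | Bit s => Bit (rename f s)
  | Bin op s u => Bin op (rename f s) (rename f u)
  | Sum b s => Sum (rename f b) (rename (fun i => if i is j.+1 then (f j).+1 else 0) s)
  end.

Lemma den_rename w t f e e' : (forall i, e (f i) = e' i) ->
  den w e (rename f t) = den w e' t.
Proof.
elim: t f e e' => [i|c||s IH|op s IHs u IHu|b IHb s IHs] f e e' ef //=.
- by rewrite (IH _ _ _ ef).
- by rewrite (IHs _ _ _ ef) (IHu _ _ _ ef).
rewrite (IHb _ _ _ ef); apply: eq_bigr => x _; apply: IHs.
by case=> [|i] //=.
Qed.

Lemma polytime_rename (f : nat -> nat) F :
  polytime F -> polytime (fun w e => F w (fun i => e (f i))).
Proof. by case=> t h; exists (rename f t) => w e; rewrite -h; apply: den_rename. Qed.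

Lemma polytime_shift F : polytime F -> polytime (fun w e => F w (fun i => e i.+1)).
Proof. exact: (polytime_rename S). Qed.

Lemma polytime_nat (b : word -> env -> bool) (F : word -> env -> nat) :
  (forall w e, F w e = b w e) -> polytime F -> polytime (fun w e => b w e).
Proof. exact: polytime_ext. Qed.

Lemma polytime_neg (b : word -> env -> bool) : polytime (fun w e => b w e) ->
  polytime (fun w e => ~~ b w e).
Proof.
move=> h; apply: polytime_nat (polytime_sub (polytime_cst 1) h) => w e /=.
by case: (b w e).
Qed.

Lemma polytime_leq F G : polytime F -> polytime G ->
  polytime (fun w e => F w e <= G w e).
Proof.
move=> hF hG.
apply: polytime_nat (polytime_sub (polytime_cst 1) (polytime_sub hF hG)) => w e.
by case: leqP; lia.
Qed.

Lemma polytime_mul F G : polytime F -> polytime G ->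
  polytime (fun w e => F w e * G w e).
Proof.
move=> hF hG; apply: polytime_ext
  (polytime_sum (G := fun w e _ => G w e) hF (polytime_shift hG)) => w e.
by rewrite big_const_seq count_predT size_iota iter_addn_0 mulnC.
Qed.

Lemma polytime_and (b c : word -> env -> bool) : polytime (fun w e => b w e) ->
  polytime (fun w e => c w e) -> polytime (fun w e => b w e && c w e).
Proof. by move=> h k; apply: polytime_nat (polytime_mul h k) => w e; rewrite mulnb. Qed.

Lemma polytime_or (b c : word -> env -> bool) : polytime (fun w e => b w e) ->
  polytime (fun w e => c w e) -> polytime (fun w e => b w e || c w e).
Proof.
move=> h k.
apply: polytime_nat (polytime_neg (polytime_and (polytime_neg h) (polytime_neg k))).
by move=> w e; rewrite negb_and !negbK.
Qed.

Lemma polytime_eqn F G : polytime F -> polytime G ->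
  polytime (fun w e => F w e == G w e).
Proof.
move=> h k; apply: polytime_nat (polytime_and (polytime_leq h k) (polytime_leq k h)).
by move=> w e; rewrite eqn_leq.
Qed.

Lemma polytime_ltn F G : polytime F -> polytime G ->
  polytime (fun w e => F w e < G w e).
Proof.
move=> h k; apply: polytime_nat (polytime_neg (polytime_leq k h)) => w e.
by rewrite -ltnNge.
Qed.

Lemma polytime_succ F : polytime F -> polytime (fun w e => (F w e).+1).
Proof.
by move=> h; apply: polytime_ext (polytime_add h (polytime_cst 1)) => w e; rewrite addn1.
Qed.

Lemma polytime_pred F : polytime F -> polytime (fun w e => (F w e).-1).
Proof.
by move=> h; apply: polytime_ext (polytime_sub h (polytime_cst 1)) => w e; rewrite subn1.
Qed.

Lemma polytime_if (b : word -> env -> bool) F G : polytime (fun w e => b w e) ->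
  polytime F -> polytime G -> polytime (fun w e => if b w e then F w e else G w e).
Proof.
move=> h k l; apply: polytime_ext (polytime_add (polytime_mul h k)
  (polytime_mul (polytime_neg h) l)) => w e.
by case: (b w e); rewrite !(mul1n, mul0n) ?addn0.
Qed.

Lemma polytime_ifb (b c d : word -> env -> bool) : polytime (fun w e => b w e) ->
  polytime (fun w e => c w e) -> polytime (fun w e => d w e) ->
  polytime (fun w e => if b w e then c w e else d w e).
Proof.
move=> h k l; apply: polytime_nat (polytime_if h k l) => w e.
by case: (b w e).
Qed.

Lemma polytime_has F (b : word -> env -> nat -> bool) : polytime F ->
  polytime (fun w e => b w (fun i => e i.+1) (e 0)) ->
  polytime (fun w e => has (b w e) (iota 0 (F w e))).
Proof.
move=> h k; apply: polytime_nat (polytime_ltn (polytime_cst 0)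
  (polytime_sum (G := fun w e x => b w e x) h k)) => w e.
by rewrite has_count -sum1_count [in RHS]big_mkcond; congr (0 < _ : bool).
Qed.

Lemma polytime_all F (b : word -> env -> nat -> bool) : polytime F ->
  polytime (fun w e => b w (fun i => e i.+1) (e 0)) ->
  polytime (fun w e => all (b w e) (iota 0 (F w e))).
Proof.
move=> h k; apply: polytime_nat (polytime_neg
  (polytime_has (b := fun w e x => ~~ b w e x) h (polytime_neg k))) => w e.
by rewrite has_predC negbK.
Qed.

(** This brings bounded search into the language of sums: each position before the first hit, and no
    other, contributes 1. *)
Lemma find_sum (b : pred nat) n :
  find b (iota 0 n) = \sum_(x <- iota 0 n) all (fun y => ~~ b y) (iota 0 x.+1).
Proof.
elim: n => [|n IH]; first by rewrite big_nil.
rewrite -addn1 iotaD find_cat big_cat big_seq1 -IH add0n /= size_iota.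
have -> : ~~ b 0 && all (fun y => ~~ b y) (iota 1 n) =
          ~~ has b (iota 0 n) && ~~ b n.
  rewrite -[LHS]/(all (predC b) (iota 0 n.+1)) all_predC -addn1 iotaD has_cat /=.
  by rewrite orbF add0n negb_or.
case: ifPn => hb /=; first by rewrite addn0.
by rewrite hasNfind // size_iota; case: (b n).
Qed.

Lemma polytime_find F (b : word -> env -> nat -> bool) : polytime F ->
  polytime (fun w e => b w (fun i => e i.+1) (e 0)) ->
  polytime (fun w e => find (b w e) (iota 0 (F w e))).
Proof.
move=> h k; apply: polytime_ext; first by move=> w e; rewrite find_sum; reflexivity.
apply: (polytime_sum (G := fun w e x => all (fun y => ~~ b w e y) (iota 0 x.+1))) => //.
apply: (polytime_all (b := fun w e y => ~~ b w (fun i => e i.+1) y)).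
  exact/polytime_succ/polytime_var.
exact/polytime_neg/(polytime_rename (fun i => if i is j.+1 then j.+2 else 0) k).
Qed.


Lemma polytime_div F G : polytime F -> polytime G ->
  polytime (fun w e => F w e %/ G w e).
Proof.
move=> hF hG.
(* The quotient is the least [q] with [F < q.+1 * G]. For a zero divisor this search fails, hence
   the case distinction below. *)
have h : polytime (fun w e => find (fun q => F w e < q.+1 * G w e) (iota 0 (F w e).+1)).
  apply: (polytime_find (b := fun w e q => F w e < q.+1 * G w e)).
    exact: polytime_succ.
  apply: polytime_ltn (polytime_shift hF) _.
  exact: polytime_mul (polytime_succ (polytime_var 0)) (polytime_shift hG).
apply: polytime_ext (polytime_if (polytime_eqn hG (polytime_cst 0)) (polytime_cst 0) h).
move=> w e; case: eqP => [->|/eqP G0]; first by rewrite divn0.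
set v := F w e; set d := G w e in G0 *.
have d0 : 0 < d by rewrite lt0n.
have hq : v %/ d < v.+1 by rewrite ltnS leq_div.
apply/eqP; rewrite eqn_leq; apply/andP; split.
  rewrite leqNgt; apply/negP => /(before_find 0) /negbT /negP; apply.
  by rewrite nth_iota // add0n ltn_ceil.
have hs : has (fun q => v < q.+1 * d) (iota 0 v.+1).
  by apply/hasP; exists (v %/ d); rewrite ?mem_iota // ltn_ceil.
have := nth_find 0 hs; rewrite has_find size_iota in hs.
by rewrite nth_iota // add0n -ltn_divLR.
Qed.

Lemma polytime_mod F G : polytime F -> polytime G ->
  polytime (fun w e => F w e %% G w e).
Proof.
move=> hF hG.
apply: polytime_ext (polytime_sub hF (polytime_mul (polytime_div hF hG) hG)) => w e.
by rewrite {1}(divn_eq (F w e) (G w e)) addKn.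
Qed.

Lemma polytime_exp F c : polytime F -> polytime (fun w e => F w e ^ c).
Proof.
move=> h; elim: c => [|c IH]; first exact: polytime_cst.
by apply: polytime_ext (polytime_mul h IH) => w e; rewrite expnS.
Qed.

(** A strict inequality is also an instance of the pattern for [<=], so its own pattern comes
    before. *)
Ltac polytime_step :=
  lazymatch goal with
  | |- polytime (fun w e => nat_of_bool (@?A w e && @?B w e)) =>
      apply: (@polytime_and A B)
  | |- polytime (fun w e => nat_of_bool (@?A w e || @?B w e)) =>
      apply: (@polytime_or A B)
  | |- polytime (fun w e => nat_of_bool (~~ @?A w e)) => apply: (@polytime_neg A)
  | |- polytime (fun w e => nat_of_bool (@?A w e == @?B w e)) =>
      apply: (@polytime_eqn A B)
  | |- polytime (fun w e => nat_of_bool ((@?A w e).+1 <= @?B w e)) =>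
      apply: (@polytime_ltn A B)
  | |- polytime (fun w e => nat_of_bool (@?A w e <= @?B w e)) =>
      apply: (@polytime_leq A B)
  | |- polytime (fun w e => nat_of_bool (has (@?A w e) (iota 0 (@?B w e)))) =>
      apply: (@polytime_has B A)
  | |- polytime (fun w e => nat_of_bool (all (@?A w e) (iota 0 (@?B w e)))) =>
      apply: (@polytime_all B A)
  | |- polytime (fun w e => nat_of_bool (nth false w (@?A w e))) =>
      apply: (@polytime_bit A)
  | |- polytime (fun w e => find (@?A w e) (iota 0 (@?B w e))) =>
      apply: (@polytime_find B A)
  | |- polytime (fun w e => @?A w e + @?B w e) => apply: (@polytime_add A B)
  | |- polytime (fun w e => @?A w e - @?B w e) => apply: (@polytime_sub A B)
  | |- polytime (fun w e => @?A w e * @?B w e) => apply: (@polytime_mul A B)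
  | |- polytime (fun w e => @?A w e %/ @?B w e) => apply: (@polytime_div A B)
  | |- polytime (fun w e => @?A w e %% @?B w e) => apply: (@polytime_mod A B)
  | |- polytime (fun w e => (@?A w e).+1) => apply: (@polytime_succ A)
  | |- polytime (fun w e => (@?A w e).-1) => apply: (@polytime_pred A)
  | |- polytime (fun w e => (@?A w e) ^ ?c) => apply: (@polytime_exp A c)
  | |- polytime (fun w e => \sum_(x <- iota 0 (@?A w e)) @?B w e x) =>
      apply: (@polytime_sum A B)
  | |- polytime (fun w e => size w) => exact: polytime_size
  | |- polytime (fun w e => e ?i) => exact: (polytime_var i)
  | |- _ => first [exact: polytime_cst | apply: polytime_ifb | apply: polytime_if]
  end.

Ltac polytime := repeat (cbv beta; first [assumption | polytime_step]).

Lemma polytime_out (b : word -> env -> bool) : polytime (fun w e => b w e) ->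
  polytime_word (fun w e => [:: b w e]).
Proof. by case=> t h; exists (Out t) => w e /=; rewrite h; case: (b w e). Qed.

Lemma polytime_cat F G : polytime_word F -> polytime_word G ->
  polytime_word (fun w e => F w e ++ G w e).
Proof. by case=> s h [u k]; exists (Cat s u) => w e /=; rewrite h k. Qed.

Lemma polytime_for F G : polytime F ->
  polytime_word (fun w e => G w (fun i => e i.+1) (e 0)) ->
  polytime_word (fun w e => flatten [seq G w e x | x <- iota 0 (F w e)]).
Proof.
case=> t h [s k]; exists (For t s) => w e /=; rewrite h; congr flatten.
by apply: eq_map => x; rewrite k.
Qed.

Lemma polytime_nseq F : polytime F -> polytime_word (fun w e => nseq (F w e) true).
Proof.
case=> t h; exists (For t (Out (Cst 1))) => w e /=; rewrite h.
by elim: (F w e) 0 => //= n IH m; rewrite IH.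
Qed.


(** * Composition of programs *)

Lemma size_exec p m t m' w : exec p m t m' w -> size w <= t.
Proof. by elim=> //= *; rewrite ?size_cat; lia. Qed.

Fixpoint expr_arrays (e : expr) : nat :=
  match e with
  | Const _ => 0
  | Read a e => maxn a.+1 (expr_arrays e)
  | Plus e1 e2 | Minus e1 e2 => maxn (expr_arrays e1) (expr_arrays e2)
  end.

Fixpoint prog_arrays (p : prog) : nat :=
  match p with
  | Assign a e1 e2 => maxn a.+1 (maxn (expr_arrays e1) (expr_arrays e2))
  | Emit e => expr_arrays e
  | Seq p1 p2 => maxn (prog_arrays p1) (prog_arrays p2)
  | If e p1 p2 => maxn (expr_arrays e) (maxn (prog_arrays p1) (prog_arrays p2))
  | While e p => maxn (expr_arrays e) (prog_arrays p)
  end.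

(* The bits emitted by [p] are stored in array [A.+1], and counted in [A]. *)
Fixpoint capture (A : nat) (p : prog) : prog :=
  match p with
  | Assign a e1 e2 => Assign a e1 e2
  | Emit e =>
      Seq (Assign A.+1 (Read A (Const 0)) (Minus (Const 1) (Minus (Const 1) e)))
          (Assign A (Const 0) (Plus (Read A (Const 0)) (Const 1)))
  | Seq p1 p2 => Seq (capture A p1) (capture A p2)
  | If e p1 p2 => If e (capture A p1) (capture A p2)
  | While e p => While e (capture A p)
  end.

Fixpoint shift_expr (A : nat) (e : expr) : expr :=
  match e with
  | Const n => Const n
  | Read a e => Read (A + a) (shift_expr A e)
  | Plus e1 e2 => Plus (shift_expr A e1) (shift_expr A e2)
  | Minus e1 e2 => Minus (shift_expr A e1) (shift_expr A e2)
  end.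

Fixpoint shift (A : nat) (p : prog) : prog :=
  match p with
  | Assign a e1 e2 => Assign (A + a) (shift_expr A e1) (shift_expr A e2)
  | Emit e => Emit (shift_expr A e)
  | Seq p1 p2 => Seq (shift A p1) (shift A p2)
  | If e p1 p2 => If (shift_expr A e) (shift A p1) (shift A p2)
  | While e p => While (shift_expr A e) (shift A p)
  end.

Definition shifted (A : nat) (m M : memory) : Prop := forall a j, M (A + a) j = m a j.

Lemma eval_shift A m M e : shifted A m M -> eval M (shift_expr A e) = eval m e.
Proof.
by move=> mM; elim: e => //= [a e ->|e1 -> e2 ->|e1 -> e2 ->]; rewrite ?mM.
Qed.

Lemma exec_shift A p m t m' w : exec p m t m' w -> forall M, shifted A m M ->
  exists2 M', exec (shift A p) M t M' w & shifted A m' M'.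
Proof.
elim=> {p m t m' w} [m a e1 e2|m e|p1 p2 m0 m1 m2 t1 t2 w1 w2 _ IH1 _ IH2
  |e p1 p2 m t m' w he _ IH|e p1 p2 m t m' w he _ IH
  |e p m0 m1 m2 t1 t2 w1 w2 he _ IH1 _ IH2|e p m he] M mM /=.
- exists (update M (A + a) (eval m e1) (eval m e2)).
    by rewrite -!(eval_shift _ mM); apply: ExecAssign.
  by move=> b j; rewrite /update eqn_add2l mM.
- by exists M => //; rewrite -(eval_shift _ mM); apply: ExecEmit.
- have [M1 ex1 mM1] := IH1 _ mM; have [M2 ex2 mM2] := IH2 _ mM1.
  by exists M2 => //; apply: ExecSeq ex2.
- have [M1 ex1 mM1] := IH _ mM; exists M1 => //.
  by apply: ExecIfTrue ex1; rewrite (eval_shift _ mM).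
- have [M1 ex1 mM1] := IH _ mM; exists M1 => //.
  by apply: ExecIfFalse ex1; rewrite (eval_shift _ mM).
- have [M1 ex1 mM1] := IH1 _ mM; have [M2 ex2 mM2] := IH2 _ mM1.
  by exists M2 => //; apply: ExecWhileTrue ex2 => //; rewrite (eval_shift _ mM).
by exists M => //; apply: ExecWhileFalse; rewrite (eval_shift _ mM).
Qed.

Lemma eval_agree A m M e : agree A m M -> expr_arrays e <= A -> eval M e = eval m e.
Proof.
move=> mM; elim: e => //= [a e IH|e1 IH1 e2 IH2|e1 IH1 e2 IH2]; rewrite geq_max.
- by move=> /andP[aA eA]; rewrite IH // mM.
- by move=> /andP[h1 h2]; rewrite IH1 // IH2.
- by move=> /andP[h1 h2]; rewrite IH1 // IH2.
Qed.

(** Seen through the shift by [A], the arrays from [A] on always form the input memory of the word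
    emitted so far. An emission becomes two assignments in sequence, whence the factor 3. *)
Lemma exec_capture A p m t m' w : exec p m t m' w -> prog_arrays p <= A ->
  forall M w0, agree A m M -> shifted A (input_memory w0) M ->
  exists t' M', [/\ exec (capture A p) M t' M' [::], t' <= 3 * t, agree A m' M' &
    shifted A (input_memory (w0 ++ w)) M'].
Proof.
elim=> {p m t m' w} [m a e1 e2|m e|p1 p2 m0 m1 m2 t1 t2 w1 w2 _ IH1 _ IH2
  |e p1 p2 m t m' w he _ IH|e p1 p2 m t m' w he _ IH
  |e p m0 m1 m2 t1 t2 w1 w2 he _ IH1 _ IH2|e p m he] /=;
  rewrite ?geq_max => pA M w0 mM sM; rewrite ?cats0.
- have /and3P[aA e1A e2A] := pA.
  exists 1, (update M a (eval m e1) (eval m e2)); split=> //.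
  + by rewrite -!(eval_agree mM) //; apply: ExecAssign.
  + by move=> b bA j; rewrite /update mM.
  + by move=> b j; rewrite update_neq ?sM //; lia.
- set M1 := update M A.+1 (size w0) (eval m e != 0).
  exists 3, (update M1 A 0 (size w0).+1); split=> //.
  + apply: (@ExecSeq _ _ _ M1 _ 1 1 [::] [::]).
      have := ExecAssign M A.+1 (Read A (Const 0)) (Minus (Const 1) (Minus (Const 1) e)).
      rewrite /= (eval_agree mM) //.
      have -> : M A 0 = size w0 by have := sM 0 0; rewrite addn0.
      by rewrite /M1; have -> : 1 - (1 - eval m e) = (eval m e != 0) by lia.
    have := ExecAssign M1 A (Const 0) (Plus (Read A (Const 0)) (Const 1)).
    have M1A : M1 A 0 = size w0.
      by rewrite /M1 update_neq; [have := sM 0 0; rewrite addn0 | lia].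
    by rewrite /= M1A addn1.
  + apply: agree_trans mM _.
    by apply: agree_trans (agree_update _ _ _ _) (agree_update _ _ _ _); lia.
  + have neqA b : (A + b.+1 == A) = false by lia.
    move=> [|[|b]] j; rewrite /update /M1 /update ?neqA /=.
    * rewrite addn0 eqxx size_cat addn1; case: j => [|j] //=.
      have -> : (A == A.+1) = false by lia.
      by have := sM 0 j.+1; rewrite addn0.
    * have -> : (A + 1 == A.+1) = true by lia.
      rewrite /= cats1 nth_rcons; case: eqP => [->|/eqP js].
        by rewrite ltnn.
      have := sM 1 j; rewrite addn1 => -> /=.
      by case: ltngtP js => // js _; rewrite nth_default // ltnW.
    * have -> : (A + b.+2 == A.+1) = false by lia.
      exact: sM.
- have /andP[p1A p2A] := pA.
  have [t1' [M1 [ex1 le1 ag1 sM1]]] := IH1 p1A _ _ mM sM.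
  have [t2' [M2 [ex2 le2 ag2 sM2]]] := IH2 p2A _ _ ag1 sM1.
  exists (t1' + t2').+1, M2; split; rewrite ?catA //; last lia.
  exact: (@ExecSeq _ _ _ _ _ _ _ [::] [::]) ex1 ex2.
- have /and3P[eA p1A p2A] := pA.
  have [t1' [M1 [ex1 le1 ag1 sM1]]] := IH p1A _ _ mM sM.
  exists t1'.+1, M1; split=> //; last lia.
  by apply: ExecIfTrue ex1; rewrite (eval_agree mM).
- have /and3P[eA p1A p2A] := pA.
  have [t1' [M1 [ex1 le1 ag1 sM1]]] := IH p2A _ _ mM sM.
  exists t1'.+1, M1; split=> //; last lia.
  by apply: ExecIfFalse ex1; rewrite (eval_agree mM).
- have /andP[eA p1A] := pA.
  have [t1' [M1 [ex1 le1 ag1 sM1]]] := IH1 p1A _ _ mM sM.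
  have [|t2' [M2 [ex2 le2 ag2 sM2]]] := IH2 _ _ _ ag1 sM1.
    by rewrite /= geq_max eA.
  exists (t1' + t2').+1, M2; split; rewrite ?catA //; last lia.
  apply: (@ExecWhileTrue _ _ _ _ _ _ _ [::] [::]) ex1 ex2.
  by rewrite (eval_agree mM).
have /andP[eA p1A] := pA.
exists 1, M; split=> //; apply: ExecWhileFalse; rewrite (eval_agree mM) //.
Qed.

Lemma computes_comp p1 p2 : exists p, forall x y z t1 t2,
  computes p1 x t1 y -> computes p2 y t2 z ->
  exists2 t, computes p x t z & t <= 3 * t1 + t2 + 1.
Proof.
(* The [.+2] puts [A] beyond arrays 0 and 1, which hold the input, so that all arrays from [A] on
   start with zeros, as the input memory of the empty word does. *)
set A := (prog_arrays p1).+2.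
exists (Seq (capture A p1) (shift A p2)) => x y z t1 t2 [m1 ex1] [m2 ex2].
have [|||t [M1 [ex leT _ sM]]] :=
  exec_capture (A := A) ex1 _ (M := input_memory x) (w0 := [::]) _ _.
- by rewrite /A; lia.
- by [].
- by case=> [|[|a]] [|j].
have [M2 ex' _] := exec_shift ex2 sM.
exists (t + t2).+1; last lia.
by exists M2; apply: (@ExecSeq _ _ _ _ _ _ _ [::]) ex ex'.
Qed.

Lemma computable_comp f g : computable f -> computable g -> computable (fun n => g (f n)).
Proof.
move=> [p1 c1] [p2 c2]; have [p cp] := computes_comp p1 p2.
exists p => n; have [t1 h1] := c1 n; have [t2 h2] := c2 (f n).
by have [t h _] := cp _ _ _ _ _ h1 h2; exists t.
Qed.

Lemma polytime_computable f : polytime (fun w e => f (size w)) -> computable f.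
Proof.
move=> /polytime_nseq /polytime_prog [p [c cp]]; exists p => n.
by have [t] := cp (nseq n true); rewrite size_nseq; exists t.
Qed.

(** The input of the second program is an output of the first, hence no longer than the first
    running time. A fixed power of an fpt time bound is again one, and an affine function of [g] is
    computable. *)
Lemma fpt_reduces_polytime (P Q S : pproblem) (R : inst Q -> inst S)
    (F : word -> env -> word) (a b : nat) :
  fpt_reduces P Q ->
  (forall y, yes y <-> yes (R y)) ->
  (forall y, param (R y) <= a * param y + b) ->
  polytime_word F -> (forall y, code (R y) = F (code y) (fun=> 0)) ->
  fpt_reduces P S.
Proof.
move=> [R1 [p1 [f [g [c [cf cg h]]]]]] yesR parR pF codeR.
have [p2 [c2 cp2]] := polytime_prog pF; have [p cp] := computes_comp p1 p2.
exists (fun x => R (R1 x)), p, (fun n => (f n + 2) ^ (c2 + 3)), (fun n => a * g n + b),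
  (c * (c2 + 3)).
split.
- apply: (@computable_comp f (fun n => (n + 2) ^ (c2 + 3))) => //.
  by apply: polytime_computable; polytime.
- apply: (@computable_comp g (fun n => a * n + b)) => //.
  by apply: polytime_computable; polytime.
move=> x; have [y1 y2 [t1 ct1 le1]] := h x; split.
- exact: iff_trans y1 (yesR _).
- by apply: leq_trans (parR _) _; rewrite leq_add2r leq_mul2l y2 orbT.
have [t2 ct2 le2] := cp2 (code (R1 x)); rewrite -codeR in ct2.
have [t ct le] := cp _ _ _ _ _ ct1 ct2; exists t => //.
have sz : size (code (R1 x)) <= t1 by case: ct1 => m' /size_exec.
set n := (size (code x)).+1 in le1 *; rewrite expnM -expnMn.
set B := (f (param x) + 2) * n ^ c.
have n0 : 0 < n ^ c by rewrite expn_gt0.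
have tB : t1 + 2 <= B by rewrite /B; nia.
have B1 : 1 < B by lia.
have t2B : t2 <= B ^ c2.
  by apply: leq_trans le2 _; case: (c2) => // c'; rewrite leq_exp2r //; lia.
have X1 : 0 < B ^ c2 by rewrite expn_gt0; lia.
apply: leq_trans le _; rewrite expnD.
have : 4 * B <= B ^ 3 by rewrite expnS mulnC leq_mul2l (@leq_sqr 2) B1 orbT.
nia.
Qed.


(** * Isometric paths and width parameters *)

Section Transport.
Variables (V V' : finType) (e : rel V) (e' : rel V') (f : V -> V') (g : V' -> V).
Hypotheses (fK : cancel f g) (gK : cancel g f).
Hypothesis fe : forall x y, e' (f x) (f y) = e x y.

Lemma path_transport x p : path e' (f x) (map f p) = path e x p.
Proof. by rewrite path_map; apply: eq_path => y z; rewrite /= fe. Qed.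

Lemma isometric_path_transport x p :
  isometric_path e x p -> isometric_path e' (f x) (map f p).
Proof.
have f_inj := can_inj fK.
have isf y q : is_path e' (f y) (map f q) = is_path e y q.
  by rewrite /is_path path_transport -map_cons map_inj_uniq.
move=> [xp short]; split=> [|q]; first by rewrite isf.
have [q' ->] : exists q', q = map f q' by exists (map g q); rewrite mapK.
by rewrite isf !last_map !size_map => xq /f_inj; apply: short.
Qed.

Lemma isometric_path_partition_transport k :
  isometric_path_partition e k -> isometric_path_partition e' k.
Proof.
have f_inj := can_inj fK; move=> [P [pP cP isoP]].
exists [set f @: (A : {set V}) | A in P]; split.
- have -> : [set: V'] = f @: [set: V].
    by apply/setP=> y; rewrite inE; apply/esym/imsetP; exists (g y); rewrite ?inE ?gK.
  by rewrite imset_partition.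
- by rewrite card_imset //; apply: imset_inj.
move=> _ /imsetP[A AP ->]; have [x [p [iso ->]]] := isoP A AP.
exists (f x), (map f p); split; first exact: isometric_path_transport.
apply/setP=> y; rewrite inE -map_cons.
apply/imsetP/mapP=> -[z]; rewrite ?inE => zp ->; exists z => //.
by rewrite inE.
Qed.

Lemma path_decomposition_transport m (X : 'I_m.+1 -> {set V}) :
  path_decomposition e X ->
  path_decomposition e' (fun i => f @: X i) /\ width (fun i => f @: X i) = width X.
Proof.
have f_inj := can_inj fK; move=> [cov cove conn]; split.
  split=> [v|u v uv|i j k ijk].
  - by have [i vi] := cov (g v); exists i; apply/imsetP; exists (g v); rewrite ?gK.
  - have [|i /andP[ui vi]] := cove (g u) (g v); first by rewrite -fe !gK.
    by exists i; rewrite -[u]gK -[v]gK !imset_f.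
  by rewrite -imsetI; [apply: imsetS; apply: conn | move=> ? ? _ _ /f_inj].
by rewrite /width; congr _.-1; apply: eq_bigr => i _; rewrite card_imset.
Qed.

End Transport.

Lemma pathwidth_le (V : finType) (e : rel V) m (X : 'I_m.+1 -> {set V}) b :
  path_decomposition e X -> (forall i, #|X i| <= b) -> pathwidth e <= b.
Proof.
move=> dX Xb; rewrite /pathwidth; case: ex_minnP => w _ min_w.
apply: leq_trans (min_w (width X) _) _; first by apply/asboolP; exists m, X.
by apply: leq_trans (leq_pred _) _; apply/bigmax_leqP => i _.
Qed.

Lemma path_is_tree m : is_tree (fun i j : 'I_m.+1 => (i.+1 == j) || (j.+1 == i)).
Proof.
set t := (fun i j : 'I_m.+1 => _).
have t_sym : symmetric t by move=> i j; rewrite /t orbC.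
have acyclic (c : seq 'I_m.+1) : uniq c -> cycle t c -> size c <= 2.
  move=> uc; case: c uc => // x0 c0; move: (x0 :: c0) (mem_head x0 c0) => c x0c uc tc.
  (* Both neighbours of the least vertex [x] on the cycle can only be [x.+1], so they coincide. *)
  have [x xc max_x] : exists2 x, x \in c & forall y, y \in c -> x <= y.
    by case: (arg_minnP (P := mem c) (fun i : 'I_m.+1 => i : nat) x0c) => x ? ?; exists x.
  have [i s rs] := rot_to xc.
  have sc : c =i x :: s by move=> y; rewrite -rs mem_rot.
  move: uc tc; rewrite -(size_rot i) -(rot_uniq i) -(rot_cycle i) rs.
  case: s {rs} sc => [|y [|z s]] // sc us /= /and3P[txy _]; rewrite rcons_path => /andP[_ tzx].
  have hy : x <= y by apply: max_x; rewrite sc !inE eqxx orbT.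
  have hl : x <= last z s by apply: max_x; rewrite sc in_cons (in_cons y) mem_last !orbT.
  have : last z s = y.
    apply: val_inj; move: hy hl txy tzx; rewrite /t /=.
    move: (nat_of_ord x) (nat_of_ord y) (nat_of_ord (last z s)) => a b l; lia.
  by move: us => /= /and3P[_ ys _] ly; rewrite -ly mem_last in ys.
split=> // [i|i j].
- by rewrite /t orbb; apply/negbTE; rewrite neq_ltn ltnSn orbT.
- have up k (j0 : 'I_m.+1) : j0 = k :> nat -> connect t ord0 j0.
    elim: k j0 => [|k IH] j0 j0k; first by rewrite (_ : j0 = ord0) //; apply: val_inj.
    have km : k < m.+1 by have := ltn_ord j0; lia.
    apply: connect_trans (IH (Ordinal km) erefl) _; apply: connect1.
    by rewrite /t /= j0k eqxx.
  by apply: connect_trans (up j j erefl); rewrite (sym_connect_sym t_sym); apply: up.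
Qed.

Lemma treewidth_pathwidth (V : finType) (e : rel V) : treewidth e <= pathwidth e.
Proof.
rewrite /pathwidth; case: ex_minnP => w /asboolP[m [X [[cov cove conn] wX]]] _.
rewrite /treewidth; case: ex_minnP => w' _; apply; apply/asboolP.
exists m, (fun i j : 'I_m.+1 => (i.+1 == j) || (j.+1 == i)), X; split=> //.
split=> //; first exact: path_is_tree.
move=> v; set r := [rel a b | _].
have up d (i j : 'I_m.+1) : i + d = j -> v \in X i -> v \in X j -> connect r i j.
  elim: d i => [|d IH] i ij vi vj.
    by rewrite (_ : i = j) //; apply: val_inj; rewrite /= -ij addn0.
  have im : i.+1 < m.+1 by have := ltn_ord j; lia.
  have vi' : v \in X (Ordinal im).
    by apply: (subsetP (conn i (Ordinal im) j _)); rewrite ?inE ?vi //=; lia.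
  apply: connect_trans (IH (Ordinal im) _ vi' vj); last by rewrite /= -ij; lia.
  by apply: connect1; rewrite /r /= vi vi' eqxx.
have r_sym : symmetric r.
  by move=> i j; rewrite /r /= orbC; case: (v \in X i); rewrite ?andbT ?andbF.
move=> i j vi vj; case: (leqP i j) => ij.
  by apply: (up (j - i)) => //; rewrite subnKC.
by rewrite (sym_connect_sym r_sym); apply: (up (i - j)) => //; rewrite subnKC // ltnW.
Qed.

Section Partition.
Variables (V : finType) (e : rel V).

(** The walk can be spliced into the path in place of the segment from [i] to [j]; shortened to a
    path with the same ends, the result competes with [p]. *)
Lemma isometric_path_walk x p a q i j :
  isometric_path e x p -> i <= j <= size p ->
  a = nth x (x :: p) i -> path e a q -> last a q = nth x (x :: p) j ->
  j - i <= size q.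
Proof.
move=> [/andP[xp _] short] /andP[ij jp] ai aq lq.
have takeE l : l <= size p -> last x (take l p) = nth x (x :: p) l.
  by case: l => [|l] lp; rewrite ?take0 // (take_nth x) // last_rcons.
have ip := leq_trans ij jp.
have dropE : path e (nth x (x :: p) j) (drop j p) /\
    last (nth x (x :: p) j) (drop j p) = last x p.
  rewrite -takeE // -last_cat cat_take_drop; split=> //.
  by move: xp; rewrite -{1}(cat_take_drop j p) cat_path => /andP[].
pose w := take i p ++ q ++ drop j p.
have wP : path e x w.
  rewrite /w !cat_path takeE // -ai aq lq (proj1 dropE) !andbT.
  by move: xp; rewrite -{1}(cat_take_drop i p) cat_path => /andP[].
have wl : last x w = last x p by rewrite /w !last_cat takeE // -ai lq (proj2 dropE).
move: wl; case: (shortenP wP) => w' w'P uw' sw' w'l.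
have := short w' _ w'l; rewrite /is_path w'P uw' => /(_ isT).
have : size w' <= size w by apply: uniq_leq_size => //; case/andP: uw'.
rewrite /w !size_cat size_drop size_takel //.
by move: jp ij; move: (size q) (size p) (size w') => n1 n2 n3; lia.
Qed.

(* [nxt] runs cyclically through the vertices of each path, and [L] is the set of
   the last vertices of the paths. *)
Lemma isometric_path_partition_next k :
  isometric_path_partition e k ->
  exists (nxt : V -> V) (L : {set V}),
    [/\ injective nxt, #|L| = k, forall u, u \notin L -> e u (nxt u) &
      forall u n q, (forall i, i < n -> iter i nxt u \notin L) ->
        path e u q -> last u q = iter n nxt u -> n <= size q].
Proof.
move=> [P [pP cP isoP]]; have /and3P[covP trivP P0] := pP.
pose spec A s := A \in P -> exists x p,
  [/\ s = x :: p, isometric_path e x p & A = [set y in x :: p]].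
have [f fP] : {f : {set V} -> seq V & forall A, spec A (f A)}.
  apply: (@choice _ _ spec) => A; rewrite /spec; case AP: (A \in P); last by exists [::].
  by have [x [p [iso pA]]] := isoP A AP; exists (x :: p) => _; exists x, p.
have blockP v : pblock P v \in P by rewrite pblock_mem // (eqP covP).
have block_eq A v : A \in P -> v \in A -> pblock P v = A.
  by move=> AP; apply: def_pblock.
pose nxt v := next (f (pblock P v)) v.
pose L := [set v | last v (f (pblock P v)) == v].
have vb v : exists x p, [/\ f (pblock P v) = x :: p, isometric_path e x p,
    v \in x :: p & forall u, u \in x :: p -> pblock P u = pblock P v].
  have [x [p [fE iso Av]]] := fP _ (blockP v); exists x, p; split=> // [|u up].
    have : v \in pblock P v by rewrite mem_pblock (eqP covP).
    by rewrite Av inE.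
  by apply: block_eq; rewrite // Av inE.
have nxt_mem v : pblock P (nxt v) = pblock P v.
  by have [x [p [fE _ vp same]]] := vb v; apply: same; rewrite /nxt fE mem_next.
have step v x p : f (pblock P v) = x :: p -> v \in x :: p -> uniq (x :: p) ->
    v \notin L -> (index v (x :: p)).+1 <= size p /\
      nxt v = nth x (x :: p) (index v (x :: p)).+1.
  move=> fE vp up; rewrite inE fE /= => vL.
  have ip : index v (x :: p) < (size p).+1 by rewrite -[(size p).+1]/(size (x :: p)) index_mem.
  have ip' : index v (x :: p) != size p.
    apply: contra vL => /eqP ip'; apply/eqP; rewrite -[RHS](nth_index x vp) ip'.
    by rewrite nth_last.
  have lt : index v (x :: p) < size p by rewrite ltn_neqAle ip'.
  split=> //; rewrite /nxt fE next_nth vp /=.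
  exact: set_nth_default.
exists nxt, L; split.
- move=> u v uv; have uvb : pblock P u = pblock P v by rewrite -(nxt_mem u) uv nxt_mem.
  have [x [p [fE [/andP[_ up] _] _ _]]] := vb v.
  by move: uv; rewrite /nxt uvb fE => /(can_inj (prev_next up)).
- rewrite -cP (_ : P = pblock P @: L).
    rewrite card_in_imset // => u v; rewrite !inE => /eqP uL /eqP vL uv.
    by rewrite -uL -vL uv; have [x [p [-> _ _ _]]] := vb v.
  apply/setP=> A; apply/idP/imsetP=> [AP|[v _ ->]]; last exact: blockP.
  have [x [p [fE _ Ax]]] := fP A AP.
  have lA : last x p \in A by rewrite Ax inE mem_last.
  exists (last x p); last by rewrite (block_eq A).
  by rewrite inE (block_eq A) // fE /=.
- move=> u uL; have [x [p [fE [/andP[xp up] _] vp _]]] := vb u.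
  have [lt ->] := step u x p fE vp up uL.
  rewrite -{1}(nth_index x vp) /=.
  by move/(pathP x): xp; apply.
move=> u n q uL uq lq; have [x [p [fE iso vp same]]] := vb u.
have up : uniq (x :: p) by case: iso => /andP[].
have itE i : i <= n -> index u (x :: p) + i <= size p /\
    iter i nxt u = nth x (x :: p) (index u (x :: p) + i).
  elim: i => [|i IH] le.
    rewrite addn0 nth_index //; split=> //.
    by rewrite -ltnS -[(size p).+1]/(size (x :: p)) index_mem.
  have [lti itE] := IH (ltnW le); have := uL i le; rewrite itE => nL.
  set v := nth x _ _ in nL.
  have vx : v \in x :: p by rewrite mem_nth.
  have [|lt nE] := step v x p _ vx up nL; first by rewrite same.
  by move: lt nE; rewrite iterS itE -/v /v index_uniq // addnS.
have [lt it] := itE n (leqnn n).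
rewrite -[n](addKn (index u (x :: p))).
apply: (isometric_path_walk iso _ _ uq); rewrite ?lt ?leq_addr //.
  by rewrite nth_index.
by rewrite lq it.
Qed.

End Partition.


(** * The gadget graph *)

Section Walks.
Variables (V : finType) (e : rel V).

Definition walk (x y : V) (n : nat) : Prop :=
  exists q, [/\ path e x q, last x q = y & size q = n].

Lemma walk0 x : walk x x 0. Proof. by exists [::]. Qed.

Lemma walk1 x y : e x y -> walk x y 1.
Proof. by move=> xy; exists [:: y]; rewrite /= xy. Qed.

Lemma walk_cat x y z a b : walk x y a -> walk y z b -> walk x z (a + b).
Proof.
move=> [q [xq lq <-]] [s [ys ls <-]]; exists (q ++ s).
by rewrite cat_path last_cat size_cat xq lq ys.
Qed.

Lemma walk_sym x y n : symmetric e -> walk x y n -> walk y x n.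
Proof.
move=> e_sym [q [xq <- <-]]; exists (rev (belast x q)); split.
- by rewrite rev_path; congr is_true: xq; apply: eq_path => a b; rewrite e_sym.
- by case: q {xq} => //= a q; rewrite rev_cons last_rcons.
- by rewrite size_rev size_belast.
Qed.

(** Since [f] falls by at most 1 along an edge, any path with the same ends has at least as many
    edges as [f] drops, and strict descent excludes repeated vertices. This certifies isometry
    without computing distances. *)
Lemma isometric_path_potential (f : V -> nat) x p :
  (forall a b, e a b -> f a <= (f b).+1) ->
  path [rel a b | e a b && (f a == (f b).+1)] x p -> isometric_path e x p.
Proof.
move=> lip xp.
have fx : f x = f (last x p) + size p.
  elim: p x xp => [|y p IH] x /=; first by rewrite addn0.
  by move=> /andP[/andP[_ /eqP ->] /IH ->]; rewrite addnS.
split=> [|q /andP[xq _] lq].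
  rewrite /is_path; apply/andP; split; first by apply: sub_path xp => a b /andP[].
  apply: (@sorted_uniq _ (fun a b => f b < f a)) => [a b c ab bc|a|].
  - exact: ltn_trans bc ab.
  - exact: ltnn.
  - by apply: sub_path xp => a b /andP[_ /eqP ->].
have : f x <= f (last x q) + size q.
  elim: q x xq {lq xp fx} => [|y q IH] x /=; first by rewrite addn0.
  move=> /andP[/lip xy /IH yq]; rewrite addnS; exact: leq_trans xy _.
by rewrite lq fx leq_add2l.
Qed.

End Walks.

Section Gadget.
Variables (K W m r : nat) (mem : nat -> nat -> nat -> bool).

(* The breaks of a track will be [period] apart, and their position modulo
   [period] encodes the value of the variable of that track.  As [cycle_len] is
   [2 * period - 2], an arc of [period] vertices is just half of a cycle of that
   length. *)
Definition period := r.*2.+1.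
Definition cycle_len := 4 * r.
Definition arcs_per_track := cycle_len * W.
Definition track_len := arcs_per_track * period.

Local Notation Pi := period.
Local Notation La := cycle_len.
Local Notation T := arcs_per_track.
Local Notation N := track_len.

(* [K] cyclic tracks of length [N]; 4 hubs with two leaves each; for each clause a
   checker and its leaf. *)
Definition gadget_vertex : finType :=
  (('I_K * 'I_N) + (('I_4 + 'I_4 * bool) + ('I_W + 'I_W)))%type.
Local Notation V := gadget_vertex.

(* As [La = - 2] modulo [Pi], the neighbours [p] of a checker on track [i] are
   congruent to [- 2 * u] modulo [Pi], for the values [u] of variable [i] that
   satisfy the clause. *)
Definition attached (c i p : nat) : bool :=
  [&& p %% La == 0, p %/ La %/ Pi == c, p %/ La %% Pi < m & mem c i (p %/ La %% Pi)].

(** A hub folds to the vertex [j * r] of the cycle. Its second residue [(j * r).+1] is what makes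
    longer arcs fail: with [j * r] alone, the detour of [shortcut] would take [period] steps, no
    fewer than the arc. *)
Definition gadget_arc (x y : V) : bool :=
  match x, y with
  | inl (i, p), inl (i', p') => (i == i') && (p' == p.+1 %% N :> nat)
  | inl (_, p), inr (inl (inl j)) => (p %% La == j * r) || (p %% La == (j * r).+1)
  | inr (inl (inl j)), inr (inl (inr (j', _))) => j == j'
  | inl (i, p), inr (inr (inl c)) => attached c i p
  | inr (inr (inl c)), inr (inr (inr c')) => c == c'
  | _, _ => false
  end.

Definition gadget_adj : rel V := fun x y => gadget_arc x y || gadget_arc y x.
Local Notation e := gadget_adj.

Lemma gadget_adj_sym : symmetric e.
Proof. by move=> x y; rewrite /e orbC. Qed.

Hypotheses (mr : m <= r) (r2 : 1 < r) (W0 : 0 < W).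

Let N0 : 0 < N. Proof. by rewrite /N /T /La /Pi !muln_gt0 W0 /= andbT; lia. Qed.
Let La_N : La %| N. Proof. by rewrite /N /T -mulnA dvdn_mulr. Qed.
Let Pi_N : Pi %| N. Proof. exact: dvdn_mull. Qed.
Let La0 : 0 < La. Proof. by rewrite /La; lia. Qed.
Let LaPi0 : 0 < La * Pi. Proof. by rewrite muln_gt0 La0. Qed.
Let NE : N = W * (La * Pi). Proof. by rewrite /N /T mulnAC mulnC. Qed.
Let LaPi_N : La * Pi <= N.
Proof. by rewrite /N /T -mulnA leq_mul2l leq_pmull ?orbT. Qed.
Let La_le : La <= N.
Proof. by apply: leq_trans LaPi_N; rewrite leq_pmulr. Qed.

Definition tr (i : 'I_K) (p : nat) : V := inl (i, Ordinal (ltn_pmod p N0)).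
Definition hub (j : 'I_4) : V := inr (inl (inl j)).
Definition hub_leaf (j : 'I_4) (b : bool) : V := inr (inl (inr (j, b))).
Definition checker (c : 'I_W) : V := inr (inr (inl c)).
Definition checker_leaf (c : 'I_W) : V := inr (inr (inr c)).

Lemma tr_inj i i' p p' : tr i p = tr i' p' -> i = i' /\ p = p' %[mod N].
Proof. by case. Qed.

Lemma tr_mod i p p' : p = p' %[mod N] -> tr i p = tr i p'.
Proof. by move=> pp; congr (inl (_, _)); apply: val_inj. Qed.

Lemma trE i (p : 'I_N) : tr i p = inl (i, p).
Proof. by congr (inl (_, _)); apply: val_inj; rewrite /= modn_small. Qed.

Lemma adj_tr i p : e (tr i p) (tr i p.+1).
Proof. by rewrite /e /= eqxx -(addn1 (p %% N)) modnDml addn1 eqxx. Qed.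

Lemma adj_hub i p (j : 'I_4) : p %% La = j * r \/ p %% La = (j * r).+1 -> e (tr i p) (hub j).
Proof.
by rewrite /e /= modn_dvdm // => -[->|->]; rewrite eqxx ?orbT.
Qed.

Lemma walk_forward i p n : walk e (tr i p) (tr i (p + n)) n.
Proof.
elim: n => [|n IH]; first by rewrite addn0; apply: walk0.
by rewrite -[in X in walk _ _ _ X]addn1 addnS; apply: walk_cat IH (walk1 (adj_tr _ _)).
Qed.

(* Going back from [p] to the nearest neighbour of a hub, through the hub to a
   vertex [La.-1] further ahead, and back from there. *)
Lemma shortcut i p : exists2 n, walk e (tr i p) (tr i (p + Pi)) n & n < Pi.
Proof.
(* A full turn is added so that [p'.-1] is a true predecessor even for [p = 0]. *)
set p' := p + N.
have -> : tr i p = tr i p' by apply: tr_mod; rewrite modnDr.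
have -> : tr i (p + Pi) = tr i (p' + Pi) by apply: tr_mod; rewrite addnAC modnDr.
pose s := p'.-1 %/ r; pose y := p'.-1 %% r.
have p'E : p' = (s * r).+1 + y.
  by rewrite addSn -divn_eq prednK // /p' addn_gt0 N0 orbT.
have yr : y < r by rewrite ltn_mod; lia.
pose j : 'I_4 := Ordinal (ltn_pmod s (isT : 0 < 4)).
have sj : s * r %% La = j * r by rewrite /La -muln_modl.
have jr : (j * r).+1 < La.
  by have := ltn_ord j; rewrite /La; nia.
have w1 : walk e (tr i p') (tr i (s * r).+1) y.
  by rewrite p'E; apply: walk_sym (walk_forward _ _ _); apply: gadget_adj_sym.
have w2 : walk e (tr i (s * r).+1) (hub j) 1.
  by apply/walk1/adj_hub; right; rewrite -addn1 -modnDml sj addn1 modn_small.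
have w3 : walk e (hub j) (tr i (s * r + La)) 1.
  by apply/walk1; rewrite gadget_adj_sym; apply: adj_hub; left; rewrite modnDr.
(* Since [y < r], the hub leads to a position not before [p' + Pi]. The detour has
   [y + 2 + (La - (y + 1 + Pi)) = 2 * r] steps in all. *)
have w4 : walk e (tr i (s * r + La)) (tr i (p' + Pi)) (La - (y.+1 + Pi)).
  have -> : s * r + La = p' + Pi + (La - (y.+1 + Pi)).
    by rewrite p'E /La /Pi; lia.
  by apply: walk_sym (walk_forward _ _ _); apply: gadget_adj_sym.
eexists; first exact: walk_cat (walk_cat w1 (walk_cat w2 w3)) w4.
by rewrite /La /Pi; lia.
Qed.

(** * From a partition into paths to an assignment *)

Section Soundness.
Hypothesis ipp : isometric_path_partition e (K * T + 4).

Let N3 : 2 < N.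
Proof. by apply: leq_trans La_le; rewrite /La; lia. Qed.

Lemma gadget_soundness : exists x : nat -> nat,
  (forall i, i < K -> x i < m) /\
  forall c, c < W -> exists2 i, i < K & mem c i (x i).
Proof.
have [nxt [L [nxt_inj cL adjL geoL]]] := isometric_path_partition_next ipp.
have no2 u : u \notin L -> nxt u \notin L -> nxt (nxt u) <> u.
  move=> uL nuL nnu.
  by have := geoL u 2 [::]; rewrite /= nnu => /(_ _ isT erefl) H;
    suff /H : forall i, i < 2 -> iter i nxt u \notin L by []; case=> [|[]].
(* The track edge from [p] to [p.+1] is used by a path in one direction or the other, and a break
   [br] is an edge used in neither. Membership in [L] is tested because [nxt] returns from the last
   vertex of a path to the start. *)
pose fwd i p := (nxt (tr i p) == tr i p.+1) && (tr i p \notin L).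
pose bwd i p := (nxt (tr i p.+1) == tr i p) && (tr i p.+1 \notin L).
pose br i p := ~~ (fwd i p || bwd i p).
have neq2 i p : tr i p <> tr i p.+2.
  move=> /tr_inj[_ /esym /eqP]; rewrite -[in X in X == _](addn2 p) -[X in _ == X %[mod N]]addn0.
  by rewrite eqn_modDl mod0n modn_small.
have tr_succ i p p' : p = p' %[mod N] -> tr i p.+1 = tr i p'.+1.
  by move=> pp; apply: tr_mod; rewrite -addn1 -modnDml pp modnDml addn1.
have br_mod i p p' : p = p' %[mod N] -> br i p = br i p'.
  by move=> pp; rewrite /br /fwd /bwd (tr_mod i pp) (tr_succ i _ _ pp).
(* As [nxt] is an injective function, consecutive edges that are used run in the same direction.
   Without a break, [Pi] of them would be part of one path, against [shortcut]. *)
have window i p : exists2 h, h < Pi & br i (p + h).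
  apply: contrapT => nobr.
  have joined h : h < Pi -> fwd i (p + h) || bwd i (p + h).
    move=> hP; apply: contrapT => nj; apply: nobr; exists h => //.
    by rewrite /br; apply/negP.
  have [n wn nPi] := shortcut i p.
  have := joined 0 isT; rewrite addn0 => /orP[f0|b0].
    have fw h : h < Pi -> fwd i (p + h).
      elim: h => [|h IH] hP; first by rewrite addn0.
      case/orP: (joined _ hP) => //; rewrite addnS => /andP[/eqP b _].
      have /andP[/eqP f _] := IH (ltnW hP).
      by move: f; rewrite -b => /nxt_inj /neq2.
    have it h : h <= Pi -> iter h nxt (tr i p) = tr i (p + h).
      elim: h => [|h IH] hP; first by rewrite addn0.
      rewrite iterS IH; last exact: ltnW.
      by have /andP[/eqP -> _] := fw h hP; rewrite addnS.
    have [q [pq lq sq]] := wn.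
    have : Pi <= size q; last by rewrite sq leqNgt nPi.
    apply: geoL pq _ => [h hP|]; last by rewrite lq it.
    by rewrite it ?(ltnW hP) //; case/andP: (fw h hP).
  have bw h : h < Pi -> bwd i (p + h).
    elim: h => [|h IH] hP; first by rewrite addn0.
    case/orP: (joined _ hP) => //; rewrite addnS => /andP[/eqP f _].
    have /andP[/eqP b _] := IH (ltnW hP).
    by move: f; rewrite b => /neq2.
  have it h : h <= Pi -> iter h nxt (tr i (p + Pi)) = tr i (p + (Pi - h)).
    elim: h => [|h IH] hP; first by rewrite subn0.
    rewrite iterS IH; last exact: ltnW.
    have hP' : Pi - h.+1 < Pi by lia.
    have /andP[/eqP b _] := bw _ hP'.
    by move: b; rewrite -addnS subnSK.
  have [q [pq lq sq]] := walk_sym gadget_adj_sym wn.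
  have : Pi <= size q; last by rewrite sq leqNgt nPi.
  apply: geoL pq _ => [h hP|]; last by rewrite lq it // subnn addn0.
  rewrite it ?(ltnW hP) //.
  have hP' : Pi - h.+1 < Pi by lia.
  by have /andP[_] := bw _ hP'; rewrite -addnS subnSK.
(* Every edge of the paths that leaves the tracks has exactly one end in [Bk], and
   each vertex of [Bk] lies on at most two edges of the paths.  Counting edges
   thus bounds the number of breaks on the tracks by [K * T], which is also the
   number of disjoint windows of [Pi] edges. *)
pose Bk : {set V} := [set v : V |
  match v with inr (inl (inl _)) | inr (inr (inl _)) => true | _ => false end].
have cBk : #|Bk| = 4 + W.
  pose f (a : 'I_4 + 'I_W) : V := match a with inl j => hub j | inr c => checker c end.
  have f_inj : injective f by move=> [a|a] [b|b] // [->].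
  have -> : Bk = f @: [set: 'I_4 + 'I_W].
    apply/setP=> v; rewrite inE; apply/idP/imsetP; last by case=> -[a|a] _ ->.
    by case: v => [v|[[j|v]|[c|v]]] // _; [exists (inl j) | exists (inr c)].
  by rewrite card_imset // cardsT card_sum !card_ord.
have cV : #|V| = K * N + (12 + 2 * W).
  by rewrite !card_sum !card_prod !card_ord card_bool; lia.
have track_edge x y : x \notin Bk -> y \notin Bk -> e x y ->
    exists i p, [/\ x = tr i p & y = tr i p.+1] \/ [/\ x = tr i p.+1 & y = tr i p].
  have arcE a b : a \notin Bk -> b \notin Bk -> gadget_arc a b ->
      exists i p, a = tr i p /\ b = tr i p.+1.
    rewrite !inE; case: a => [[i p]|[[a|[a ?]]|[a|a]]] //;
      case: b => [[i' p']|[[b|[b ?]]|[b|b]]] //=.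
    move=> _ _ /andP[/eqP <- /eqP pp]; exists i, p; rewrite !trE; split=> //.
    by congr (inl (_, _)); apply: val_inj.
  move=> xB yB /orP[|] /arcE; case=> // i [p [-> ->]]; exists i, p; by [left|right].
have BkC c : checker c \in Bk by rewrite inE.
clearbody Bk.
pose brs := [set a : 'I_K * 'I_N | br a.1 a.2].
pose U := ~: L.
pose Ua := U :&: Bk.
pose Ub := [set u in U | nxt u \in Bk].
pose Ut := [set u in U | (u \notin Bk) && (nxt u \notin Bk)].
have cUa : #|Ua| <= 4 + W by rewrite -cBk subset_leq_card // subsetIr.
have imUb : nxt @: Ub \subset Bk by apply/subsetP=> _ /imsetP[u + ->]; rewrite inE => /andP[].
have cUb : #|Ub| <= 4 + W by rewrite -cBk -(card_imset _ nxt_inj) subset_leq_card.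
have cUt : #|Ut| <= #|~: brs|.
  (* A track edge that is used is sent to its tail, so that [Ut] lies in the image of the unbroken
     edges. *)
  pose psi (a : 'I_K * 'I_N) : V := if fwd a.1 a.2 then tr a.1 a.2 else tr a.1 a.2.+1.
  apply: leq_trans (leq_imset_card psi _); apply/subset_leq_card/subsetP=> u.
  rewrite !inE => /andP[uL /andP[uB nB]].
  have [i [p [[uE nE]|[uE nE]]]] := track_edge u (nxt u) uB nB (adjL u uL).
    have fip : fwd i (Ordinal (ltn_pmod p N0)).
      rewrite /fwd (tr_mod i (modn_mod p N)) (tr_succ i _ _ (modn_mod p N)).
      by rewrite -uE nE uL eqxx.
    apply/imsetP; exists (i, Ordinal (ltn_pmod p N0)); rewrite ?inE /br /psi /= fip //.
    by rewrite uE; apply/esym/tr_mod/modn_mod.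
  have bip : bwd i (Ordinal (ltn_pmod p N0)).
    rewrite /bwd (tr_mod i (modn_mod p N)) (tr_succ i _ _ (modn_mod p N)).
    by rewrite -uE nE uL eqxx.
  apply/imsetP; exists (i, Ordinal (ltn_pmod p N0)); rewrite ?inE /br /psi /= ?bip ?orbT //.
  rewrite (negbTE (_ : ~~ fwd _ _)) /=; last first.
    apply/negP; rewrite /fwd (tr_mod i (modn_mod p N)) (tr_succ i _ _ (modn_mod p N)).
    by rewrite -uE -nE => /andP[/eqP nn nL]; apply: (no2 u).
  by rewrite uE; apply/esym/tr_succ/modn_mod.
have cU : #|U| <= #|Ua| + #|Ub| + #|Ut|.
  have : U \subset Ua :|: Ub :|: Ut.
    apply/subsetP=> u uU; rewrite !inE in uU *; rewrite uU /=.
    by case: (u \in Bk) (nxt u \in Bk) => -[].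
  move=> /subset_leq_card /leq_trans; apply.
  apply: leq_trans (leq_card_setU _ _).1 _; rewrite leq_add2r.
  exact: (leq_card_setU _ _).1.
have cUL : #|U| + (K * T + 4) = K * N + (12 + 2 * W).
  by rewrite -cL -cV addnC cardsC.
have cbrs : #|brs| + #|~: brs| = K * N by rewrite cardsC card_prod !card_ord.
have brs_sum : #|brs| = \sum_(i < K) \sum_(0 <= p < N) br i p.
  rewrite -sum1_card big_mkcond [RHS](eq_bigr (fun i => \sum_(p < N) br i p)) => [|i _].
    by rewrite pair_bigA; apply: eq_bigr => a _; rewrite inE; case: (br _ _).
  by rewrite big_mkord.
pose S (i : 'I_K) o n := \sum_(o <= p < o + n) br i p.
have S_cat i o n n' : S i o (n + n') = S i o n + S i (o + n) n'.
  by rewrite /S addnA (@big_cat_nat _ _ _ (o + n)) //= leq_addr.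
have S_window i o : 0 < S i o Pi.
  have [h hP brh] := window i o.
  rewrite /S (big_cat_nat (n := o + h)) ?leq_addr //=; last by rewrite leq_add2l ltnW.
  by rewrite [X in _ + X]big_ltn ?ltn_add2l // brh; lia.
have S_ge i o n : n <= S i o (n * Pi).
  elim: n o => [|n IH] o //.
  by rewrite mulSn S_cat; have := S_window i o; have := IH (o + Pi); lia.
have S_N i o : S i o N = S i 0 N.
  elim: o => // o <-; apply/eqP; rewrite -(eqn_add2l (br i o)).
  have e1 : br i o + S i o.+1 N = S i o N.+1.
    by rewrite /S addSnnS [RHS]big_ltn //; lia.
  rewrite e1 /S addnS big_nat_recr /=; last lia.
  by rewrite addnC (br_mod i _ o) // modnDr.
(* The squeeze: at most [K * T] breaks in all, at least [T] on every track. *)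
have ST i : S i 0 N = T.
  have sum_le : \sum_(i < K) S i 0 N <= K * T.
    by rewrite -brs_sum; lia.
  have ge (i0 : 'I_K) : T <= S i0 0 N by apply: S_ge.
  apply/eqP; rewrite eqn_leq ge andbT leqNgt; apply/negP=> lt.
  have : K * T < \sum_(i < K) S i 0 N; last by rewrite ltnNge sum_le.
  rewrite (bigD1 i) //= -[K in K * T](card_ord K) -sum_nat_const (bigD1 i) //=.
  by rewrite -addSn leq_add // leq_sum.
(* Tightness also fills [Ua] and [Ub]: every hub and every checker has a predecessor and a successor
   on its path. *)
have [eUa eUb] : #|Ua| = 4 + W /\ #|Ub| = 4 + W.
  have : #|brs| = K * T.
    by rewrite brs_sum (eq_bigr (fun=> T)) ?sum_nat_const ?card_ord // => i _; apply: ST.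
  lia.
(* A full turn from [o] consists of this window and [T.-1] others, each with at least one break, and
   has [T] breaks in total. *)
have S1 i o : S i o Pi = 1.
  apply/eqP; rewrite eqn_leq S_window andbT.
  have T0 : 0 < T by rewrite /T muln_gt0 W0 /La; lia.
  have := S_N i o; rewrite ST /N -{1}(prednK T0) mulSn S_cat.
  by have := S_ge i (o + Pi) T.-1; lia.
have br_per i o : br i (o + Pi) = br i o.
  have e1 : br i o + S i o.+1 Pi = S i o Pi.+1.
    by rewrite /S addSnnS [RHS]big_ltn //; lia.
  have e2 : S i o Pi.+1 = S i o Pi + br i (o + Pi).
    by rewrite /S addnS big_nat_recr /=; last lia.
  by move: e1; rewrite e2 !S1 addnC => /addnI; case: (br i o) (br i (o + Pi)) => -[].
have br_modPi i p p' : p = p' %[mod Pi] -> br i p = br i p'.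
  have brk o n : br i (o + n * Pi) = br i o.
    by elim: n => [|n IH]; [rewrite addn0 | rewrite mulSn addnCA addnC br_per].
  by move=> pp; rewrite (divn_eq p Pi) (divn_eq p' Pi) pp addnC brk addnC brk.
have br_uniq i o a b : o <= a -> a < b -> b < o + Pi -> br i a -> br i b -> False.
  move=> oa ab bo bra brb; have := S1 i o; rewrite /S.
  rewrite (@big_cat_nat _ _ _ a) //=; last lia.
  rewrite [X in _ + X]big_ltn; last lia.
  rewrite [X in _ + (_ + X)](@big_cat_nat _ _ _ b) //=; last lia.
  by rewrite [X in _ + (_ + (_ + X))]big_ltn // bra brb; lia.
(* [Q i u] says that arcs of track [i] end at the positions congruent to [- 2 * u] modulo [Pi]: a
   break comes right after or right before. For [u < r] the residues [- 2 * u] and [- 2 * u - 1] are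
   all distinct modulo [2 * r + 1], so a single break per window determines [u]. *)
pose Q i u := br i (N - u.*2) || br i (N - u.*2.+1).
have rN : r.*2 < N by apply: leq_trans La_le; rewrite /La; lia.
have Q_lt i u u' : u < u' -> u' < r -> Q i u -> Q i u' -> False.
  have o (a b : nat) : a < b -> b < r.*2 -> br i (N - b) -> br i (N - a) -> False.
    move=> ab br2; apply: (@br_uniq _ (N - r.*2).+1); rewrite /Pi; lia.
  by move=> uu ur /orP[] h1 /orP[] h2; apply: o h2 h1; lia.
have Q_inj i u u' : u < r -> u' < r -> Q i u -> Q i u' -> u = u'.
  move=> ur u'r qu qu'; case: (ltngtP u u') => // uu; exfalso.
    exact: Q_lt uu u'r qu qu'.
  exact: Q_lt uu ur qu' qu.
(* A checker lies on two edges of the paths, at most one of which goes to its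
   leaf, so a path turns off a track at one of its neighbours. *)
have neighbour (c : 'I_W) : exists (i : 'I_K) (p : 'I_N), attached c i p /\
    (br i p || br i (p + N.-1)).
  have cU' : checker c \in Ua.
    by rewrite (_ : Ua = Bk) ?BkC //; apply/eqP; rewrite eqEcard subsetIr cBk eUa /=.
  have cUb' : checker c \in nxt @: Ub.
    rewrite (_ : nxt @: Ub = Bk) ?BkC //; apply/eqP.
    by rewrite eqEcard imUb cBk (card_imset _ nxt_inj) eUb /=.
  have {cU'} cL' : checker c \notin L by move: cU'; rewrite !inE => /andP[].
  have [z {cUb'}] := imsetP cUb'; rewrite !inE => /andP[zL _] cz.
  have nb (y : V) : e (checker c) y ->
      y = checker_leaf c \/ exists (i : 'I_K) (p : 'I_N), y = tr i p /\ attached c i p.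
    case: y => [[i p]|[[y|[y b]]|[y|y]]] //.
    - by move=> /= att; right; exists i, p; rewrite trE.
    - by move=> /orP[/eqP ->|//]; left.
  (* If both track edges at a vertex are used, its predecessor and successor under [nxt] are on the
     track, so no path joins it to a checker. *)
  have through (i : 'I_K) (p : 'I_N) : ~~ (br i p || br i (p + N.-1)) ->
      exists a b, nxt (tr i a) = tr i p /\ nxt (tr i p) = tr i b.
    have prevE : tr i (p + N.-1).+1 = tr i p.
      by apply: tr_mod; rewrite -addnS prednK // modnDr.
    have nextE : tr i (p + N.-1).+2 = tr i p.+1.
      by apply: tr_succ; rewrite -addnS prednK // modnDr.
    rewrite /br negb_or !negbK /fwd /bwd prevE.
    case/andP=> /orP[]/andP[/eqP h1 _] /orP[]/andP[/eqP h2 _].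
    - by exists (p + N.-1), p.+1.
    - by case: (neq2 i (p + N.-1)); rewrite nextE -h1.
    - by case: (neq2 i (p + N.-1)); rewrite nextE; apply: nxt_inj; rewrite h1.
    - by exists p.+1, (p + N.-1).
  have [nl|[i [p [nE att]]]] := nb _ (adjL _ cL').
    have zc : e (checker c) z by rewrite gadget_adj_sym cz; apply: adjL.
    have [zl|[i [p [zE att]]]] := nb _ zc.
      by case: (no2 _ cL'); rewrite nl -zl // -cz.
    exists i, p; split=> //; apply: contrapT => /negP /through [a [b [_]]].
    by rewrite -zE -cz.
  exists i, p; split=> //; apply: contrapT => /negP /through [a [b [+ _]]].
  by rewrite -nE => /nxt_inj.
(* A track whose breaks match no [u < m] gets the default 0; this is a legal value, as the existence
   of a checker neighbour gives [0 < m]. *)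
pose x (n : nat) : nat :=
  if insub n is Some i then if [pick u : 'I_m | Q i u] is Some u then u : nat else 0 else 0.
have xE (i : 'I_K) : x i = if [pick u : 'I_m | Q i u] is Some u then u : nat else 0.
  by rewrite /x valK.
have m0 : 0 < m.
  have [i [p [/and4P[_ _ um _] _]]] := neighbour (Ordinal W0).
  exact: leq_trans um.
exists x; split=> [i iK|c cW].
  by rewrite (xE (Ordinal iK)); case: pickP.
have [i [p [/and4P[pLa pc um mu] brp]]] := neighbour (Ordinal cW).
exists i => //; set u := p %/ La %% Pi in um mu.
suff Qu : Q i u.
  rewrite xE; case: pickP => [u' Qu'|/(_ (Ordinal um))]; last by rewrite /= Qu.
  have -> // : nat_of_ord u' = u.
  apply: (Q_inj i) => //; apply: leq_trans mr => //.
have pE : p = La * (c * Pi + u) :> nat.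
  by have /eqP <- : p %/ La %/ Pi == c := pc; rewrite -divn_eq mulnC divnK.
have uN : u.*2.+1 <= N by apply: leq_trans rN; rewrite ltnS leq_double ltnW // (leq_trans um).
have modP : p = N - u.*2 %[mod Pi].
  apply/eqP; rewrite -(eqn_modDr u.*2) subnK; last exact: ltnW.
  have -> : p + u.*2 = (4 * r * c + u.*2) * Pi by rewrite pE /La /Pi; lia.
  by rewrite modnMl /N modnMl.
case/orP: brp => brp; apply/orP; [left|right].
  by rewrite -(br_modPi i _ _ modP).
rewrite -(br_modPi i (p + N.-1)) //.
apply/eqP; rewrite -(eqn_modDr 1) -addnA !addn1 prednK // subnSK //.
by rewrite -modnDmr (eqP Pi_N) addn0 modP.
Qed.
End Soundness.

(** * From an assignment to a partition into paths *)

Section Completeness.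
Variable x : nat -> nat.
Hypotheses (xm : forall i, i < K -> x i < m).
Hypothesis xmem : forall c, c < W -> exists2 i, i < K & mem c i (x i).

Let x2 (i : 'I_K) : (x i).*2 < N.
Proof. have := xm (ltn_ord i); have := La_le; rewrite /La; lia. Qed.

(** The arcs start at the positions congruent to [- 2 * x i] modulo [Pi]; the summand [N] keeps the
    subtraction from being truncated. *)
Definition arc_start (i : 'I_K) (t : nat) : nat := t * Pi + (N - (x i).*2).

(* The distance, in a cycle of length [La], to the end of an arc starting at [q]. *)
Definition dist_end (q p : nat) : nat :=
  let y := (p + q * La.-1) %% La in if y <= r.*2 then r.*2 - y else y - r.*2.

(** The distance after folding to the end of the arc that starts at [q]. All neighbours of checkers
    fold to 0, so checkers and their leaves hang off that vertex at heights 1 and 2, and the path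
    from a leaf through its checker into an arc starting there descends. *)
Definition potential (q : nat) (v : V) : nat :=
  match v with
  | inl (_, p) => dist_end q p
  | inr (inl (inl j)) | inr (inl (inr (j, _))) => dist_end q (j * r)
  | inr (inr (inl _)) => (dist_end q 0).+1
  | inr (inr (inr _)) => (dist_end q 0).+2
  end.

Lemma dist_end_mod q p p' : p = p' %[mod La] -> dist_end q p = dist_end q p'.
Proof. by move=> pp; rewrite /dist_end -modnDml pp modnDml. Qed.

Lemma dist_endS q p :
  dist_end q p <= (dist_end q p.+1).+1 /\ dist_end q p.+1 <= (dist_end q p).+1.
Proof.
rewrite /dist_end.
have -> : (p.+1 + q * La.-1) %% La = ((p + q * La.-1) %% La).+1 %% La.
  by rewrite addSn -addn1 -(addn1 (_ %% La)) modnDml.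
have : (p + q * La.-1) %% La < La by rewrite ltn_pmod.
move: (_ %% La) => y yLa.
have [ey|ny] := eqVneq y.+1 La.
  rewrite ey modnn; move: ey; rewrite /La => ey.
  by rewrite leq0n subn0; case: (leqP y r.*2); lia.
rewrite modn_small; last by rewrite ltn_neqAle ny yLa.
by case: (leqP y r.*2); case: (leqP y.+1 r.*2); lia.
Qed.

Lemma potential_lip q a b : e a b -> potential q a <= (potential q b).+1.
Proof.
suff lip v w : gadget_arc v w ->
    potential q v <= (potential q w).+1 /\ potential q w <= (potential q v).+1.
  by case/orP=> /lip[].
case: v => [[i p]|[[j|[j b']]|[c|c]]] //; case: w => [[i' p']|[[j'|[j' b'']]|[c'|c']]] //=.
- move=> /andP[_ /eqP pp]; rewrite pp (@dist_end_mod q (p.+1 %% N) p.+1).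
    exact: dist_endS.
  by rewrite modn_dvdm.
- have jr : (j' * r).+1 < La by have := ltn_ord j'; rewrite /La; nia.
  case/orP=> /eqP pj.
    rewrite (@dist_end_mod q p (j' * r)) ?leqnSn //.
    by rewrite pj modn_small // ltnW.
  rewrite (@dist_end_mod q p (j' * r).+1); last by rewrite pj modn_small.
  by have [] := dist_endS q (j' * r).
- move=> /and4P[/eqP pc _ _ _]; rewrite (@dist_end_mod q p 0) ?pc ?mod0n //.
  by split; lia.
- by move=> /eqP <-; rewrite leqnSn.
by split; lia.
Qed.

Lemma potential_arc q i h : h <= r.*2 -> potential q (tr i (q + h)) = r.*2 - h.
Proof.
move=> hr; rewrite /= (@dist_end_mod q _ (q + h)); last by rewrite modn_dvdm.
(* In [dist_end] the term [q * La.-1] stands for [- q] modulo [La], so [q + q * La.-1] vanishes. *)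
rewrite /dist_end addnAC -mulnS prednK // -modnDml modnMl add0n modn_small ?hr //.
by rewrite /La; lia.
Qed.

Local Notation step q := [rel a b | e a b && (potential q a == (potential q b).+1)].

Lemma path_arc q i h n : h + n <= r.*2 ->
  path (step q) (tr i (q + h)) [seq tr i (q + k) | k <- iota h.+1 n].
Proof.
elim: n h => [|n IH] h hn //; apply/andP; split; last by apply: IH; lia.
apply/andP; split; first by rewrite addnS; apply: adj_tr.
by apply/eqP; rewrite !potential_arc; lia.
Qed.

Lemma gadget_completeness : isometric_path_partition e (K * T + 4).
Proof.
have [ic icP] : {ic : 'I_W -> 'I_K & forall c : 'I_W, mem c (ic c) (x (ic c))}.
  apply: (@choice _ _ (fun (c : 'I_W) (i : 'I_K) => mem c i (x i))) => c.
  by have [i iK h] := xmem (ltn_ord c); exists (Ordinal iK).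
have T0 : 0 < T by rewrite muln_gt0 La0 W0.
(* The arc that starts at the neighbour [La * (c * Pi + x i)] has number [La * c + 2 * x i], because
   [La + 2 = 2 * Pi]. *)
have arcT (c : 'I_W) : La * c + (x (ic c)).*2 < T.
  have := xm (ltn_ord (ic c)); have := ltn_ord c; rewrite /T /La.
  by nia.
have trackT i (p : 'I_N) : (p + (x i).*2) %% N %/ Pi < T.
  by rewrite ltn_divLR // ltn_pmod.
pose cl (c : 'I_W) : 'I_K * 'I_T + 'I_4 := inl (ic c, Ordinal (arcT c)).
(* [lab v] names the path that will contain [v]: an arc, possibly prolonged by a checker and its
   leaf, or a hub between its two leaves. *)
pose lab (v : V) : 'I_K * 'I_T + 'I_4 := match v with
  | inl (i, p) => inl (i, Ordinal (trackT i p))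
  | inr (inl (inl j)) | inr (inl (inr (j, _))) => inr j
  | inr (inr (inl c)) | inr (inr (inr c)) => cl c
  end.
pose arc i t := [seq tr i (arc_start i t + k) | k <- iota 0 Pi].
have arcP i (t : 'I_T) v : (v \in arc i t) =
    (if v is inl _ then lab v == inl (i, t) else false).
  apply/mapP/idP => [[k] | ].
    rewrite mem_iota add0n => /andP[_ kP] -> /=.
    apply/eqP; congr (inl (_, _)); apply: val_inj; rewrite /= modnDml.
    have -> : arc_start i t + k + (x i).*2 = t * Pi + k + N.
      by rewrite /arc_start; have := x2 i; lia.
    rewrite modnDr modn_small; last first.
      by rewrite /N; have := ltn_ord t; nia.
    by rewrite divnMDl // divn_small // addn0.
  case: v => // -[i' p] /eqP[-> tE]; pose y := (p + (x i).*2) %% N.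
  exists (y %% Pi); first by rewrite mem_iota /= add0n ltn_mod.
  rewrite -trE; apply: tr_mod; rewrite /arc_start -tE /= -/y addnAC -divn_eq /y modnDml.
  by rewrite -addnA subnKC ?modnDr // ltnW.
pose chk i (t : nat) := [pick c : 'I_W | (ic c == i) && (La * c + (x i).*2 == t)].
pose blk (l : 'I_K * 'I_T + 'I_4) : seq V := match l with
  | inl (i, t) =>
      if chk i t is Some c then [:: checker_leaf c, checker c & arc i t] else arc i t
  | inr j => [:: hub_leaf j true; hub j; hub_leaf j false]
  end.
have clP c i (t : 'I_T) : (cl c == inl (i, t)) = (chk i t == Some c).
  rewrite /chk; apply/eqP/eqP.
    move=> [<- <-]; case: pickP => [c' /andP[/eqP icc /eqP]|/(_ c)]; last by rewrite !eqxx.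
    move/addIn/eqP; rewrite eqn_mul2l gtn_eqF //= => /eqP cc; congr Some.
    exact: val_inj.
  case: pickP => // c' /andP[/eqP <- /eqP tE] [<-]; congr (inl (_, _)).
  exact: val_inj.
have blkP l v : (v \in blk l) = (lab v == l).
  case: l => [[i t]|j0] /=.
    have -> : (lab v == inl (i, t)) = (v \in arc i t) ||
        match v with inr (inr (inl c)) | inr (inr (inr c)) => chk i t == Some c | _ => false end.
      by rewrite arcP; case: v => [v|[[j|[j b]]|[c|c]]] //=; rewrite ?orbF // clP.
    case: (chk i t) => [c|]; last by case: v => [v|[[j|[j b]]|[c|c]]]; rewrite ?orbF.
    rewrite !in_cons orbA orbC; congr (_ || _).
    by case: v => [v|[[j|[j b]]|[c'|c']]]; rewrite // /checker /checker_leaf eq_sym ?orbF.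
  case: v => [[i p]|[[j'|[j' []]]|[c|c]]]; rewrite !inE //= ?orbF.
  - by apply/eqP/eqP => -[->].
  - by apply/orP/eqP => [[/eqP[->]|/eqP[]]//|[->]]; left.
  - by apply/orP/eqP => [[/eqP[]|/eqP[->]]//|[->]]; right.
have iso l : exists a p, blk l = a :: p /\ isometric_path e a p.
  case: l => [[i t]|j].
    pose q := arc_start i t.
    have arcE : arc i t = tr i q :: [seq tr i (q + k) | k <- iota 1 r.*2].
      by rewrite /arc /= addn0.
    have arc_path : path (step q) (tr i q) [seq tr i (q + k) | k <- iota 1 r.*2].
      by have := @path_arc q i 0 r.*2; rewrite addn0; apply.
    rewrite /blk /chk; case: pickP => [c /andP[/eqP icc /eqP tE]|_]; rewrite arcE.
      exists (checker_leaf c); eexists; split; first by [].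
      apply: (isometric_path_potential (potential_lip q)).
      have q_mod : q = La * (c * Pi + x i) %[mod N].
        rewrite /q /arc_start -tE; apply/eqP; rewrite -(eqn_modDr (x i).*2) -addnA subnK.
          rewrite modnDr; apply/eqP; congr (_ %% _); rewrite /La /Pi; lia.
        exact: ltnW.
      have q0 : tr i q = tr i (La * (c * Pi + x i)) by apply: tr_mod.
      have cm : x i < m by apply: xm.
      have mi : mem c i (x i) by rewrite -icc.
      have ltN : La * (c * Pi + x i) < N.
        by rewrite /N /T -mulnA ltn_pmul2l //; have := ltn_ord c; rewrite /Pi; nia.
      have xPi : x i < Pi by rewrite /Pi; lia.
      have att : e (checker c) (tr i q).
        rewrite q0 gadget_adj_sym /e /= /attached (modn_small ltN) [La * _]mulnC modnMl mulnK //.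
        by rewrite divnMDl // modnMDl modn_small // divn_small // addn0 !eqxx cm mi.
      apply/andP; split; first by rewrite /= /e /= !eqxx.
      apply/andP; split; last exact: arc_path.
      apply/andP; split=> //; apply/eqP; rewrite q0; congr _.+1.
      by apply: dist_end_mod; rewrite modn_dvdm // modnMr mod0n.
    exists (tr i q); eexists; split=> //; apply: isometric_path_potential arc_path.
    exact: potential_lip.
  exists (hub_leaf j true), [:: hub j; hub_leaf j false]; split=> //; split.
    have adj b : e (hub j) (hub_leaf j b) by rewrite /e /= eqxx.
    apply/andP; split; first by apply/and3P; rewrite gadget_adj_sym !adj.
    rewrite /= !inE negb_or andbT.
    by do ?[apply/andP; split]; try (apply/eqP; discriminate).
  move=> [_ /= []|a [|b s]] //.
  by move=> /andP[/andP[ea _] _] /= ae; rewrite ae in ea.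
pose F (l : 'I_K * 'I_T + 'I_4) := [set v | lab v == l].
have F0 l : F l != set0.
  have [a [p [bl _]]] := iso l; apply/set0Pn; exists a.
  by rewrite inE -blkP bl mem_head.
have [||trivP F_inj] := @trivIimset V ('I_K * 'I_T + 'I_4)%type predT F.
- move=> l l' _ _ ll; rewrite -setI_eq0; apply/eqP/setP=> v; rewrite !inE.
  by apply/negP=> /andP[/eqP -> /eqP h]; rewrite h eqxx in ll.
- by apply/imsetP=> -[l _] /esym /eqP; rewrite (negbTE (F0 l)).
exists [set F l | l in predT]; split.
- apply/and3P; split=> //.
    rewrite eqEsubset subsetT; apply/subsetP=> v _; apply/bigcupP.
    by exists (F (lab v)); rewrite ?imset_f // inE.
  by apply/imsetP=> -[l _] /esym /eqP; rewrite (negbTE (F0 l)).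
- by rewrite card_in_imset // card_sum card_prod !card_ord.
move=> _ /imsetP[l _ ->]; have [a [p [bl isop]]] := iso l.
by exists a, p; split=> //; apply/setP=> v; rewrite !inE -blkP bl inE.
Qed.

End Completeness.

(** * Path decomposition of the gadget graph *)

Definition in_bag (j : nat) (v : V) : bool :=
  match v with
  | inl (_, p) => [|| p == 0 :> nat, p == j :> nat | p == j.+1 :> nat]
  | inr (inl _) => true
  | inr (inr (inl c)) | inr (inr (inr c)) => c == j %/ (La * Pi) :> nat
  end.

(** Position 0 stays in every bag because the tracks close up there. A checker is present just
    during the stretch of [La * Pi] positions that contains all its neighbours. A bag has at most 3
    vertices per track, the 12 hubs and hub leaves, and one checker with its leaf. *)
Lemma gadget_pathwidth : pathwidth e <= 3 * K + 14.
Proof.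
pose X (j : 'I_N.-1.+1) := [set v | in_bag j v].
have XE (j : 'I_N.-1.+1) v : (v \in X j) = in_bag j v by rewrite inE.
have jN (j : 'I_N.-1.+1) : j < N by rewrite -[X in _ < X](prednK N0).
have bag n (nN : n < N) : exists j : 'I_N.-1.+1, j = n :> nat.
  by rewrite -(prednK N0) in nN; exists (Ordinal nN).
have arc_bag u v : gadget_arc u v -> exists j, (u \in X j) && (v \in X j).
  case: u => [[i p]|[[h|[h b]]|[c|c]]] //; case: v => [[i' p']|[[h'|[h' b']]|[c'|c']]] //=.
  - move=> /andP[_ /eqP pp]; have [j jE] := bag p (ltn_ord p); exists j.
    rewrite !XE /= jE pp eqxx orbT /=.
    have [eN|nN] := eqVneq p.+1 N; first by rewrite eN modnn.
    by rewrite modn_small ?eqxx ?orbT // ltn_neqAle nN ltn_ord.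
  - by have [j jE] := bag p (ltn_ord p); exists j; rewrite !XE /= jE eqxx orbT.
  - move=> /and4P[_ /eqP pc _ _]; have [j jE] := bag p (ltn_ord p); exists j.
    by rewrite !XE /= jE eqxx orbT divnMA pc eqxx.
  - by exists ord0; rewrite !XE.
  - move=> /eqP <-; have [|j jE] := bag (c * (La * Pi)); first by rewrite NE ltn_pmul2r.
    by exists j; rewrite !XE /= jE mulnK ?eqxx.
apply: (@pathwidth_le _ _ _ X) => [|j]; first split.
- move=> v; have [j jv] : exists j : 'I_N.-1.+1, in_bag j v; last by exists j; rewrite XE.
  case: v => [[i p]|[h|c]].
  + by have [j jE] := bag p (ltn_ord p); exists j; rewrite /= jE eqxx orbT.
  + by exists ord0.
  + have [d dE] : exists d : 'I_W,
        forall j, in_bag j (inr (inr c)) = (d == j %/ (La * Pi) :> nat).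
      by case: c => c; exists c.
    have [|j jE] := bag (d * (La * Pi)); first by rewrite NE ltn_pmul2r.
    by exists j; rewrite dE jE mulnK.
- move=> u v /orP[|] /arc_bag [j]; exists j => //; by rewrite andbC.
- move=> j1 j2 j3 /andP[j12 j23]; apply/subsetP=> v; rewrite in_setI !XE.
  case: v => [[i p]|[h|[c|c]]] //=.
  + lia.
  + move=> /andP[/eqP c1 /eqP c3]; have := leq_div2r (La * Pi) j12.
    by have := leq_div2r (La * Pi) j23; rewrite -c1 -c3 eqn_leq => -> ->.
  + move=> /andP[/eqP c1 /eqP c3]; have := leq_div2r (La * Pi) j12.
    by have := leq_div2r (La * Pi) j23; rewrite -c1 -c3 eqn_leq => -> ->.
have cW : j %/ (La * Pi) < W.
  by rewrite ltn_divLR // -NE.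
pose s : seq V := [seq tr i p | i <- enum 'I_K, p <- [:: 0; nat_of_ord j; j.+1]] ++
  [seq inr (inl h) | h <- enum {: 'I_4 + 'I_4 * bool}] ++
  [:: checker (Ordinal cW); checker_leaf (Ordinal cW)].
have sz : size s = 3 * K + 14.
  have sK : size (enum 'I_K) = K := size_enum_ord K.
  rewrite !size_cat size_allpairs [X in X * _]sK [X in _ + (X + _)]size_map -cardT.
  by rewrite card_sum card_prod card_bool !card_ord /=; lia.
rewrite -sz; apply: leq_trans (card_size s); apply/subset_leq_card/subsetP=> v.
rewrite XE !mem_cat; case: v => [[i p]|[h|[c|c]]] /= vj; apply/orP.
- left; apply/flatten_mapP; exists i; rewrite ?mem_enum // -trE !inE.
  by case/or3P: vj => /eqP ->; rewrite eqxx ?orbT.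
- by right; rewrite map_f // mem_enum.
- right; apply/orP; right; rewrite inE; apply/orP; left; apply/eqP.
  by congr (inr (inr (inl _))); apply: val_inj; apply/eqP.
- right; apply/orP; right; rewrite !inE; apply/orP; right; apply/eqP.
  by congr (inr (inr (inr _))); apply: val_inj; apply/eqP.
Qed.

End Gadget.



(** * Numbering the vertices of the gadget graph *)

Section Numbering.
Variables (K W m r : nat) (mem : nat -> nat -> nat -> bool).
Local Notation La := (cycle_len r).
Local Notation N := (track_len W r).
Local Notation D := (K * N).
Local Notation att := (attached m r mem).
Local Notation V := (gadget_vertex K W r).

(** Adjacency on plain numbers, for a program to evaluate. The numbering runs through the tracks,
    the 4 hubs, the 8 hub leaves, the checkers and the checker leaves. *)
Definition arc_nat (x y : nat) : bool :=
  [|| [&& x < D, y < D, x %/ N == y %/ N & y %% N == (x %% N).+1 %% N],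
      [&& x < D, D <= y, y < D + 4 &
        (x %% N %% La == (y - D) * r) || (x %% N %% La == ((y - D) * r).+1)],
      [&& x < D, D + 12 <= y, y < D + 12 + W & att (y - (D + 12)) (x %/ N) (x %% N)],
      [&& D <= x, x < D + 4, D + 4 <= y, y < D + 12 & (y - (D + 4)) %/ 2 == x - D] |
      [&& D + 12 <= x, x < D + 12 + W & y == x + W]].

Definition adj_nat (x y : nat) : bool := (x != y) && (arc_nat x y || arc_nat y x).

Definition gadget_order : nat := D + 12 + 2 * W.

Definition gadget_edges : {set 'I_gadget_order * 'I_gadget_order} :=
  [set a : 'I_gadget_order * 'I_gadget_order | adj_nat a.1 a.2].

Lemma gadget_edges_sym :
  [forall i, forall j, ((i, j) \in gadget_edges) == ((j, i) \in gadget_edges)].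
Proof.
apply/forallP=> i; apply/forallP=> j.
by rewrite !inE /adj_nat /= (eq_sym (j : nat)) orbC eqxx.
Qed.

Lemma gadget_edges_irr : [forall i, (i, i) \notin gadget_edges].
Proof. by apply/forallP=> i; rewrite inE /adj_nat eqxx. Qed.

Definition gadget_graph : sgraph := SGraph gadget_edges_sym gadget_edges_irr.

Definition enc (v : V) : nat :=
  match v with
  | inl (i, p) => i * N + p
  | inr (inl (inl j)) => D + j
  | inr (inl (inr (j, b))) => D + 4 + (2 * j + b)
  | inr (inr (inl c)) => D + 12 + c
  | inr (inr (inr c)) => D + 12 + (W + c)
  end.

Lemma enc_lt v : enc v < gadget_order.
Proof.
rewrite /gadget_order; case: v => [[i p]|[[j|[j b]]|[c|c]]] /=.
- have := ltn_ord i; have := ltn_ord p; nia.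
- have := ltn_ord j; lia.
- have := ltn_ord j; lia.
- have := ltn_ord c; lia.
- have := ltn_ord c; lia.
Qed.

Lemma enc_tr (i : 'I_K) (p : 'I_N) :
  [/\ i * N + p < D, (i * N + p) %/ N = i & (i * N + p) %% N = p].
Proof.
have pN := ltn_ord p; have N0 : 0 < N by apply: leq_ltn_trans pN.
split; first by have := ltn_ord i; nia.
  by rewrite divnMDl // divn_small // addn0.
by rewrite modnMDl modn_small.
Qed.

Ltac decide_leq := repeat match goal with
  | |- context [leq ?a ?b] =>
    let h := fresh in
    first [have h : leq a b = true by lia | have h : leq a b = false by lia];
    rewrite h {h}
  end.

Lemma enc_inj : injective enc.
Proof.
case=> [[i p]|[[j|[j []]]|[c|c]]]; case=> [[i' p']|[[j'|[j' []]]|[c'|c']]] /=;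
  try have [x1 x2 x3] := enc_tr i p; try have [y1 y2 y3] := enc_tr i' p';
  try have := ltn_ord j; try have := ltn_ord j';
  try have := ltn_ord c; try have := ltn_ord c'; intros; try lia.
- have ii : i = i' by apply: val_inj; rewrite /= -x2 -y2; congr (_ %/ _).
  have pp : p = p' by apply: val_inj; rewrite /= -x3 -y3; congr (_ %% _).
  by rewrite ii pp.
- by congr (inr (inl (inl _))); apply: val_inj => /=; lia.
- by congr (inr (inl (inr (_, _)))); apply: val_inj => /=; lia.
- by congr (inr (inl (inr (_, _)))); apply: val_inj => /=; lia.
- by congr (inr (inr (inl _))); apply: val_inj => /=; lia.
- by congr (inr (inr (inr _))); apply: val_inj => /=; lia.
Qed.

Lemma arc_natE v v' : arc_nat (enc v) (enc v') = gadget_arc m mem v v'.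
Proof.
rewrite /arc_nat.
case: v => [[i p]|[[j|[j b]]|[c|c]]]; case: v' => [[i' p']|[[j'|[j' b']]|[c'|c']]];
  rewrite [enc _]/= [enc _]/= [gadget_arc _ _ _ _]/=;
  try have [x1 x2 x3] := enc_tr i p; try have [y1 y2 y3] := enc_tr i' p';
  try have jj := ltn_ord j; try have jj' := ltn_ord j';
  try have cc := ltn_ord c; try have cc' := ltn_ord c';
  decide_leq; rewrite ?andbF ?orbF ?x2 ?x3 ?y2 ?y3 //=.
- by rewrite addKn.
- by rewrite addKn.
- rewrite !addKn mulnC divnMDl // divn_small ?addn0; last by case: b'.
  by rewrite eq_sym.
- by apply/negbTE; lia.
- by apply/negbTE; lia.
- by apply/negbTE; lia.
- by apply/negbTE; lia.
have -> : D + 12 + c + W = D + 12 + (W + c) by lia.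
by rewrite !eqn_add2l eq_sym.
Qed.

Hypotheses (mr : m <= r) (r2 : 1 < r) (W0 : 0 < W).

Let N1 : 1 < N.
Proof. by rewrite /track_len /arcs_per_track /cycle_len /period; nia. Qed.

Lemma adj_natE v v' : adj_nat (enc v) (enc v') = gadget_adj m mem v v'.
Proof.
rewrite /adj_nat !arc_natE (inj_eq enc_inj) -/(gadget_adj m mem v v') andb_idl //.
have irr (u : V) : gadget_arc m mem u u = false.
  case: u => [[i p]|[[j|[j b]]|[c|c]]] //; rewrite /gadget_arc eqxx andTb.
  apply/negbTE; have pN := ltn_ord p; have [eN|nN] := eqVneq p.+1 N.
    by rewrite eN modnn; lia.
  by rewrite modn_small; [rewrite neq_ltn ltnSn|rewrite ltn_neqAle nN].
by apply: contraTneq => ->; rewrite /gadget_adj irr.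
Qed.

Lemma gadget_graph_iso : exists (f : V -> 'I_gadget_order) (g : 'I_gadget_order -> V),
  [/\ cancel f g, cancel g f &
      forall x y, @adj gadget_graph (f x) (f y) = gadget_adj m mem x y].
Proof.
pose f (v : V) : 'I_gadget_order := Ordinal (enc_lt v).
have f_inj : injective f by move=> u v [/enc_inj].
have [|g fK gK] := inj_card_bij f_inj.
  by rewrite !card_sum !card_prod !card_ord card_bool /gadget_order; lia.
by exists f, g; split=> // x y; rewrite /adj inE /= adj_natE.
Qed.

Lemma gadget_graph_ipp :
  isometric_path_partition (@adj gadget_graph) (K * arcs_per_track W r + 4) <->
  exists x : nat -> nat, (forall i, i < K -> x i < m) /\
    forall c, c < W -> exists2 i, i < K & mem c i (x i).
Proof.
have [f [g [fK gK fe]]] := gadget_graph_iso; split.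
  have ge x y : gadget_adj m mem (g x) (g y) = @adj gadget_graph x y.
    by rewrite -fe !gK.
  by move=> /(isometric_path_partition_transport gK fK ge); apply: gadget_soundness.
move=> [x [xm xmem]].
apply: (isometric_path_partition_transport fK gK fe).
exact: gadget_completeness xm xmem.
Qed.

Lemma gadget_graph_pathwidth : pathwidth (@adj gadget_graph) <= 3 * K + 14.
Proof.
have [f [g [fK gK fe]]] := gadget_graph_iso.
have := gadget_pathwidth K mem mr r2 W0; apply: leq_trans.
rewrite {2}/pathwidth; case: ex_minnP => w /asboolP[n [X [dX <-]]] _.
have [dX' <-] := path_decomposition_transport fK gK fe dX.
rewrite /pathwidth; case: ex_minnP => w' _; apply.
by apply/asboolP; eexists; eexists; split; first exact: dX'.
Qed.

End Numbering.


(** * From circuits of weft 1 to clauses *)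

Section Clauses.
Variables (m k : nat) (arcf : nat -> nat -> bool) (andf : nat -> bool).

Definition indeg (g : nat) : nat := \sum_(j <- iota 0 m) arcf j g.
Definition fst_pred (g : nat) : nat := find (fun j => arcf j g) (iota 0 m).
Definition lst_pred (g : nat) : nat := m.-1 - find (fun j => arcf (m.-1 - j) g) (iota 0 m).

(* Does gate [g] take the value [b] when all its predecessors do, rather than
   when some predecessor does? *)
Definition conj_gate (b : bool) (g : nat) : bool := if b then andf g else ~~ andf g.

(** That an input is not chosen is a conjunction over the [k] chosen ones, so the challenger names
    one of them by [t]. The idle challenge [t = k] keeps the number of challenges positive when
    [k = 0]. *)
Definition lit_clause (b : bool) (g t i u : nat) : bool :=
  if b then (i < k) && (u == g) else (k <= t) || ((i == t) && (u != g)).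

(* A game on the circuit between a prover, who claims that gate [g] has value [b],
   and a challenger, who picks a predecessor of [g] when they all matter.  A
   clause is a strategy of the challenger, coded by the number [c]; it contains
   the literals that the prover can then reach.  Below the only large gate of a
   path the strategy depends on the moves of the prover, and each clause has a
   bounded number of literals of the circuit. *)
Fixpoint bot_size (d : nat) : nat :=
  if d is d.+1 then 2 * (bot_size d * bot_size d) else k.+1.

Fixpoint bot_clause (d : nat) (b : bool) (g c i u : nat) : bool :=
  if d is d.+1 then
    if indeg g == 0 then lit_clause b g (c %% k.+1) i u
    else if indeg g == 1 then bot_clause d (~~ b) (fst_pred g) (c %% bot_size d) i u
    else if conj_gate b g then
      bot_clause d b (if c %/ (bot_size d * bot_size d) == 0 then fst_pred g else lst_pred g)
        (c %% bot_size d) i u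
    else bot_clause d b (fst_pred g) (c %% bot_size d) i u
      || bot_clause d b (lst_pred g) (c %/ bot_size d %% bot_size d) i u
  else lit_clause b g (c %% k.+1) i u.

(* Down to a large gate the moves of the prover are instead the values of the
   variables numbered from [k + o] on, one for each of the boundedly many
   sequences of moves of the challenger before reaching that gate. *)
Fixpoint top_vars (d : nat) : nat := if d is d.+1 then (2 * top_vars d).+1 else 0.

Fixpoint top_size (d : nat) : nat :=
  if d is d.+1 then m * bot_size d + 2 * top_size d else k.+1.

Fixpoint top_clause (d : nat) (b : bool) (g o c i u : nat) : bool :=
  if d is d.+1 then
    if indeg g == 0 then lit_clause b g (c %% k.+1) i u
    else if indeg g == 1 then
      top_clause d (~~ b) (fst_pred g) o.+1 (c %% top_size d) i u
    else if indeg g == 2 then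
      (~~ conj_gate b g && ((i == k + o) && ((u == 0) != (c %/ top_size d == 0))))
      || top_clause d b (if c %/ top_size d == 0 then fst_pred g else lst_pred g)
           (if c %/ top_size d == 0 then o.+1 else o.+1 + top_vars d)
           (c %% top_size d) i u
    else
      if conj_gate b g then
        ~~ ((c %/ bot_size d < m) && arcf (c %/ bot_size d) g)
        || bot_clause d b (c %/ bot_size d) (c %% bot_size d) i u
      else
        ((i == k + o) && (u != c %/ bot_size d))
        || [&& c %/ bot_size d < m, arcf (c %/ bot_size d) g &
             bot_clause d b (c %/ bot_size d) (c %% bot_size d) i u]
  else lit_clause b g (c %% k.+1) i u.

(** The shape of a circuit below its large gate, unfolded to match the recursion of [bot_clause];
    [top_ok] does the same down to that gate. *)
Fixpoint bot_ok (d g : nat) : Prop :=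
  indeg g = 0 \/
  if d is d.+1 then
    indeg g <= 2 /\ forall j, j < m -> arcf j g -> bot_ok d j
  else False.

Fixpoint top_ok (d g : nat) : Prop :=
  indeg g = 0 \/
  if d is d.+1 then
    forall j, j < m -> arcf j g -> if 2 < indeg g then bot_ok d j else top_ok d j
  else False.

Lemma indeg_count g : indeg g = count (fun j => arcf j g) (iota 0 m).
Proof.
rewrite /indeg -sum1_count [RHS]big_mkcond /=.
by apply: eq_bigr => j _; case: arcf.
Qed.

Lemma indeg_le g : indeg g <= m.
Proof. by rewrite indeg_count -[X in _ <= X](size_iota 0); apply: count_size. Qed.

Lemma fst_predP g : 0 < indeg g ->
  [/\ fst_pred g < m, arcf (fst_pred g) g & forall j, j < m -> arcf j g -> fst_pred g <= j].
Proof.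
rewrite indeg_count -has_count => h.
have lt : fst_pred g < m by rewrite -[X in _ < X](size_iota 0) -has_find.
split=> //; first by have := nth_find 0 h; rewrite nth_iota.
move=> j jm jg; rewrite leqNgt; apply/negP=> /(before_find 0).
by rewrite nth_iota // jg.
Qed.

Lemma lst_predP g : 0 < indeg g ->
  [/\ lst_pred g < m, arcf (lst_pred g) g & forall j, j < m -> arcf j g -> j <= lst_pred g].
Proof.
rewrite indeg_count -has_count => /hasP[j0]; rewrite mem_iota add0n => /andP[_ j0m] j0g.
set a := fun j => arcf (m.-1 - j) g.
have h : has a (iota 0 m).
  apply/hasP; exists (m.-1 - j0); first by rewrite mem_iota; lia.
  by rewrite /a subKn //; lia.
have lt : find a (iota 0 m) < m by rewrite -[X in _ < X](size_iota 0) -has_find.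
rewrite /lst_pred -/a; split; first lia.
  by have := nth_find 0 h; rewrite nth_iota.
move=> j jm jg; rewrite leqNgt; apply/negP=> ltj.
have /(before_find 0) : m.-1 - j < find a (iota 0 m) by lia.
rewrite nth_iota; last lia.
by rewrite /a add0n subKn ?jg //; lia.
Qed.

Lemma indeg_uniq g s : uniq s -> (forall j, j \in s -> j < m /\ arcf j g) -> size s <= indeg g.
Proof.
move=> us sg; rewrite indeg_count -size_filter; apply: uniq_leq_size => // j /sg[jm jg].
by rewrite mem_filter jg mem_iota.
Qed.

Lemma indeg1P g j : indeg g = 1 -> j < m -> arcf j g -> j = fst_pred g.
Proof.
move=> g1 jm jg; have [|fm fg _] := @fst_predP g; first by rewrite g1.
apply/eqP; apply: contraT => ne.
have := @indeg_uniq g [:: j; fst_pred g]; rewrite g1 /= inE ne => /(_ isT).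
by move=> H; suff /H : forall i, i \in [:: j; fst_pred g] -> i < m /\ arcf i g by [];
   move=> i; rewrite !inE => /orP[] /eqP ->.
Qed.

Lemma indeg2P g j : indeg g = 2 -> j < m -> arcf j g ->
  j = fst_pred g \/ j = lst_pred g.
Proof.
move=> g2 jm jg; have [|fm fg _] := @fst_predP g; first by rewrite g2.
have [|lm lg lmax] := @lst_predP g; first by rewrite g2.
have [->|nf] := eqVneq j (fst_pred g); first by left.
have [->|nl] := eqVneq j (lst_pred g); first by right.
have jl : j < lst_pred g by rewrite ltn_neqAle nl lmax.
have fj : fst_pred g < j.
  by have [|_ _ fmin] := @fst_predP g; rewrite ?g2 // ltn_neqAle eq_sym nf fmin.
have := @indeg_uniq g [:: fst_pred g; j; lst_pred g]; rewrite g2 /= !inE.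
have -> : fst_pred g == j = false by lia.
have -> : fst_pred g == lst_pred g = false by lia.
have -> : j == lst_pred g = false by lia.
move=> /(_ isT) H.
suff /H : forall i, i \in [:: fst_pred g; j; lst_pred g] -> i < m /\ arcf i g by [].
by move=> i; rewrite !inE => /or3P[] /eqP ->.
Qed.

Lemma bot_size_gt d : k < bot_size d.
Proof. by elim: d => //= d IH; nia. Qed.

Lemma top_size_gt d : k < top_size d.
Proof. by elim: d => //= d IH; nia. Qed.

Variable val : nat -> bool.

Definition gate_value (g : nat) : bool :=
  if indeg g == 1 then all (fun j => arcf j g ==> ~~ val j) (iota 0 m)
  else if andf g then all (fun j => arcf j g ==> val j) (iota 0 m)
  else has (fun j => arcf j g && val j) (iota 0 m).

Variables (K : nat) (x : nat -> nat).

Definition sat (P : nat -> nat -> bool) : bool := has (fun i => P i (x i)) (iota 0 K).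

Hypothesis kK : k <= K.
Hypothesis xm : forall i, i < K -> x i < m.
Hypothesis val_input : forall g, g < m -> indeg g = 0 ->
  val g = (g \in [seq x i | i <- iota 0 k]).
Hypothesis val_gate : forall g, g < m -> 0 < indeg g -> val g = gate_value g.

Lemma satP (P : nat -> nat -> bool) : reflect (exists2 i, i < K & P i (x i)) (sat P).
Proof.
apply: (iffP hasP) => [[i]|[i iK h]]; first by rewrite mem_iota => iK h; exists i.
by exists i; rewrite ?mem_iota.
Qed.

Lemma sat_or (P Q : nat -> nat -> bool) : sat (fun i u => P i u || Q i u) = sat P || sat Q.
Proof. exact: has_predU. Qed.

Lemma sat_at a (Q : pred nat) : a < K -> sat (fun i u => (i == a) && Q u) = Q (x a).
Proof.
move=> aK; apply/satP/idP => [[i _ /andP[/eqP -> //]]|q].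
by exists a; rewrite ?eqxx.
Qed.

Lemma sat_and (b : bool) (P : nat -> nat -> bool) : sat (fun i u => b && P i u) = b && sat P.
Proof. by rewrite /sat; case: b => //=; elim: (iota 0 K). Qed.

Lemma lit_sat b g : g < m -> indeg g = 0 -> 0 < K ->
  (forall t, t <= k -> sat (lit_clause b g t)) <-> val g = b.
Proof.
move=> gm g0 K0; rewrite val_input //; split=> [h|gb t tk].
  case: b h => h.
    have /satP[i iK /= /andP[ik /eqP <-]] := h 0 isT.
    by rewrite map_f // mem_iota.
  apply/mapP=> -[t]; rewrite mem_iota add0n => /= tk gt.
  have /satP[i iK] := h t (ltnW tk).
  by rewrite /lit_clause leqNgt tk /= => /andP[/eqP ->]; rewrite gt eqxx.
case: b gb => gb; apply/satP.
  have /mapP[i] := gb; rewrite mem_iota add0n => /= ik ->.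
  by exists i; rewrite ?ik ?eqxx //; apply: leq_trans kK.
have [kt|tk'] := leqP k t; first by exists 0; rewrite //= kt.
exists t; first exact: leq_trans kK.
rewrite /= eqxx; apply/orP; right; apply: contraFneq gb => <-.
by rewrite map_f // mem_iota.
Qed.

Lemma gate1 g : g < m -> indeg g = 1 -> val g = ~~ val (fst_pred g).
Proof.
move=> gm g1; rewrite val_gate ?g1 // /gate_value g1 eqxx.
have [|fm fg _] := @fst_predP g; first by rewrite g1.
apply/allP/idP => [/(_ (fst_pred g))|h j]; first by rewrite mem_iota fm fg; apply.
by rewrite mem_iota => jm; apply/implyP=> /(indeg1P g1 jm) ->.
Qed.

Lemma gate_conj g b : g < m -> 1 < indeg g -> conj_gate b g ->
  val g = b <-> forall j, j < m -> arcf j g -> val j = b.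
Proof.
move=> gm g2 cb; rewrite val_gate ?(ltnW g2) // /gate_value gtn_eqF //.
move: cb; rewrite /conj_gate; case: b => [-> | /negbTE ->]; split.
- by move=> /allP h j jm jg; apply: (implyP (h j _)) => //; rewrite mem_iota.
- by move=> h; apply/allP=> j; rewrite mem_iota => jm; apply/implyP=> /(h j jm).
- move=> /negbT/hasPn h j jm jg; apply/negbTE.
  by have := h j; rewrite mem_iota jg => /(_ jm).
- move=> h; apply/negbTE/hasPn=> j; rewrite mem_iota => jm.
  by apply/negP=> /andP[jg]; rewrite (h j jm jg).
Qed.

Lemma gate_disj g b : g < m -> 1 < indeg g -> ~~ conj_gate b g ->
  val g = b <-> exists j, [/\ j < m, arcf j g & val j = b].
Proof.
move=> gm g2 cb; rewrite val_gate ?(ltnW g2) // /gate_value gtn_eqF //.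
move: cb; rewrite /conj_gate; case: b => [/negbTE -> | /negbNE ->]; split.
- by case/hasP=> j; rewrite mem_iota => jm /andP[jg vj]; exists j.
- by case=> j [jm jg vj]; apply/hasP; exists j; rewrite ?mem_iota ?jg.
- move=> /negbT /allPn[j]; rewrite mem_iota => jm; rewrite negb_imply => /andP[jg /negbTE vj].
  by exists j.
- case=> j [jm jg vj]; apply/negbTE/allPn; exists j; rewrite ?mem_iota //.
  by rewrite jg vj.
Qed.

Hypothesis K0 : 0 < K.

Lemma lit_size_sat b g C : g < m -> indeg g = 0 -> k < C ->
  (forall c, c < C -> sat (lit_clause b g (c %% k.+1))) <-> val g = b.
Proof.
move=> gm g0 kC; rewrite -lit_sat //; split=> h.
  move=> t tk; have := h t (leq_ltn_trans tk kC).
  by rewrite modn_small.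
by move=> c _; apply: h; rewrite -ltnS ltn_mod.
Qed.

(** The game is determined. Where the prover moves, winning strategies of the challenger against
    both moves combine into one, coded [c1 * C + c0]; where the challenger moves, the leading digit
    of the code is the move. *)
Lemma bot_sat d b g : bot_ok d g -> g < m ->
  (forall c, c < bot_size d -> sat (bot_clause d b g c)) <-> val g = b.
Proof.
elim: d b g => [|d IH] b g /=.
  by case=> // g0 gm; apply: lit_size_sat.
set C := bot_size d; have C0 : 0 < C := leq_ltn_trans (leq0n _) (bot_size_gt d).
have CC : C <= C * C by rewrite leq_pmulr.
move=> ok gm; case: eqP => [g0|/eqP g0].
  by apply: lit_size_sat => //; have := bot_size_gt d; rewrite -/C; nia.
have gt0 : 0 < indeg g by rewrite lt0n.
case: ok => [/eqP|[g2 ok]]; first by rewrite (negbTE g0).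
have [fm fg _] := fst_predP gt0; have [lm lg _] := lst_predP gt0.
have okf := ok _ fm fg; have okl := ok _ lm lg.
case: eqP => [g1|/eqP g1].
  rewrite gate1 //; have := IH (~~ b) _ okf fm; rewrite -/C => IHf.
  have -> : (~~ val (fst_pred g) = b) <-> (val (fst_pred g) = ~~ b).
    by case: b {IH IHf}; case: (val _).
  rewrite -IHf; split=> h c cC; last by apply: h; rewrite ltn_mod.
  by have := h c; rewrite modn_small //; apply; lia.
have {g0 g1} g2 : indeg g = 2 by lia.
have g1 : 1 < indeg g by rewrite g2.
case cb: (conj_gate b g).
  rewrite gate_conj //; split=> h.
    have hb (z : bool) : val (if z then fst_pred g else lst_pred g) = b.
      apply/IH; rewrite ?(fun_if (fun j => j < m)) ?(fun_if (bot_ok d)); try by case: z.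
      move=> c cC; have := h (~~ z * (C * C) + c).
      rewrite divnMDl; last by lia.
      rewrite [c %/ _]divn_small; last by lia.
      rewrite mulnA modnMDl modn_small //.
      by case: z {h} => /= -> //; lia.
    by move=> j jm jg; case: (indeg2P g2 jm jg) => ->; [apply: (hb true) | apply: (hb false)].
  move=> c cC; case: eqP => _.
    by apply: (proj2 (IH b _ okf fm)); rewrite ?ltn_mod ?h.
  by apply: (proj2 (IH b _ okl lm)); rewrite ?ltn_mod ?h.
rewrite gate_disj ?cb //.
under [X in X <-> _]eq_forall => c do rewrite sat_or.
split=> [h|[j [jm jg vj]] c cC].
  have [vf|vf] := eqVneq (val (fst_pred g)) b; first by exists (fst_pred g).
  have [vl|vl] := eqVneq (val (lst_pred g)) b; first by exists (lst_pred g).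
  have fail j : bot_ok d j -> j < m -> val j != b ->
      exists2 c, c < C & ~~ sat (bot_clause d b j c).
    move=> okj jm /eqP vj; apply: contrapT => nf; apply: vj; apply/(IH b j okj jm) => c cC.
    by apply: contrapT => /negP ns; apply: nf; exists c.
  have [c0 c0C /negbTE n0] := fail _ okf fm vf.
  have [c1 c1C /negbTE n1] := fail _ okl lm vl.
  have := h (c1 * C + c0).
  rewrite modnMDl modn_small // divnMDl // divn_small // addn0 modn_small // n0 n1.
  by apply: contraPP => _; nia.
apply/orP; case: (indeg2P g2 jm jg) => jE; [left|right];
  by apply: (proj2 (IH b _ _ _)); rewrite ?ltn_mod // -jE.
Qed.

Lemma sat_const (b : bool) : sat (fun _ _ => b) = b.
Proof. by apply/satP/idP => [[]//|hb]; exists 0. Qed.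

Lemma sat_small d b g o c : indeg g = 2 -> k + o < K ->
  sat (top_clause d.+1 b g o c) =
  (~~ conj_gate b g && ((x (k + o) == 0) != (c %/ top_size d == 0))) ||
  sat (top_clause d b (if c %/ top_size d == 0 then fst_pred g else lst_pred g)
         (if c %/ top_size d == 0 then o.+1 else o.+1 + top_vars d) (c %% top_size d)).
Proof.
move=> g2 oK; rewrite /= g2 /= sat_or sat_and.
by rewrite (@sat_at _ (fun u => (u == 0) != (c %/ top_size d == 0))).
Qed.

Lemma sat_large d b g o c : 2 < indeg g -> k + o < K ->
  sat (top_clause d.+1 b g o c) =
  let j := c %/ bot_size d in
  if conj_gate b g then
    ~~ ((j < m) && arcf j g) || sat (bot_clause d b j (c %% bot_size d))
  else (x (k + o) != j) || [&& j < m, arcf j g & sat (bot_clause d b j (c %% bot_size d))].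
Proof.
move=> g2 oK /=; have -> : indeg g == 0 = false by lia.
have -> : indeg g == 1 = false by lia.
have -> : indeg g == 2 = false by lia.
case: ifP => _; rewrite sat_or; congr (_ || _).
- exact: sat_const.
- by rewrite (@sat_at _ (fun u => u != c %/ bot_size d)).
by rewrite (@sat_and (_ < m)) (@sat_and (arcf _ g)).
Qed.

(** Where the prover moves, a challenge aimed at a predecessor other than the one named by variable
    [k + o] is met by the literal on this variable. So only challenges at the named predecessor have
    force, and these establish its value. *)
Lemma top_sound d b g o : top_ok d g -> g < m -> k + o + top_vars d <= K ->
  (forall c, c < top_size d -> sat (top_clause d b g o c)) -> val g = b.
Proof.
elim: d b g o => [|d IH] b g o.
  by case=> // g0 gm _; apply: (proj1 (lit_size_sat _ _ _ _)).
move=> ok gm oK h; have := ok => /=.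
set C := top_size d; have C0 : 0 < C := leq_ltn_trans (leq0n _) (top_size_gt d).
set B := bot_size d; have B0 : 0 < B := leq_ltn_trans (leq0n _) (bot_size_gt d).
have hsz : top_size d.+1 = m * B + 2 * C by [].
have oK' : k + o < K by move: oK => /=; lia.
have [g0 _|g0] := eqVneq (indeg g) 0.
  apply/(lit_size_sat b gm g0 (top_size_gt d.+1)) => c cC.
  by have := h c cC; rewrite /= g0.
have gt0 : 0 < indeg g by rewrite lt0n.
have [fm fg _] := fst_predP gt0; have [lm lg _] := lst_predP gt0.
case=> [/eqP|{}ok]; first by rewrite (negbTE g0).
have [g1|g1] := eqVneq (indeg g) 1.
  rewrite gate1 // (IH (~~ b) _ o.+1) ?negbK //.
  - by have := ok _ fm fg; rewrite g1.
  - by move: oK => /=; lia.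
  move=> c cC; have := h c; rewrite /= g1 /= -/C modn_small //; apply.
  by rewrite -/B; lia.
have [g2|g2] := eqVneq (indeg g) 2.
  have child (z : bool) : ~~ conj_gate b g && ((x (k + o) == 0) != z) = false ->
      val (if z then fst_pred g else lst_pred g) = b.
    move=> nz; apply: (IH _ _ (if z then o.+1 else o.+1 + top_vars d)).
    - by case: z {nz}; [have := ok _ fm fg | have := ok _ lm lg]; rewrite g2.
    - by case: z {nz}.
    - by move: oK => /=; case: z {nz}; lia.
    move=> c cC; have := h (~~ z * C + c); rewrite sat_small // -/C.
    rewrite divnMDl // [c %/ _]divn_small // modnMDl modn_small // addn0.
    have -> : (~~ z == 0 :> nat) = z by case: z {nz}.
    by rewrite nz /=; apply; rewrite ?hsz -?/B -?/C; case: z {nz} => /=; lia.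
  have lt1 : 1 < indeg g by rewrite g2.
  case cg: (conj_gate b g).
    apply/gate_conj => // j jm jg; case: (indeg2P g2 jm jg) => ->.
      by apply: (child true); rewrite cg.
    by apply: (child false); rewrite cg.
  apply/gate_disj; rewrite ?cg //; set z := x (k + o) == 0.
  exists (if z then fst_pred g else lst_pred g); split; try by case: (z).
  by apply: child; rewrite -/z eqxx andbF.
have lt2 : 2 < indeg g by lia.
have okb j : j < m -> arcf j g -> bot_ok d j by move=> jm jg; have := ok j jm jg; rewrite lt2.
have dec j c : c < B -> (j * B + c) %/ B = j /\ (j * B + c) %% B = c.
  by move=> cB; rewrite divnMDl // divn_small // modnMDl modn_small // addn0.
have lt j c : j < m -> c < B -> j * B + c < top_size d.+1.
  by move=> jm cB; rewrite hsz; nia.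
case cg: (conj_gate b g).
  apply/(gate_conj gm _ cg); first exact: ltnW.
  move=> j jm jg; apply/(bot_sat _ (okb j jm jg) jm) => c cB.
  have [e1 e2] := dec j c cB; have := h _ (lt j c jm cB).
  by rewrite sat_large // -/B /= e1 e2 cg jm jg.
apply/(gate_disj gm); rewrite ?cg //; first exact: ltnW.
set j := x (k + o); have jm : j < m by apply: xm.
have hj c : c < B -> arcf j g && sat (bot_clause d b j c).
  move=> cB; have [e1 e2] := dec j c cB; have := h _ (lt j c jm cB).
  by rewrite sat_large // -/B /= e1 e2 cg -/j eqxx jm.
have /andP[jg _] := hj 0 B0.
exists j; split=> //; apply/(bot_sat _ (okb j jm jg) jm) => c cB.
by have /andP[] := hj c cB.
Qed.

(** Winning moves for the prover, in the preorder by which [top_clause] numbers its variables: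
    position 0 for [g], then [top_vars d] positions for the subtree of the first predecessor, then
    those for the last. At in-degree 2 the move 0 selects the first predecessor. *)
Fixpoint top_witness (d : nat) (b : bool) (g p : nat) : nat :=
  if d is d.+1 then
    if p is q.+1 then
      if indeg g == 1 then top_witness d (~~ b) (fst_pred g) q
      else if q < top_vars d then top_witness d b (fst_pred g) q
      else top_witness d b (lst_pred g) (q - top_vars d)
    else if indeg g == 2 then nat_of_bool (val (fst_pred g) != b)
    else find (fun j => arcf j g && (val j == b)) (iota 0 m)
  else 0.

Lemma top_complete d b g o : top_ok d g -> g < m -> k + o + top_vars d <= K ->
  (forall p, p < top_vars d -> x (k + o + p) = top_witness d b g p %% m) ->
  val g = b -> forall c, c < top_size d -> sat (top_clause d b g o c).
Proof.
elim: d b g o => [|d IH] b g o.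
  by case=> // g0 gm _ _ vg; apply: (proj2 (lit_size_sat _ _ _ _)).
move=> ok gm oK xw vg c cC.
have ok' : indeg g = 0 \/ forall j, j < m -> arcf j g ->
  if 2 < indeg g then bot_ok d j else top_ok d j by [].
set C := top_size d; have C0 : 0 < C := leq_ltn_trans (leq0n _) (top_size_gt d).
set B := bot_size d; have B0 : 0 < B := leq_ltn_trans (leq0n _) (bot_size_gt d).
have oK' : k + o < K by move: oK => /=; lia.
have [g0|g0] := eqVneq (indeg g) 0.
  have := proj2 (lit_size_sat b gm g0 (top_size_gt d.+1)) vg c cC.
  by rewrite /= g0.
have gt0 : 0 < indeg g by rewrite lt0n.
have [fm fg _] := fst_predP gt0; have [lm lg _] := lst_predP gt0.
case: ok' => [/eqP|{}ok]; first by rewrite (negbTE g0).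
have [g1|g1] := eqVneq (indeg g) 1.
  rewrite /= g1 /=; apply: IH; rewrite ?ltn_mod //.
  - by have := ok _ fm fg; rewrite g1.
  - by move: oK => /=; lia.
  - move=> p pZ; have -> : k + o.+1 + p = k + o + p.+1 by lia.
    by rewrite xw /= ?g1 //; lia.
  - by rewrite -vg (gate1 gm g1) negbK.
have [g2|g2] := eqVneq (indeg g) 2.
  rewrite sat_small // -/C.
  set z := c %/ C == 0.
  have x0 : (x (k + o) == 0) = (val (fst_pred g) == b).
    have := xw 0; rewrite addn0 /= g2 => -> //.
    (* In-degree 2 forces two nodes, so the bit survives the reduction modulo [m]. *)
    have m2 : 1 < m by apply: leq_trans (indeg_le g); rewrite g2.
    by rewrite modn_small; case: (_ == b); rewrite //; lia.
  have lt1 : 1 < indeg g by rewrite g2.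
  case bad: (~~ conj_gate b g && ((x (k + o) == 0) != z)) => //=.
  apply: IH; rewrite ?ltn_mod //.
  - by case: (z); [have := ok _ fm fg | have := ok _ lm lg]; rewrite g2.
  - by case: (z).
  - by move: oK => /=; case: (z); lia.
  - move=> p pZ; case: (z).
      have -> : k + o.+1 + p = k + o + p.+1 by lia.
      by rewrite xw /= ?(negbTE g1) ?pZ //; lia.
    have -> : k + (o.+1 + top_vars d) + p = k + o + (p + top_vars d).+1 by lia.
    by rewrite xw /= ?(negbTE g1) ?ltnNge ?leq_addl ?addnK //; lia.
  case cg: (conj_gate b g) bad => /= bad.
    by case: (z); apply: (proj1 (gate_conj gm lt1 cg) vg).
  move/negbFE/eqP: bad; rewrite x0 => <-; case: (val (fst_pred g) =P b) => // vf.
  have [|j [jm jg vj]] := proj1 (gate_disj gm lt1 _) vg; first by rewrite cg.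
  by case: (indeg2P g2 jm jg) => jE; move: vj; rewrite jE.
have lt2 : 2 < indeg g by lia.
have lt1 : 1 < indeg g by lia.
have okb j : j < m -> arcf j g -> bot_ok d j by move=> jm jg; have := ok j jm jg; rewrite lt2.
rewrite sat_large // -/B /=.
set j := c %/ B; have cB : c %% B < B by rewrite ltn_mod.
case cg: (conj_gate b g).
  case: andP => //= -[jm jg].
  by apply: (proj2 (bot_sat b (okb j jm jg) jm)) => //; apply: (proj1 (gate_conj gm lt1 cg)).
have [|j0 [j0m j0g vj0]] := proj1 (gate_disj gm lt1 _) vg; first by rewrite cg.
set a := fun j => arcf j g && (val j == b).
have ha : has a (iota 0 m).
  by apply/hasP; exists j0; rewrite ?mem_iota // /a j0g vj0 eqxx.
have am : find a (iota 0 m) < m by rewrite -[X in _ < X](size_iota 0) -has_find.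
have := nth_find 0 ha; rewrite nth_iota // add0n => /andP[ag /eqP va].
have := xw 0; rewrite addn0 /= (negbTE g2) -/a modn_small // => -> //.
case: eqP => //= <-; rewrite am ag /=.
exact: (proj2 (bot_sat b (okb _ am ag) am)).
Qed.

End Clauses.


(** * Weighted satisfiability as a system of clauses *)

Section CircuitClauses.
Variables (d m k : nat) (arcf : nat -> nat -> bool) (andf : nat -> bool).

Local Notation deg := (indeg m arcf).

(** The added 1 keeps the number positive: even a clause that always holds needs a variable to
    satisfy it. *)
Definition clause_vars : nat := (k + top_vars d).+1.

(** Three families interleaved modulo 3: challenges to the output, coincidences of two of the [k]
    inputs at one of [m] values, and the [k] conditions of being an input. Numbers beyond the range
    of their family give clauses that always hold. *)
Definition clause_count : nat := 3 * (top_size m k d + k * k * m + k).+1.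

(* The variables [i < k] are distinct input nodes, and every challenge to the
   value 1 of the output node is met. *)
Definition clause (c i u : nat) : bool :=
  if c %% 3 == 0 then
    (top_size m k d <= c %/ 3) || top_clause m k arcf andf d true m.-1 0 (c %/ 3) i u
  else if c %% 3 == 1 then
    [|| c %/ 3 %/ m %/ k <= c %/ 3 %/ m %% k, k <= c %/ 3 %/ m %/ k |
      ((i == c %/ 3 %/ m %% k) || (i == c %/ 3 %/ m %/ k)) && (u != c %/ 3 %% m)]
  else (k <= c %/ 3) || ((i == c %/ 3) && (deg u == 0)).

Variable C : circuit.
Hypothesis mC : m = (csize C).+1.
Hypothesis arcfP : forall i j : 'I_(csize C).+1, arcf i j = ((i, j) \in arcs C).
Hypothesis andfP : forall i : 'I_(csize C).+1, andf i = (i \in and_nodes C).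
Local Notation node := 'I_(csize C).+1.

Lemma indeg_preds (g : node) : deg g = #|preds g|.
Proof.
rewrite /indeg mC -sum1_card [RHS]big_mkcond.
have -> : iota 0 (csize C).+1 = index_iota 0 (csize C).+1 by rewrite /index_iota subn0.
by rewrite big_mkord; apply: eq_bigr => j _; rewrite inE -arcfP; case: (arcf j g).
Qed.

Lemma arcf_lt i j : i < m -> j < m -> arcf i j -> i < j.
Proof.
rewrite mC => im jm; rewrite (arcfP (Ordinal im) (Ordinal jm)) => a.
by have /forallP/(_ (Ordinal im, Ordinal jm)) := arcs_sorted C; rewrite a.
Qed.

Lemma forall_preds (g : node) (P : nat -> bool) :
  [forall j in preds g, P j] = all (fun j => arcf j g ==> P j) (iota 0 m).
Proof.
apply/forall_inP/allP=> [h j|h j jg].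
  rewrite mem_iota mC => jm; apply/implyP=> jg.
  by apply: (h (Ordinal jm)); rewrite inE -arcfP.
by apply: (implyP (h j _)); rewrite ?mem_iota ?mC ?ltn_ord //; move: jg; rewrite inE -arcfP.
Qed.

Lemma exists_preds (g : node) (P : nat -> bool) :
  [exists j in preds g, P j] = has (fun j => arcf j g && P j) (iota 0 m).
Proof.
apply/exists_inP/hasP=> [[j]|[j]].
  by rewrite inE -arcfP => jg Pj; exists (nat_of_ord j); rewrite ?mem_iota ?mC ?ltn_ord ?jg.
rewrite mem_iota mC => jm /andP[jg Pj].
by exists (Ordinal jm) => //; rewrite inE -arcfP.
Qed.

Lemma evaluationP (v : {ffun node -> bool}) (val : nat -> bool) :
  (forall i : node, val i = v i) ->
  evaluation v <-> forall g, g < m -> 0 < deg g -> val g = gate_value m arcf andf val g.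
Proof.
move=> valE.
have gateE (i : node) : gate_value m arcf andf val i =
    if #|preds i| == 1 then [forall j in preds i, ~~ v j]
    else if i \in and_nodes C then [forall j in preds i, v j]
    else [exists j in preds i, v j].
  rewrite /gate_value indeg_preds andfP -!forall_preds -exists_preds.
  congr (if _ then _ else _); last congr (if _ then _ else _).
  - by apply: eq_forallb => j; rewrite valE.
  - by apply: eq_forallb => j; rewrite valE.
  - by apply: eq_existsb => j; rewrite valE.
have inputE (i : node) : (i \notin input_nodes C) = (0 < deg i).
  by rewrite inE indeg_preds lt0n.
split.
  move=> /forallP ev g gm g0; have gm' : g < (csize C).+1 by rewrite -mC.
  have /implyP := ev (Ordinal gm').
  by rewrite inputE => /(_ g0) /eqP; rewrite -gateE -valE.
move=> ev; apply/forallP=> i; apply/implyP; rewrite inputE => i0.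
by rewrite -gateE -valE; apply/eqP/ev; rewrite // mC.
Qed.

Lemma gate_value_ext (val val' : nat -> bool) g :
  (forall j, j < m -> arcf j g -> val j = val' j) ->
  gate_value m arcf andf val g = gate_value m arcf andf val' g.
Proof.
move=> h; rewrite /gate_value; congr (if _ then _ else _); last congr (if _ then _ else _).
- apply: eq_in_all => j; rewrite mem_iota => jm.
  by case jg: (arcf j g); rewrite //= h.
- apply: eq_in_all => j; rewrite mem_iota => jm.
  by case jg: (arcf j g); rewrite //= h.
- apply: eq_in_has => j; rewrite mem_iota => jm.
  by case jg: (arcf j g); rewrite //= h.
Qed.

(** Recursion on fuel: arcs increase the node number, so any [n > g] is enough. *)
Fixpoint compute_value (s : seq nat) (n g : nat) : bool :=
  if n is n.+1 then
    if deg g == 0 then g \in s else gate_value m arcf andf (compute_value s n) g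
  else false.

Lemma compute_value_stable s n n' g : g < m -> g < n -> g < n' ->
  compute_value s n g = compute_value s n' g.
Proof.
elim: n n' g => // n IH [//|n'] g gm gn gn' /=.
case: eqP => // _; apply: gate_value_ext => j jm jg.
by have := arcf_lt jm gm jg; move=> lt; apply: IH => //; lia.
Qed.

Lemma evaluation_exists (s : seq nat) : exists val : nat -> bool,
  (forall g, g < m -> deg g = 0 -> val g = (g \in s)) /\
  (forall g, g < m -> 0 < deg g -> val g = gate_value m arcf andf val g).
Proof.
exists (fun g => compute_value s g.+1 g); split=> [g gm g0 /=|g gm g0].
  by rewrite g0.
have -> : compute_value s g.+1 g = gate_value m arcf andf (compute_value s g) g.
  by rewrite /= eqn0Ngt g0.
apply: gate_value_ext => j jm jg.
by apply: compute_value_stable; rewrite // (arcf_lt jm gm jg).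
Qed.

(** Weft and depth are measured along paths from inputs. Going back along arcs from [g] decreases
    the node number and so ends in an input, whence any path from [g] to the output extends to a
    measured one. *)
Lemma in_path_to (g : node) : exists i p,
  [/\ i \in input_nodes C, path (@arc C) i p & last i p = g].
Proof.
have [n] := ubnP (nat_of_ord g); elim: n g => // n IH g gn.
have [g0|] := boolP (g \in input_nodes C); first by exists g, [::].
rewrite inE cards_eq0 => /set0Pn[j]; rewrite inE => jg.
have jltg : j < g by apply: arcf_lt; rewrite ?mC ?ltn_ord // arcfP.
have [|i [p [i0 ip lp]]] := IH j; first by lia.
exists i, (rcons p g); split=> //; last by rewrite last_rcons.
by rewrite rcons_path ip lp.
Qed.

Hypotheses (weft1 : weft_le C 1) (depthd : depth_le C d).

(** Here [q] leads from [g] to the output and [n] is the depth that remains. If [q] already meets a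
    large gate, a large [g] would put two on one path; if [n = 0], a predecessor of [g] would make a
    path too long. *)
Lemma circuit_ok n (g : node) q : path (@arc C) g q -> last g q = ord_max ->
  n + size q = d ->
  (has (@large_node C) q -> bot_ok m arcf n g) /\
  (~~ has (@large_node C) q -> top_ok m arcf n g).
Proof.
have input0 (i : node) : i \in input_nodes C -> deg i = 0.
  by rewrite inE -indeg_preds => /eqP.
have full (i : node) q' : path (@arc C) i q' -> last i q' = ord_max ->
    size q' <= d /\ count (@large_node C) (i :: q') <= 1.
  move=> iq lq; have [i0 [p [i0i ip lp]]] := in_path_to i.
  have io : in_out_path i0 (p ++ q') by split; rewrite // ?cat_path ?last_cat ?ip lp.
  split.
    by apply: leq_trans (depthd io); rewrite size_cat leq_addl.
  have ip' : i \in i0 :: p by rewrite -lp mem_last.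
  apply: leq_trans (weft1 io); rewrite -cat_cons count_cat /= leq_add2r.
  case li: (large_node i) => //; rewrite -[_ + _]/(count (@large_node C) (i0 :: p)).
  by rewrite -has_count; apply/hasP; exists i.
elim: n g q => [|n IH] g q gq lq sz.
  have g0 : deg g = 0.
    apply/eqP; apply: contraT => g0; rewrite indeg_preds cards_eq0 in g0.
    have [j] := set0Pn _ g0; rewrite inE => jg.
    have jgq : path (@arc C) j (g :: q) by rewrite /= gq andbT.
    have [lt _] := full j (g :: q) jgq lq.
    by move: lt; rewrite /= -sz add0n ltnn.
  by split=> _; left.
have [g0|g0] := eqVneq (deg g) 0; first by split=> _; left.
have step j : j < m -> arcf j g -> exists2 j' : node, j' = j :> nat &
    path (@arc C) j' (g :: q).
  rewrite mC => jm jg; exists (Ordinal jm) => //=; rewrite gq andbT /arc.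
  by rewrite -arcfP.
have sz' : n + size (g :: q) = d by rewrite /= addnS -sz.
split=> hq; right.
  split.
    rewrite leqNgt; apply/negP=> lg; have [_] := full g q gq lq.
    have lg' : large_node g by rewrite /large_node -indeg_preds.
    by rewrite /= lg' add1n ltnS leqNgt -has_count hq.
  move=> j jm jg; have [j' <- jp] := step j jm jg.
  by apply: (proj1 (IH j' (g :: q) jp lq sz')); rewrite /= hq orbT.
move=> j jm jg; have [j' <- jp] := step j jm jg.
have [bo to] := IH j' (g :: q) jp lq sz'.
case: ifP => lg; first by apply: bo; rewrite /= /large_node -indeg_preds lg.
by apply: to; rewrite /= /large_node -indeg_preds lg.
Qed.

Lemma circuit_clauses : weighted_sat C k <->
  exists x : nat -> nat, (forall i, i < clause_vars -> x i < m) /\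
    forall c, c < clause_count -> exists2 i, i < clause_vars & clause c i (x i).
Proof.
have m0 : 0 < m by rewrite mC.
have out_lt : m.-1 < m by rewrite mC.
have outE : m.-1 = (ord_max : node) by rewrite mC.
have kK : k <= clause_vars by rewrite /clause_vars; lia.
have K0 : 0 < clause_vars by [].
have ok : top_ok m arcf d m.-1.
  rewrite outE; apply: (proj2 (@circuit_ok d ord_max [::] _ _ _)) => //.
  by rewrite addn0.
have oK : k + 0 + top_vars d <= clause_vars by rewrite /clause_vars; lia.
split.
  move=> [v [ev vmax vk]].
  pose val g := v (inord g).
  have valE (i : node) : val i = v i by rewrite /val inord_val.
  have val_gate := proj1 (evaluationP valE) ev.
  pose xs := [seq nat_of_ord i | i <- enum [set i in input_nodes C | v i]].
  have sz : size xs = k by rewrite size_map -cardE.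
  have xs_uniq : uniq xs by rewrite map_inj_uniq ?enum_uniq //; apply: ord_inj.
  have xsP g : g < m -> (g \in xs) = (deg g == 0) && val g.
    rewrite mC => gm; rewrite (_ : g = Ordinal gm) // (mem_map (@ord_inj _)).
    by rewrite mem_enum !inE -indeg_preds valE mC.
  have xs_lt g : g \in xs -> g < m by case/mapP=> i _ ->; rewrite mC.
  (* The first [k] variables enumerate the true inputs; the others record winning moves of the
     prover. *)
  pose x i := if i < k then nth 0 xs i
              else top_witness m arcf val d true m.-1 (i - k) %% m.
  have xE : [seq x i | i <- iota 0 k] = xs.
    rewrite -sz -[RHS](mkseq_nth 0); apply/eq_in_map => i.
    by rewrite mem_iota /x sz add0n => /= ->.
  have xm i : x i < m.
    rewrite /x; case: ifP => ik; last by rewrite ltn_mod.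
    by apply: xs_lt; rewrite mem_nth ?sz.
  have val_input g : g < m -> deg g = 0 -> val g = (g \in [seq x i | i <- iota 0 k]).
    by move=> gm g0; rewrite xE xsP // g0.
  exists x; split=> [i _ //|c cW]; rewrite /clause.
  case c0: (c %% 3 == 0); last case c1: (c %% 3 == 1).
  + case: (leqP (top_size m k d) (c %/ 3)) => [_|cs]; first by exists 0.
    apply/satP; apply: (top_complete kK val_input val_gate K0 ok out_lt oK) => //.
      by move=> p pZ; rewrite /x addn0 ltnNge leq_addr /= addKn.
    by rewrite outE valE.
  + set a := _ %% k; set b := _ %/ k; set u := _ %% m.
    case: (leqP b a) => ab; first by exists 0.
    case: (leqP k b) => bk; first by exists 0.
    have xab : x a != x b.
      have ak := ltn_trans ab bk.
      by rewrite /x ak bk nth_uniq ?sz // ltn_eqF.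
    have [xau|xau] := eqVneq (x a) u.
      exists b; first exact: leq_trans kK.
      by rewrite eqxx orbT /= -xau eq_sym.
    by exists a; [apply: leq_trans kK; apply: ltn_trans bk | rewrite eqxx].
  + case: (leqP k (c %/ 3)) => ck; first by exists 0.
    exists (c %/ 3); first exact: leq_trans kK.
    rewrite eqxx /x ck /=.
    have := xsP (nth 0 xs (c %/ 3)); rewrite mem_nth ?sz // => H.
    have /H : nth 0 xs (c %/ 3) < m by apply: xs_lt; rewrite mem_nth ?sz.
    by move/esym/andP=> [].
move=> [x [xm xc]].
have sub3 t q : t < 3 -> (q * 3 + t) %% 3 = t /\ (q * 3 + t) %/ 3 = q.
  by move=> t3; rewrite modnMDl modn_small // divnMDl // divn_small // addn0.
have x_input q : q < k -> deg (x q) = 0.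
  move=> qk; have [e1 e2] := @sub3 2 q isT.
  have [|i iK] := xc (q * 3 + 2); first by rewrite /clause_count; lia.
  rewrite /clause e1 e2 /= leqNgt qk /= => /andP[/eqP -> /eqP ->].
  done.
have x_inj a b : a < b -> b < k -> x a <> x b.
  move=> ab bk xab; have xam : x a < m by apply: xm; lia.
  (* Clause number [q * 3 + 1] forbids the variables [a] and [b] to share the value [x a]. *)
  set q := (b * k + a) * m + x a.
  have k0 : 0 < k by lia.
  have q1 : q %/ m = b * k + a by rewrite divnMDl // divn_small // addn0.
  have q2 : q %% m = x a by rewrite modnMDl modn_small.
  have ak := ltn_trans ab bk.
  have [e1 e2] := @sub3 1 q isT.
  have [|i iK] := xc (q * 3 + 1).
    have h1 : b * k + a < k * k.
      by apply: (@leq_trans (b.+1 * k)); [rewrite mulSn; lia | rewrite leq_mul2r bk orbT].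
    have : q < k * k * m.
      apply: (@leq_trans ((b * k + a).+1 * m)); last by rewrite leq_mul2r h1 orbT.
      by rewrite mulSn /q; lia.
    by rewrite /clause_count; lia.
  rewrite /clause e1 e2 /= q1 q2 divnMDl // divn_small // addn0 modnMDl modn_small //.
  rewrite leqNgt ab leqNgt bk /= => /andP[/orP[]/eqP ->]; rewrite ?eqxx //.
  by rewrite xab eqxx.
have [val [val_input val_gate]] := evaluation_exists [seq x i | i <- iota 0 k].
pose v : {ffun node -> bool} := [ffun i => val (nat_of_ord i)].
have valE (i : node) : val i = v i by rewrite ffunE.
exists v; split.
- exact/(evaluationP valE).
- rewrite -valE -outE; apply: (top_sound kK xm val_input val_gate K0 ok out_lt oK).
  move=> q qs; have [e1 e2] := @sub3 0 q isT.
  have [|i iK] := xc (q * 3 + 0); first by rewrite /clause_count; lia.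
  by rewrite /clause e1 e2 /= leqNgt qs /= => h; apply/satP; exists i.
have xs_uniq : uniq [seq x i | i <- iota 0 k].
  rewrite map_inj_in_uniq ?iota_uniq // => a b; rewrite !mem_iota !add0n => /= ak bk xab.
  case: (ltngtP a b) => // ab; exfalso; first exact: x_inj ab bk xab.
  exact: x_inj ab ak (esym xab).
rewrite cardE -(size_map (@nat_of_ord _)) -[RHS](size_iota 0) -[RHS](size_map x).
apply: perm_size; apply: uniq_perm => //.
  by rewrite map_inj_uniq ?enum_uniq //; apply: ord_inj.
move=> g; apply/mapP/mapP=> [[i]|[t]].
  rewrite mem_enum !inE -indeg_preds -valE => /andP[/eqP i0 vi] ->.
  by apply/mapP; rewrite -val_input // mC.
rewrite mem_iota add0n => /= tk ->.
have xt : x t < (csize C).+1 by rewrite -mC; apply: xm; lia.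
exists (Ordinal xt) => //; rewrite mem_enum !inE -indeg_preds -valE /= x_input //=.
by rewrite val_input ?x_input ?map_f ?mem_iota // mC.
Qed.

End CircuitClauses.


(** * The reduction *)

(** A code opens with a 1 for each node, so its first 0 reveals the number of nodes. All other
    fields then have known offsets, and the weight is the length that remains. *)
Definition code_nodes (w : word) : nat :=
  find (fun j => ~~ nth false w j) (iota 0 (size w)).
Definition code_arc (w : word) (i j : nat) : bool :=
  nth false w ((code_nodes w).+1 + (i * code_nodes w + j)).
Definition code_and (w : word) (i : nat) : bool :=
  nth false w ((code_nodes w).+1 + code_nodes w * code_nodes w + i).
Definition code_weight (w : word) : nat :=
  size w - ((code_nodes w).+1 + code_nodes w * code_nodes w + code_nodes w).

Lemma matrix_codeE n (A : {set 'I_n * 'I_n}) (f : nat -> nat -> bool) :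
  (forall i j : 'I_n, f i j = ((i, j) \in A)) ->
  matrix_code A = flatten [seq [seq f i j | j <- iota 0 n] | i <- iota 0 n].
Proof.
move=> fA; rewrite /matrix_code -val_enum_ord -map_comp; congr flatten.
apply: eq_map => i /=; rewrite -map_comp; apply: eq_map => j /=.
by rewrite fA.
Qed.

Lemma nth_matrix (f : nat -> nat -> bool) n n' i j : i < n -> j < n' ->
  nth false (flatten [seq [seq f i j | j <- iota 0 n'] | i <- iota 0 n]) (i * n' + j) = f i j.
Proof.
move=> ni nj; suff H a : i < a + n -> a <= i ->
    nth false (flatten [seq [seq f i j | j <- iota 0 n'] | i <- iota a n])
      ((i - a) * n' + j) = f i j.
  by have := H 0; rewrite subn0; apply.
elim: n a {ni} => [|n IH] a ian ai; first lia.
rewrite /= nth_cat size_map size_iota.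
have [ia|ia] := eqVneq i a.
  by rewrite ia subnn mul0n add0n nj (nth_map 0) ?size_iota // nth_iota.
have -> : (i - a) * n' + j < n' = false by apply/negbTE; rewrite -leqNgt; nia.
have -> : (i - a) * n' + j - n' = (i - a.+1) * n' + j by nia.
by apply: IH; lia.
Qed.

(** * Reading a circuit from its code *)

Section Decode.
Variables (C : circuit) (k : nat).
Let w := circuit_code (C, k).
Let m := (csize C).+1.

Lemma code_nodesE : code_nodes w = m.
Proof.
have nthm j : j < m -> nth false w j.
  by move=> jm; rewrite /w /circuit_code -cat_cons nth_cat size_nseq jm nth_nseq jm.
have nm : nth false w m = false.
  by rewrite /w /circuit_code nth_cat size_nseq ltnn subnn.
have sw : m < size w by rewrite /w /circuit_code size_cat size_nseq /=; lia.
have hs : has (fun j => ~~ nth false w j) (iota 0 (size w)).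
  by apply/hasP; exists m; rewrite ?mem_iota ?nm.
have lt : code_nodes w < size w by rewrite -[X in _ < X](size_iota 0) -has_find.
have fw := nth_find 0 hs; rewrite nth_iota // add0n in fw.
case: (ltngtP (code_nodes w) m) => // lm; first by rewrite nthm in fw.
by have := before_find 0 lm; rewrite nth_iota // add0n nm.
Qed.

Let body := matrix_code (arcs C) ++
  [seq i \in and_nodes C | i <- enum 'I_m] ++ nseq k true.

Lemma code_tail j : nth false w (m.+1 + j) = nth false body j.
Proof.
rewrite /w /circuit_code nth_cat size_nseq ltnNge (leq_trans (leqnSn _) (leq_addr _ _)) /=.
by rewrite addSnnS addKn.
Qed.

Lemma code_arcE (i j : 'I_m) : code_arc w i j = ((i, j) \in arcs C).
Proof.
pose f a b := ((inord a : 'I_m, inord b : 'I_m) \in arcs C).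
have fE (a b : 'I_m) : f a b = ((a, b) \in arcs C) by rewrite /f !inord_val.
rewrite /code_arc code_nodesE code_tail nth_cat size_matrix_code.
have -> : i * m + j < m * m by have := ltn_ord i; have := ltn_ord j; nia.
by rewrite (matrix_codeE fE) nth_matrix.
Qed.

Lemma code_andE (i : 'I_m) : code_and w i = (i \in and_nodes C).
Proof.
rewrite /code_and code_nodesE -addnA code_tail nth_cat size_matrix_code.
rewrite ltnNge leq_addr /= addKn nth_cat size_map size_enum_ord ltn_ord.
by rewrite (nth_map i) ?size_enum_ord // nth_ord_enum.
Qed.

Lemma code_weightE : code_weight w = k.
Proof.
rewrite /code_weight code_nodesE /w /circuit_code !size_cat /= !size_cat.
rewrite !size_nseq size_matrix_code size_map size_enum_ord -/m; lia.
Qed.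

End Decode.

(** * The instance built from a code *)

Section Reduction.
Variable d : nat.

Definition red_clause (w : word) : nat -> nat -> nat -> bool :=
  clause d (code_nodes w) (code_weight w) (code_arc w) (code_and w).
Definition red_vars (w : word) : nat := clause_vars d (code_weight w).
Definition red_count (w : word) : nat := clause_count d (code_nodes w) (code_weight w).
(** One more than the number of nodes, which secures both [m <= r] and [1 < r], also for a circuit
    with a single node. *)
Definition red_radius (w : word) : nat := (code_nodes w).+1.
Definition red_adj (w : word) : nat -> nat -> bool :=
  adj_nat (red_vars w) (red_count w) (code_nodes w) (red_radius w) (red_clause w).
Definition red_order (w : word) : nat :=
  gadget_order (red_vars w) (red_count w) (red_radius w).
Definition red_paths (w : word) : nat :=
  red_vars w * arcs_per_track (red_count w) (red_radius w) + 4.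
Definition red_graph (w : word) : sgraph :=
  gadget_graph (red_vars w) (red_count w) (code_nodes w) (red_radius w) (red_clause w).

Definition red_word (w : word) : word :=
  nseq (red_order w) true ++ [:: false] ++
  flatten [seq flatten [seq [:: red_adj w i j] | j <- iota 0 (red_order w)]
          | i <- iota 0 (red_order w)] ++
  nseq (red_paths w) true.

Lemma graph_code_red w : graph_code (red_graph w, red_paths w) = red_word w.
Proof.
rewrite /graph_code /red_word; congr (_ ++ _ :: _ ++ _).
rewrite (@matrix_codeE _ _ (red_adj w)); last by move=> i j; rewrite inE.
congr flatten; apply: eq_map => i; rewrite -[LHS]flatten_seq1 -map_comp //.
Qed.

Lemma red_correct (C : circuit) k : weft_le C 1 -> depth_le C d ->
  let w := circuit_code (C, k) in
  weighted_sat C k <-> isometric_path_partition (@adj (red_graph w)) (red_paths w).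
Proof.
move=> weft1 depthd w.
have mE : code_nodes w = (csize C).+1 := code_nodesE C k.
rewrite gadget_graph_ipp; try by rewrite /red_radius ?mE //.
have -> : k = code_weight w by rewrite code_weightE.
apply: circuit_clauses => //.
- by move=> i j; apply: code_arcE.
- by move=> i; apply: code_andE.
Qed.

Lemma red_pathwidth (C : circuit) k :
  pathwidth (@adj (red_graph (circuit_code (C, k)))) <= 3 * k + (3 * top_vars d + 17).
Proof.
set w := circuit_code _; have mE : code_nodes w = (csize C).+1 := code_nodesE C k.
have := @gadget_graph_pathwidth (red_vars w) (red_count w) _ (red_radius w) (red_clause w).
move=> /(_ _ (leqnSn _)) h; apply: leq_trans (h _ _) _; rewrite // /red_radius ?mE //.
by rewrite /red_vars /clause_vars code_weightE; lia.
Qed.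

(** * Polynomial running time of the construction *)

Lemma polytime_nodes : polytime (fun w e => code_nodes w).
Proof. rewrite /code_nodes; polytime. Qed.

Lemma polytime_weight : polytime (fun w e => code_weight w).
Proof. rewrite /code_weight; have hn := polytime_nodes; polytime. Qed.

Lemma polytime_arc F G : polytime F -> polytime G ->
  polytime (fun w e => code_arc w (F w e) (G w e)).
Proof. move=> hF hG; rewrite /code_arc; have hn := polytime_nodes; polytime. Qed.

Lemma polytime_conj b F : polytime F ->
  polytime (fun w e => conj_gate (code_and w) b (F w e)).
Proof.
move=> hF; rewrite /conj_gate /code_and; have hn := polytime_nodes.
by case: b; cbn iota; polytime.
Qed.

Lemma polytime_indeg F : polytime F ->
  polytime (fun w e => indeg (code_nodes w) (code_arc w) (F w e)).
Proof.
move=> hF; rewrite /indeg; have hn := polytime_nodes.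
apply: (polytime_sum (G := fun w e j => code_arc w j (F w e))) => //.
apply: polytime_arc; first exact: polytime_var.
exact: polytime_shift.
Qed.

Lemma polytime_fst F : polytime F ->
  polytime (fun w e => fst_pred (code_nodes w) (code_arc w) (F w e)).
Proof.
move=> hF; rewrite /fst_pred; have hn := polytime_nodes.
apply: (polytime_find (b := fun w e j => code_arc w j (F w e))) => //.
apply: polytime_arc; first exact: polytime_var.
exact: polytime_shift.
Qed.

Lemma polytime_lst F : polytime F ->
  polytime (fun w e => lst_pred (code_nodes w) (code_arc w) (F w e)).
Proof.
move=> hF; rewrite /lst_pred; have hn := polytime_nodes.
apply: polytime_sub; first by polytime.
apply: (polytime_find (b := fun w e j => code_arc w ((code_nodes w).-1 - j) (F w e))) => //.
by apply: polytime_arc; [polytime | apply: polytime_shift].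
Qed.

Lemma polytime_lit b F G H I : polytime F -> polytime G -> polytime H -> polytime I ->
  polytime (fun w e => lit_clause (code_weight w) b (F w e) (G w e) (H w e) (I w e)).
Proof.
move=> *; rewrite /lit_clause; have hk := polytime_weight.
by case: b; cbn iota; polytime.
Qed.

Lemma polytime_bot_size n : polytime (fun w e => bot_size (code_weight w) n).
Proof.
have hk := polytime_weight.
by elim: n => [|n IH]; cbn [bot_size]; polytime.
Qed.

Lemma polytime_top_size n : polytime (fun w e => top_size (code_nodes w) (code_weight w) n).
Proof.
have hk := polytime_weight; have hn := polytime_nodes.
by have hb := polytime_bot_size; elim: n => [|n IH]; cbn [top_size]; polytime.
Qed.

Ltac polytime_gate := repeat (cbv beta; first
  [ assumption
  | apply: polytime_nodes | apply: polytime_weight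
  | apply: polytime_bot_size | apply: polytime_top_size
  | apply: polytime_arc | apply: polytime_conj | apply: polytime_indeg
  | apply: polytime_fst | apply: polytime_lst | apply: polytime_lit
  | polytime_step ]).

(** The depth [n] and the claimed value [b] are fixed parameters, not inputs, so the recursion is
    unfolded into one term, whose size depends on [n]. *)
Lemma polytime_bot n b F G H I : polytime F -> polytime G -> polytime H -> polytime I ->
  polytime (fun w e => bot_clause (code_nodes w) (code_weight w) (code_arc w) (code_and w)
    n b (F w e) (G w e) (H w e) (I w e)).
Proof.
elim: n b F G H I => [|n IH] b F G H I hF hG hH hI; cbn [bot_clause].
  by polytime_gate.
apply: polytime_ifb; [by polytime_gate | by polytime_gate |].
apply: polytime_ifb; [by polytime_gate | by apply: IH; polytime_gate |].
apply: polytime_ifb; [by polytime_gate | by apply: IH; polytime_gate |].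
by apply: polytime_or; apply: IH; polytime_gate.
Qed.

Lemma polytime_top n b F O G H I : polytime F -> polytime O -> polytime G ->
  polytime H -> polytime I ->
  polytime (fun w e => top_clause (code_nodes w) (code_weight w) (code_arc w) (code_and w)
    n b (F w e) (O w e) (G w e) (H w e) (I w e)).
Proof.
elim: n b F O G H I => [|n IH] b F O G H I hF hO hG hH hI; cbn [top_clause].
  by polytime_gate.
apply: polytime_ifb; [by polytime_gate | by polytime_gate |].
apply: polytime_ifb; [by polytime_gate | by apply: IH; polytime_gate |].
have hbit : polytime (fun w e => (G w e %/ top_size (code_nodes w) (code_weight w) n == 0)).
  by polytime_gate.
apply: polytime_ifb; first by polytime_gate.
  apply: polytime_or; last by apply: IH; polytime_gate.
  apply: polytime_and; first by polytime_gate.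
  apply: polytime_and; first by polytime_gate.
  (* The inequality compares booleans rather than numbers, so the exclusive or is spelled out with
     conditionals. *)
  apply: (@polytime_nat _ (fun w e =>
     if I w e == 0 then (if G w e %/ top_size (code_nodes w) (code_weight w) n == 0 then 0 else 1)
     else (if G w e %/ top_size (code_nodes w) (code_weight w) n == 0 then 1 else 0))).
    by move=> w e; case: (I w e == 0); case: (_ == 0).
  by polytime_gate.
have hj : polytime (fun w e => G w e %/ bot_size (code_weight w) n) by polytime_gate.
have hc : polytime (fun w e => G w e %% bot_size (code_weight w) n) by polytime_gate.
have hb := polytime_bot n b hj hc hH hI.
by polytime_gate.
Qed.

Lemma polytime_clause F G H : polytime F -> polytime G -> polytime H ->
  polytime (fun w e => red_clause w (F w e) (G w e) (H w e)).
Proof.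
move=> hF hG hH; rewrite /red_clause /clause.
apply: polytime_ifb; [by polytime_gate | | by polytime_gate].
apply: polytime_or; first by polytime_gate.
by apply: polytime_top; polytime_gate.
Qed.

Lemma polytime_vars : polytime (fun w e => red_vars w).
Proof. by rewrite /red_vars /clause_vars; polytime_gate. Qed.

Lemma polytime_count : polytime (fun w e => red_count w).
Proof. by rewrite /red_count /clause_count; polytime_gate. Qed.

Lemma polytime_radius : polytime (fun w e => red_radius w).
Proof. by rewrite /red_radius; polytime_gate. Qed.

Lemma polytime_arcs : polytime (fun w e => arcs_per_track (red_count w) (red_radius w)).
Proof.
have hc := polytime_count; have hr := polytime_radius.
by rewrite /arcs_per_track /cycle_len; polytime.
Qed.

Lemma polytime_period : polytime (fun w e => period (red_radius w)).
Proof.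
apply: polytime_ext (polytime_succ (polytime_add polytime_radius polytime_radius)) => w e.
by rewrite /period addnn.
Qed.

Lemma polytime_track : polytime (fun w e => track_len (red_count w) (red_radius w)).
Proof.
by have hc := polytime_arcs; have hr := polytime_period; rewrite /track_len; polytime.
Qed.

Lemma polytime_order : polytime (fun w e => red_order w).
Proof.
have hc := polytime_track; have hv := polytime_vars; have hn := polytime_count.
by rewrite /red_order /gadget_order; polytime.
Qed.

Lemma polytime_paths : polytime (fun w e => red_paths w).
Proof. by have hc := polytime_arcs; have hv := polytime_vars; rewrite /red_paths; polytime. Qed.

Lemma polytime_attached F G H : polytime F -> polytime G -> polytime H ->
  polytime (fun w e => attached (code_nodes w) (red_radius w) (red_clause w)
    (F w e) (G w e) (H w e)).
Proof.
move=> hF hG hH; rewrite /attached /cycle_len.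
have hn := polytime_nodes; have hr := polytime_radius; have hp := polytime_period.
have hu : polytime (fun w e => H w e %/ (4 * red_radius w) %% period (red_radius w)).
  by polytime.
have hm := polytime_clause hF hG hu.
by polytime.
Qed.

Lemma polytime_red_arc F G : polytime F -> polytime G ->
  polytime (fun w e => arc_nat (red_vars w) (red_count w) (code_nodes w)
    (red_radius w) (red_clause w) (F w e) (G w e)).
Proof.
move=> hF hG; rewrite /arc_nat /cycle_len.
have hn := polytime_track; have hv := polytime_vars; have hc := polytime_count.
have hr := polytime_radius.
have hD : polytime (fun w e => red_vars w * track_len (red_count w) (red_radius w)).
  by polytime.
have h1 : polytime (fun w e => G w e -
    (red_vars w * track_len (red_count w) (red_radius w) + 12)) by polytime.
have h2 : polytime (fun w e => F w e %/ track_len (red_count w) (red_radius w)) by polytime.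
have h3 : polytime (fun w e => F w e %% track_len (red_count w) (red_radius w)) by polytime.
have ha := polytime_attached h1 h2 h3.
by polytime.
Qed.

Lemma polytime_red : polytime_word (fun w e => red_word w).
Proof.
rewrite /red_word; have ho := polytime_order.
apply: polytime_cat; first exact: polytime_nseq.
apply: polytime_cat; first exact: (@polytime_out (fun _ _ => false) (polytime_cst 0)).
apply: polytime_cat; last exact: polytime_nseq polytime_paths.
apply: (polytime_for (G := fun w e i =>
  flatten [seq [:: red_adj w i j] | j <- iota 0 (red_order w)])) => //.
apply: (polytime_for (G := fun w e j => [:: red_adj w (e 0) j])) => //.
apply: polytime_out; rewrite /red_adj /adj_nat.
have h1 := polytime_red_arc (polytime_var 1) (polytime_var 0).
have h2 := polytime_red_arc (polytime_var 0) (polytime_var 1).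
by polytime.
Qed.

End Reduction.

(** A reduction only needs an upper bound on the new parameter, so one construction serves every
    measure that is at most the pathwidth. *)
Lemma W1_hard (kappa : sgraph -> nat) : (forall G, kappa G <= pathwidth (@adj G)) ->
  W_hard 1 (IPP kappa).
Proof.
move=> small Q [d QW].
pose R (x : inst (WCS 1 d)) : inst (IPP kappa) :=
  let w := circuit_code (sval x.1, x.2) in (red_graph d w, red_paths d w).
apply: (@fpt_reduces_polytime Q (WCS 1 d) (IPP kappa) R _ 3 (3 * top_vars d + 17) QW _ _
  (polytime_red d)).
- by move=> [[C /= /asboolP[weft1 depthd]] k]; apply: red_correct.
- move=> [[C h] k]; apply: leq_trans (small _) _.
  exact: red_pathwidth.
- by move=> x; apply: graph_code_red.
Qed.

Theorem theorem2 : W_hard 1 IPP_pathwidth /\ W_hard 1 IPP_treewidth.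
Proof.
by split; apply: W1_hard => G //; apply: treewidth_pathwidth.
Qed.
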